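(* Given an instance $(G,k,h)$ of $\mathcal{T}_{h+1}$-Free Edge Deletion, where $G$ has $n$ vertices and $m$ edges, together with a cluster vertex deletion set $X$ of $G$ of size $\ell$, the problem can be solved in time $\mathcal{O}\!\left((2^{\ell}\ell h^{2})^{\mathcal{O}(2^{\ell}\ell h)}\cdot (n+m)\right)$.
   Context: $\mathcal{T}_{h+1}$-Free Edge Deletion: given a simple undirected graph $G$ and positive integers $k,h$, decide whether there is $F\subseteq E(G)$ with $|F|\le k$ such that every connected component of $G\setminus F$ has at most $h$ vertices. A cluster vertex deletion set is a set $X\subseteq V(G)$ such that $G-X$ is a disjoint union of complete graphs. *)

(* Defs.v *)
From mathcomp Require Import all_boot.

Set Implicit Arguments.
Unset Strict Implicit.
Unset Printing Implicit Defensive.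

(** Simple undirected graphs are symmetric irreflexive relations on a finite
    type; an edge is the two-element set of its ends. *)

Section Graphs.
Variable V : finType.
Implicit Types (e : rel V) (F : {set {set V}}) (X : {set V}).

Definition edges e : {set {set V}} :=
  [set [set p.1; p.2] | p : V * V & e p.1 p.2].

Definition remove_edges e F : rel V :=
  [rel u v | e u v && ([set u; v] \notin F)].

Definition component e (v : V) : {set V} := [set w | connect e v w].

Definition Tfree_edge_deletion e (k h : nat) : Prop :=
  exists F : {set {set V}},
    [/\ F \subset edges e, #|F| <= k &
        forall v : V, #|component (remove_edges e F) v| <= h].

(** The blocks of [P] are the vertex sets of the complete graphs whose disjoint
    union is the subgraph induced on the complement of [X]. *)
Definition cluster_vertex_deletion_set e X : Prop :=
  exists2 P : {set {set V}}, partition P (~: X) &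
    {in ~: X &, forall u v, e u v = (u != v) && (pblock P u == pblock P v)}.

End Graphs.

(** The model of computation is the uniform-cost random access machine, with
    structured control flow in place of jumps.  A state consists of registers
    and of an indirectly addressed memory, both holding natural numbers; a given
    program mentions finitely many registers.  Multiplication and shifts are not
    primitive, because at unit cost on unbounded words they would make the
    machine unrealistically fast. *)

Inductive prog : Type :=
  | Skip
  | Const of nat & nat
  | Add of nat & nat & nat
  | Sub of nat & nat & nat
  | Read of nat & nat
  | Write of nat & nat
  | Seq of prog & prog
  | If of nat & prog & prog
  | While of nat & prog.

Record state : Type := State { regs : nat -> nat; mem : nat -> nat }.

Definition set_reg (s : state) (r x : nat) : state :=
  State [eta regs s with r |-> x] (mem s).

Definition set_mem (s : state) (a x : nat) : state :=
  State (regs s) [eta mem s with a |-> x].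

(** [exec p s t s']: started in [s], the program [p] halts in [s'] after [t]
    steps.  Subtraction is truncated at 0; tests branch on being nonzero. *)
Inductive exec : prog -> state -> nat -> state -> Prop :=
  | exec_skip s : exec Skip s 1 s
  | exec_const s r x : exec (Const r x) s 1 (set_reg s r x)
  | exec_add s r a b :
      exec (Add r a b) s 1 (set_reg s r (regs s a + regs s b))
  | exec_sub s r a b :
      exec (Sub r a b) s 1 (set_reg s r (regs s a - regs s b))
  | exec_read s r a : exec (Read r a) s 1 (set_reg s r (mem s (regs s a)))
  | exec_write s a b : exec (Write a b) s 1 (set_mem s (regs s a) (regs s b))
  | exec_seq p q s s1 s2 t1 t2 :
      exec p s t1 s1 -> exec q s1 t2 s2 -> exec (Seq p q) s (t1 + t2) s2
  | exec_if_true r p q s s1 t :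
      regs s r != 0 -> exec p s t s1 -> exec (If r p q) s t.+1 s1
  | exec_if_false r p q s s1 t :
      regs s r = 0 -> exec q s t s1 -> exec (If r p q) s t.+1 s1
  | exec_while_true r p s s1 s2 t1 t2 :
      regs s r != 0 -> exec p s t1 s1 -> exec (While r p) s1 t2 s2 ->
      exec (While r p) s (t1 + t2).+1 s2
  | exec_while_false r p s : regs s r = 0 -> exec (While r p) s 1 s.

(** The input word occupies memory cells 0, 1, ...; everything else is 0. *)
Definition init_state (input : seq nat) : state :=
  State (fun=> 0) (nth 0 input).

Definition accepting (s : state) : bool := regs s 0 != 0.

(** [adj u] lists the neighbours of [u], in an arbitrary order. *)
Definition adjacency_lists n (e : rel 'I_n) (adj : 'I_n -> seq 'I_n) : Prop :=
  forall u, uniq (adj u) /\ forall v, (v \in adj u) = e u v.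

(** Numbers n, m, k, h, l, then the l vertices of the deletion set, then the n
    vertex degrees, then the n adjacency lists one after the other. *)
Definition encode n (e : rel 'I_n) (k h : nat) (xs : seq 'I_n)
    (adj : 'I_n -> seq 'I_n) : seq nat :=
  [:: n; #|edges e|; k; h; size xs]
    ++ [seq val x | x <- xs]
    ++ [seq size (adj u) | u <- enum 'I_n]
    ++ [seq val v | v <- flatten [seq adj u | u <- enum 'I_n]].

(* Main.v *)
Require Import Defs.
From mathcomp Require Import all_boot.
From mathcomp Require Import zify.

(** Cutting all edges between the parts of a vertex partition shows that one
    looks for a partition into parts of size at most [h] that keeps as many
    edges as possible.  At most [l] parts meet [X]; the others may be taken
    inside a cluster, and a clique is best cut greedily into parts of size [h].
    So a solution is a labelling: a vertex of [X] gets the number of its part,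
    every other vertex the number of a part meeting [X] or 0.  Ordering the
    vertices, with clusters contiguous, the number of kept edges is the sum over
    all vertices of the number [d] of earlier neighbours with the same label,
    with [d %% h] instead of [d] for the label 0.

    For each of the [l ^ l] labellings of [X], a dynamic program runs through
    the other vertices.  Its states record, for each part meeting [X], its size
    and its number of vertices in the current cluster, and it stores the best
    number of kept edges; the number of vertices labelled 0 in the current
    cluster is determined by the state.  There are [(h + 1) ^ (2 l)] states,
    just one if [l = 0], where the running time must not depend on [h]. *)

Set Implicit Arguments.
Unset Strict Implicit.
Unset Printing Implicit Defensive.

(** * Edge deletions as vertex labellings *)

(** Counting a kept edge at its later end lets the objective accumulate along the order: an earlier
    neighbour outside [X] lies in the current cluster, where all pairs are adjacent, so only the
    number of equal labels matters and not which vertices bear them. For label 0, cutting the ranks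
    at multiples of [h] keeps [d %% h] edges at the vertex of rank [d]. No cut does better, because
    a class of at most [h] vertices keeps [0 + 1 + ...] edges, and this is at most any sum of as
    many consecutive residues modulo [h].

    The machine neither multiplies nor divides, and for [l = 0] the bound is a constant times
    [n + m]. Hence each loop of length [h + 1] is nested in a loop over digits, which is empty when
    [l = 0], and remainders modulo [h] are tabulated up to [n] and not up to [h]. The search is
    written in a language whose programs always terminate and carry a clock, so that correctness and
    cost follow from the same rules; compilation multiplies the clock by a constant that depends on
    the program only. *)

Section Ranks.
Variables (V : finType) (pos : V -> nat).
Hypothesis pos_inj : injective pos.
Implicit Types A : {set V}.

Definition rank A (v : V) : nat := #|[set w in A | pos w < pos v]|.

Lemma rank_setD1 A v w :
  {in A, forall u, pos u <= pos v} -> w \in A -> rank (A :\ v) w = rank A w.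
Proof.
move=> vmax wA; apply: eq_card => u; rewrite !inE.
have [->|] := eqVneq u v => //=.
by rewrite ltnNge vmax // andbF.
Qed.

(** Ranks number [A] by [0, ..., #|A| - 1]. The induction removes the element of largest position,
    which changes no other rank. *)
Lemma sum_rank A (phi : nat -> nat) :
  \sum_(v in A) phi (rank A v) = \sum_(0 <= i < #|A|) phi i.
Proof.
move En: #|A| => n; elim: n A En => [|n IH] A En.
  by rewrite big_geq // big1 // => v; rewrite (cards0_eq En) inE.
have [v0 v0A] : exists v0, v0 \in A by apply/card_gt0P; rewrite En.
have [v vA vmax] : exists2 v, v \in A & {in A, forall u, pos u <= pos v}.
  by have [v vA vmax] := arg_maxnP pos v0A; exists v.
have cD : #|A :\ v| = n by move: En; rewrite (cardsD1 v) vA => -[].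
rewrite (bigD1 v) //= big_nat_recr //= addnC -(IH _ cD); congr (_ + _).
  rewrite [RHS](eq_bigl (fun i => (i \in A) && (i != v))); last first.
    by move=> w; rewrite !inE andbC.
  by apply: eq_bigr => w /andP[wA _]; rewrite rank_setD1.
congr phi; rewrite -cD; apply: eq_card => w; rewrite !inE.
have [->|nwv] := eqVneq w v; first by rewrite ltnn andbF.
case wA: (w \in A) => //=; rewrite ltn_neqAle (vmax w wA) andbT.
by apply: contra nwv => /eqP/pos_inj->.
Qed.

Lemma rank_le A v : rank A v <= pos v.
Proof.
rewrite /rank; case: (pos v) => [|m].
  by rewrite leqn0 cards_eq0; apply/eqP/setP => w; rewrite !inE ltn0 andbF.
rewrite -[X in _ <= X]card_ord; pose f w : 'I_m.+1 := inord (pos w).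
rewrite -(card_in_imset (f := f)) ?max_card //.
move=> w w'; rewrite !inE => /andP[_ Hw] /andP[_ Hw'] /(congr1 val).
by rewrite /f /= !inordK //; apply: pos_inj.
Qed.

Lemma sum_pos_ge A : \sum_(0 <= i < #|A|) i <= \sum_(v in A) pos v.
Proof. by rewrite -(sum_rank A id); apply: leq_sum => v _; apply: rank_le. Qed.

End Ranks.

(* [p <= h] consecutive residues modulo [h] are pairwise distinct, so their sum
   is at least [0 + 1 + ... + (p - 1)]. *)
Lemma sum_modn_add h r p : p <= h ->
  \sum_(0 <= i < p) i + \sum_(0 <= i < r) i %% h <= \sum_(0 <= i < p + r) i %% h.
Proof.
move=> ph; rewrite [p + r]addnC [X in _ <= X](@big_cat_nat _ _ _ r) ?leq_addr //= addnC.
rewrite leq_add2l -[X in _ <= \big[_/_]_(X <= i < _) _]add0n big_addn addKn.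
pose f (i : 'I_p) := (i + r) %% h.
have f_inj : injective f.
  move=> i j /eqP; rewrite /f eqn_modDr => /eqP; rewrite !modn_small => [/ord_inj||] //;
  exact: leq_trans (ltn_ord _) ph.
have := sum_pos_ge f_inj [set: 'I_p].
rewrite cardsT card_ord => /leq_trans-> //.
by rewrite big_mkord (eq_bigl xpredT) // => i; rewrite inE.
Qed.

(** Removing one class [K] leaves a smaller set of the same kind. [K] itself contributes
    [0 + ... + (#|K| - 1)] pairs, which [sum_modn_add] absorbs because [#|K| <= h]. Applied to a
    clique, this is the optimality of the greedy cut. *)
Lemma sum_classes_le (V : finType) (pos : V -> nat) (c : rel V) (h : nat) (A : {set V}) :
  injective pos -> equivalence_rel c ->
  (forall v, #|[set w in A | c v w]| <= h) ->
  \sum_(v in A) #|[set w in A | (pos w < pos v) && c v w]| <=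
  \sum_(0 <= i < #|A|) i %% h.
Proof.
move=> pinj ceq; move En: #|A| => n.
have [m lenm] := ubnP n; elim: m => // m IH in n A En lenm *; move=> Ah.
have [->|[v0 v0A]] := set_0Vmem A; first by rewrite big1 // => v; rewrite inE.
pose K := [set w in A | c v0 w].
have KA : K \subset A by apply/subsetP => w; rewrite inE => /andP[].
have KK v w : v \in K -> w \in A -> c v w = (w \in K).
  rewrite !inE => /andP[vA cv] ->; rewrite /=.
  by have [_ /(_ cv)->] := ceq v0 v w.
have csym v w : c v w -> c w v.
  by move=> cvw; have [_ /(_ cvw)<-] := ceq v w v; have [] := ceq v v v.
have v0K : v0 \in K by rewrite inE v0A; have [] := ceq v0 v0 v0.
have cD : #|A :\: K| = n - #|K| by rewrite cardsD (setIidPr KA) En.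
have K0 : 0 < #|K| by apply/card_gt0P; exists v0.
have Kn : #|K| <= n by rewrite -En subset_leq_card.
rewrite (big_setID K) /= (setIidPr KA).
have -> : \sum_(v in K) #|[set w in A | (pos w < pos v) && c v w]| =
          \sum_(0 <= i < #|K|) i.
  rewrite -(sum_rank pinj K id); apply: eq_bigr => v vK; apply: eq_card => w.
  rewrite !inE; case wA: (w \in A) => //=; rewrite (KK v) // andbC inE wA //.
have H : \sum_(v in A :\: K) #|[set w in A | (pos w < pos v) && c v w]| <=
    \sum_(0 <= i < n - #|K|) i %% h.
  have := IH _ (A :\: K) cD _ _; rewrite (eq_bigr (fun v =>
      #|[set w in A | (pos w < pos v) && c v w]|)).
    apply; first lia.
    by move=> v; apply: leq_trans (Ah v); apply: subset_leq_card; apply/subsetP => w;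
      rewrite !inE => /andP[/andP[_ ->]].
  move=> v; rewrite in_setD => /andP[vK vA]; apply: eq_card => w; rewrite in_set in_setD [RHS]in_set.
  case wA: (w \in A); rewrite ?andbF //= andbT.
  case wK: (w \in K) => //=; apply/esym/negP => /andP[_ /csym cwv].
  by move: vK; rewrite -(KK w) ?cwv.
have E : n = #|K| + (n - #|K|) by lia.
rewrite {1}E; apply: leq_trans (sum_modn_add (n - #|K|) (Ah v0)).
by rewrite leq_add2l.
Qed.

(** * Counting edges at their later ends *)

Section Edges.
Variables (V : finType) (pos : V -> nat).
Hypothesis pos_inj : injective pos.

Lemma set2_eq (a b c d : V) :
  [set a; b] = [set c; d] -> (a = c /\ b = d) \/ (a = d /\ b = c).
Proof.
move=> E.
have: a \in [set c; d] by rewrite -E !inE eqxx.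
have: b \in [set c; d] by rewrite -E !inE eqxx orbT.
have: c \in [set a; b] by rewrite E !inE eqxx.
have: d \in [set a; b] by rewrite E !inE eqxx orbT.
rewrite !inE => /orP[] /eqP H1 /orP[] /eqP H2 /orP[] /eqP H3 /orP[] /eqP H4; subst; auto.
Qed.

Lemma card_edges (r : rel V) : symmetric r -> irreflexive r ->
  #|edges r| = \sum_v #|[set w | (pos w < pos v) && r v w]|.
Proof.
move=> rs ri.
have -> : edges r = [set [set p.1; p.2] | p in [set p : V * V | (pos p.2 < pos p.1) && r p.1 p.2]].
  apply/setP => E; apply/imsetP/imsetP => -[[v w]]; rewrite inE /= => Hr ->; last first.
    by case/andP: Hr => _ Hr; exists (v, w); rewrite ?inE.
  case: (ltngtP (pos v) (pos w)) => [lt|lt|/pos_inj Evw].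
  - by exists (w, v); rewrite ?inE /= ?lt 1?rs //= setUC.
  - by exists (v, w); rewrite ?inE /= ?lt.
  - by move: Hr; rewrite Evw ri.
rewrite card_in_imset => [|[v w] [v' w']]; last first.
  rewrite !inE /= => /andP[lt _] /andP[lt' _] /set2_eq[[-> ->]//|[E1 E2]].
  by subst; move: lt; rewrite ltnNge ltnW.
rewrite -sum1_card (eq_bigl (fun p : V * V => true && ((pos p.2 < pos p.1) && r p.1 p.2))); last first.
  by move=> p; rewrite inE.
rewrite -(pair_big_dep xpredT (fun v w => (pos w < pos v) && r v w) (fun _ _ => 1)) /=.
by apply: eq_bigr => v _; rewrite sum1_card cardsE.
Qed.
End Edges.

(** * Equivalence of edge deletions and labellings *)

Section Labelling.
Variables (V : finType) (e : rel V) (X : {set V}) (pos : V -> nat) (h : nat).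
Hypotheses (e_sym : symmetric e) (e_irr : irreflexive e) (pos_inj : injective pos).
Hypothesis h_gt0 : 0 < h.
Hypothesis cluster : forall u v w, u \notin X -> v \notin X -> w \notin X ->
  e u v -> e v w -> u != w -> e u w.

Definition back_degree (f : V -> nat) (v : V) : nat :=
  #|[set w | [&& pos w < pos v, e v w & f w == f v]]|.

(* The vertices labelled 0 of a cluster are cut greedily into groups of size h,
   so the vertex of rank d among them keeps d %% h edges to earlier ones. *)
Definition gain (f : V -> nat) (v : V) : nat :=
  if f v == 0 then back_degree f v %% h else back_degree f v.

(** Label 0 is exempt from the size bound: its vertices are cut further, inside their clusters. *)
Definition proper (l : nat) (f : V -> nat) : Prop :=
  [/\ {in X, forall v, 0 < f v}, forall v, f v <= l &
      forall j, 0 < j -> #|[set v | f v == j]| <= h].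

Section Sound.
Variables (l : nat) (f : V -> nat).
Hypothesis f_proper : proper l f.

Let d := back_degree f.

Let f0X v : f v = 0 -> v \notin X.
Proof. by have [fX _ _] := f_proper; move=> fv; apply/negP => /fX; rewrite fv. Qed.

Let near v w := (v == w) || e v w.

Let near_trans u v w : f u = 0 -> f v = 0 -> f w = 0 -> near u v -> near v w -> near u w.
Proof.
rewrite /near => /f0X uX /f0X vX /f0X wX.
have [->//|nuv] := eqVneq u v; have [<-|nvw] := eqVneq v w; first by move=> /= euv _; rewrite euv orbT.
have [//|nuw] := eqVneq u w; rewrite /= => euv evw.
exact: cluster euv evw _.
Qed.

Let near_sym u v : near u v = near v u.
Proof. by rewrite /near eq_sym e_sym. Qed.

(** Membership in the same part of the solution. For label 0 the parts are the blocks of [h]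
    consecutive values of [d] within a cluster. *)
Let same v w := (f v == f w) && ((f v == 0) ==> near v w && (d v %/ h == d w %/ h)).

Let same_sym v w : same v w = same w v.
Proof.
rewrite /same eq_sym; case: eqP => //= ->.
by rewrite near_sym [X in _ && X]eq_sym.
Qed.

Let same_trans u v w : same u v -> same v w -> same u w.
Proof.
rewrite /same => /andP[/eqP Euv Huv] /andP[/eqP Evw Hvw].
rewrite Euv Evw eqxx /=; apply/implyP => /eqP w0.
move: Huv Hvw; rewrite Euv Evw w0 eqxx /= => /andP[nuv /eqP->] /andP[nvw /eqP->].
by rewrite eqxx andbT; apply: near_trans nuv nvw; rewrite ?Euv ?Evw ?w0.
Qed.

(** By transitivity in the cluster, the earlier neighbours of [w] are neighbours of [v] too, and [w]
    itself is one more. So [d] ranks the vertices labelled 0 of a cluster. *)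
Let d_mono v w : f v = 0 -> f w = 0 -> e v w -> pos w < pos v -> d w < d v.
Proof.
move=> fv fw evw lt; apply: proper_card; apply/properP; split.
  apply/subsetP => u; rewrite !inE fw => /and3P[lt' ewu /eqP fu].
  rewrite (ltn_trans lt' lt) fu fv eqxx andbT /=.
  have := @near_trans v w u fv fw fu; rewrite /near evw ewu !orbT => /(_ isT isT).
  by case/orP=> // /eqP Evu; move: lt'; rewrite -Evu ltnNge ltnW.
by exists w; rewrite !inE ?lt ?evw ?fv ?fw // ltnn.
Qed.

Let d_inj v w : f v = 0 -> f w = 0 -> near v w -> d v = d w -> v = w.
Proof.
move=> fv fw; case/orP => [/eqP//|evw] Ed.
case: (ltngtP (pos v) (pos w)) => [lt|lt|/pos_inj//].
  by have := d_mono fw fv; rewrite e_sym evw lt Ed ltnn => /(_ isT isT).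
by have := d_mono fv fw evw lt; rewrite Ed ltnn.
Qed.

Let card_ge_inj (A : {set V}) (m b : nat) (g : V -> nat) :
  {in A &, injective g} -> {in A, forall v, m <= g v < m + b} -> #|A| <= b.
Proof.
case: b => [|b] gI gm.
  by rewrite leqn0 cards_eq0; apply/eqP/setP => v; rewrite inE; apply/negP => /gm; lia.
rewrite -[b.+1]card_ord -(card_in_imset (f := fun v => inord (g v - m) : 'I_b.+1)) ?max_card //.
move=> v w vA wA /(congr1 val); have := gm _ vA; have := gm _ wA => H1 H2.
by rewrite /= !inordK; try lia; move=> E; apply: gI => //; lia.
Qed.

Let card_same v : #|[set w | same v w]| <= h.
Proof.
have [_ _ fh] := f_proper; case: (posnP (f v)) => fv; last first.
  apply: leq_trans (fh _ fv); apply: subset_leq_card; apply/subsetP => w.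
  by rewrite !inE eq_sym => /andP[].
apply: (card_ge_inj (m := d v %/ h * h) (g := d)) => [w w'|w].
  rewrite !inE /same fv => /andP[/eqP/esym fw /andP[nw _]] /andP[/eqP/esym fw' /andP[nw' _]].
  by apply: d_inj => //; apply: (@near_trans _ v) => //; rewrite near_sym.
rewrite inE /same => /andP[_]; rewrite fv /= => /andP[_ /eqP->].
by rewrite leq_divM addnC {1}(divn_eq (d w) h) addnC ltn_add2r ltn_mod.
Qed.

(** For label 0, the earlier neighbours that are cut off lie in lower blocks. As [d] is injective on
    them, there are at most [d v %/ h * h], and at least [d v %% h] of the [d v] remain. *)
Let gain_le v : gain f v <= #|[set w | (pos w < pos v) && (e v w && same v w)]|.
Proof.
rewrite /gain; case: eqP => fv; last first.
  apply: subset_leq_card; apply/subsetP => w; rewrite !inE => /and3P[-> -> /eqP Ew] /=.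
  by rewrite /same Ew eqxx; case: eqP.
set A := [set w | _]; pose S := [set w | [&& pos w < pos v, e v w & f w == f v]].
have SA w : w \in S :\: A -> [/\ f w = 0, e v w & d w < d v %/ h * h].
  rewrite !inE fv => /andP[H /and3P[lt evw /eqP fw]]; split=> //.
  have dl := d_mono fv fw evw lt.
  move: H; rewrite lt evw /= /same fv fw eqxx /= /near evw orbT /=.
  rewrite ltnNge; apply: contra => le; rewrite eqn_leq; apply/andP; split; last first.
    by rewrite leq_div2r // ltnW.
  by rewrite leq_divRL.
have: #|S :\: A| <= d v %/ h * h.
  apply: (card_ge_inj (m := 0) (g := d)) => [w w'|w].
    move=> /SA[fw ew _] /SA[fw' ew' _]; apply: d_inj => //.
    by apply: (@near_trans _ v) => //; rewrite /near ?[e w v]e_sym ?ew ?ew' orbT.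
  by case/SA.
have : #|S| = d v by [].
have : #|S :&: A| <= #|A| by rewrite subset_leq_card // subsetIr.
have := cardsID A S; rewrite -/(d v); have := divn_eq (d v) h; lia.
Qed.

Lemma labelling_sound k : #|edges e| <= k + \sum_v gain f v -> Tfree_edge_deletion e k h.
Proof.
move=> Hk; pose r : rel V := fun v w => e v w && same v w.
have rs : symmetric r by move=> v w; rewrite /r e_sym same_sym.
have ri : irreflexive r by move=> v; rewrite /r e_irr.
have re : edges r \subset edges e.
  apply/subsetP => E /imsetP[p]; rewrite inE => /andP[ep _] ->.
  by apply/imsetP; exists p; rewrite ?inE.
(* Exactly the edges between different parts are deleted, so a path in the remaining graph never
   leaves a class of [same]. *)
exists (edges e :\: edges r); split; first exact: subsetDl.
  rewrite cardsD (setIidPr re) leq_subLR addnC; apply: leq_trans Hk _.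
  rewrite leq_add2l (card_edges pos_inj rs ri).
  by apply: leq_sum => v _; apply: gain_le.
move=> v; apply: leq_trans (card_same v); apply: subset_leq_card.
apply/subsetP => w; rewrite !inE => /connectP[p].
have sv : same v v by rewrite /same !eqxx /near eqxx /= implybT.
elim/last_ind: p w => [|p u IH] w /=; first by move=> _ ->.
rewrite rcons_path last_rcons => /andP[pp step] ->.
apply: same_trans (IH _ pp (erefl _)) _; move: step; rewrite /= => /andP[evu].
rewrite inE => /negP H; case Er: (r (last v p) u); first by case/andP: Er.
case: H; apply/andP; split; last first.
  by apply/imsetP; exists (last v p, u); rewrite ?inE.
apply/imsetP => -[[a b]]; rewrite inE /= => rab /set2_eq[[E1 E2]|[E1 E2]].
  by move: Er; rewrite E1 E2 rab.
by move: Er; rewrite E1 E2 rs rab.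
Qed.

End Sound.

Lemma labelling_complete k : Tfree_edge_deletion e k h ->
  exists2 f, proper #|X| f & #|edges e| <= k + \sum_v gain f v.
Proof.
case=> F [Fe Fk Fh]; set r := remove_edges e F.
have rs : symmetric r by move=> v w; rewrite /r /remove_edges /= e_sym setUC.
have ri : irreflexive r by move=> v; rewrite /r /remove_edges /= e_irr.
have cs : connect_sym r by exact: sym_connect_sym.
have Er : edges r = edges e :\: F.
  apply/setP => E; rewrite inE; apply/idP/andP.
    case/imsetP => -[v w]; rewrite inE /= => /andP[evw nF] ->; split=> //.
    by apply/imsetP; exists (v, w); rewrite ?inE.
  case=> nF /imsetP[[v w]]; rewrite inE /= => evw EE; apply/imsetP; exists (v, w) => //.
  by rewrite inE /r /remove_edges /= evw -EE.
have Ec : #|edges e| = #|F| + #|edges r|.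
  by rewrite Er -(cardsID F) (setIidPr Fe).
pose xs := enum X.
(* A component that meets [X] is named after its first vertex in [xs]; the successor reserves 0 for
   the components that avoid [X]. *)
pose f v := if has (connect r v) xs then (find (connect r v) xs).+1 else 0.
have fconn v w : connect r v w -> f v = f w.
  move=> cvw; have E : connect r v =1 connect r w by apply: same_connect.
  by rewrite /f (eq_has E) (eq_find E).
have fpos v : 0 < f v -> exists2 x, nth x xs (f v).-1 = x & connect r v x.
  rewrite /f; case: ifP => // /[dup] Hh /hasP[x0 _ _] _ /=.
  exists (nth x0 xs (find (connect r v) xs)); last exact: nth_find.
  by apply: set_nth_default; rewrite -has_find.
have feq v w : 0 < f v -> f v = f w -> connect r v w.
  move=> fv E; have [x Ex cx] := fpos v fv.
  have [y Ey cy] : exists2 y, nth y xs (f w).-1 = y & connect r w y by apply: fpos; rewrite -E.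
  have Exy : x = y.
    rewrite -Ex -Ey E; apply: set_nth_default.
    move: fv; rewrite E /f; case: ifP => // Hh _; by rewrite -has_find.
  by apply: connect_trans cx _; rewrite cs Exy.
have fX v : v \in X -> 0 < f v.
  by move=> vX; rewrite /f; case: hasP => // -[]; exists v; rewrite ?mem_enum.
exists f.
  split=> // [v|j j0].
    by rewrite /f; case: ifP => //; rewrite has_find cardE.
  have [->|[v]] := set_0Vmem [set v | f v == j]; first by rewrite cards0.
  rewrite inE => /eqP fv; apply: leq_trans (Fh v); apply: subset_leq_card.
  by apply/subsetP => w; rewrite !inE => /eqP fw; apply: feq; rewrite ?fv ?fw.
rewrite Ec leq_add // (card_edges pos_inj rs ri).
rewrite [X in X <= _](bigID (fun v => f v == 0)) [X in _ <= X](bigID (fun v => f v == 0)) /=.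
apply: leq_add; last first.
  apply: leq_sum => v fv; rewrite /gain (negbTE fv); apply: subset_leq_card.
  apply/subsetP => w; rewrite !inE => /andP[-> rvw]; rewrite /= (fconn v w) ?connect1 // eqxx.
  by case/andP: rvw => ->.
pose Z := [set v | f v == 0].
have ZX v : v \in Z -> v \notin X by rewrite inE => /eqP fv; apply/negP => /fX; rewrite fv.
(* For [v] labelled 0, [kap v] is the set of vertices labelled 0 in its cluster; regrouping both
   sums by [kap] treats one cluster at a time. *)
pose kap v := [set w in Z | (v == w) || e v w].
rewrite [X in X <= _](partition_big kap xpredT) //= [X in _ <= X](partition_big kap xpredT) //=.
apply: leq_sum => K _.
pose A := [set v in Z | kap v == K].
have Ae : {in A &, forall v w, v != w -> e v w}.
  move=> v w; rewrite !inE => /andP[vZ /eqP kv] /andP[wZ /eqP kw] nvw.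
  have : w \in kap v by rewrite kv -kw !inE wZ eqxx.
  by rewrite !inE (negbTE nvw) => /andP[].
have Ak v w : v \in A -> w \in Z -> e v w -> w \in A.
  move=> vA wZ evw; have vZ : v \in Z by move: vA; rewrite inE => /andP[].
  move: vA; rewrite !in_set => /andP[_ /eqP<-]; have fw : f w == 0 by move: wZ; rewrite inE.
  rewrite fw /=.
  apply/eqP/setP => u; rewrite !in_set; case uZ: (f u == 0) => //=.
  have uX : u \notin X by apply: ZX; rewrite inE.
  have [vX wX] := (ZX v vZ, ZX w wZ).
  have [<-|nwu] := eqVneq w u; first by rewrite evw orbT.
  have [<-|nvu] := eqVneq v u; first by rewrite e_sym evw.
  rewrite /=; apply/idP/idP => H; first exact: cluster H _.
  by apply: (@cluster w v u); rewrite // e_sym.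
have R v : v \in A -> back_degree f v = rank pos A v.
  move=> vA; apply: eq_card => w; rewrite !in_set.
  have vZ : v \in Z by move: vA; rewrite inE => /andP[].
  have fv : f v = 0 by move: vZ; rewrite inE => /eqP.
  rewrite fv; case wA: (w \in A).
    move: (wA); rewrite in_set in_set => /andP[fw ->].
    case lt: (pos w < pos v) => //=; rewrite ?andbF // fw !andbT.
    by apply: Ae => //; apply: contraTneq lt => ->; rewrite ltnn.
  case: andP => [[_ /andP[evw fw]]|_].
    by move: (Ak v w vA); rewrite wA inE evw fw => /(_ isT isT).
  by move: wA; rewrite !in_set => ->.
(* The components of [r] cut the clique [A] into classes of at most [h] vertices, while back degrees
   in [A] are ranks, so the gains add up to the value of the greedy cut. *)
have : \sum_(v in A) #|[set w in A | (pos w < pos v) && connect r v w]| <=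
   \sum_(0 <= i < #|A|) i %% h.
  apply: sum_classes_le => //.
    by move=> x y z; split=> [|cxy]; [apply: connect0|apply: same_connect].
  move=> v; apply: leq_trans (Fh v); apply: subset_leq_card.
  by apply/subsetP => w; rewrite !inE => /andP[].
rewrite -(sum_rank pos_inj A (fun i => i %% h)) => H.
have AE : (fun v => (f v == 0) && (kap v == K)) =1 mem A by move=> v; rewrite /= !inE.
rewrite (eq_bigl (mem A) _ AE) [X in _ <= X](eq_bigl (mem A) _ AE).
apply: leq_trans (leq_trans _ H) _; last first.
  apply: leq_sum => v vA; rewrite /gain -R //.
  by have : v \in A; rewrite // !in_set => /andP[->].
apply: leq_sum => v vA; apply: subset_leq_card; apply/subsetP => w.
rewrite !in_set => /andP[-> rvw] /=; rewrite connect1 // andbT.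
have : w \in A; last by rewrite !in_set.
have fv : f v == 0 by have : v \in A; rewrite // !in_set => /andP[].
apply: Ak vA _ _; last by case/andP: rvw.
by rewrite inE -(fconn v w) ?connect1.
Qed.

End Labelling.

(** * A language of arrays and bounded loops, compiled to the random access machine *)

(** [EC] is a constant, [EV] a scalar variable, [EI] a cell of the input, which is never
    overwritten, and [EA] an array entry. *)
Inductive expr : Type :=
  | EC of nat
  | EV of nat
  | EI of expr
  | EA of nat & expr
  | EAdd of expr & expr
  | ESub of expr & expr.

Inductive com : Type :=
  | CSet of nat & expr
  | CPut of nat & expr & expr
  | CSeq of com & com
  | CIf of expr & com & com
  | CFor of nat & expr & com.

(** The clock [ck] is part of the store but invisible to programs; it counts assignments, tests and
    loop rounds. *)
Record store : Type := Store { sv : nat -> nat; sa : nat -> nat -> nat; ck : nat }.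

Definition tick (s : store) : store := Store (sv s) (sa s) (ck s).+1.
Definition setv (s : store) (x k : nat) : store :=
  Store (fun y => if y == x then k else sv s y) (sa s) (ck s).
Definition seta (s : store) (a i k : nat) : store :=
  Store (sv s) (fun b j => if (b == a) && (j == i) then k else sa s b j) (ck s).

(** * Semantics with a clock, and rules for correctness together with time *)

Section Semantics.
Variable inp : seq nat.

Fixpoint eval (s : store) (e : expr) : nat :=
  match e with
  | EC k => k
  | EV x => sv s x
  | EI e => nth 0 inp (eval s e)
  | EA a e => sa s a (eval s e)
  | EAdd e1 e2 => eval s e1 + eval s e2
  | ESub e1 e2 => eval s e1 - eval s e2
  end.

(** The bound of a loop is evaluated once, before the first round, so [run] is a total function.
    Every round has a tick of its own besides those of the body. *)
Fixpoint run (c : com) (s : store) : store :=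
  match c with
  | CSet x e => setv (tick s) x (eval s e)
  | CPut a e1 e2 => seta (tick s) a (eval s e1) (eval s e2)
  | CSeq c1 c2 => run c2 (run c1 s)
  | CIf e c1 c2 => if eval s e != 0 then run c1 (tick s) else run c2 (tick s)
  | CFor x e b =>
      iter (eval s e)
        (fun s' => let s1 := run b s' in setv (tick s1) x (sv s1 x).+1)
        (setv (tick s) x 0)
  end.

Fixpoint mod_vars (c : com) : seq nat :=
  match c with
  | CSet x _ => [:: x]
  | CPut _ _ _ => [::]
  | CSeq c1 c2 | CIf _ c1 c2 => mod_vars c1 ++ mod_vars c2
  | CFor x _ b => x :: mod_vars b
  end.

Fixpoint mod_arrays (c : com) : seq nat :=
  match c with
  | CSet _ _ => [::]
  | CPut a _ _ => [:: a]
  | CSeq c1 c2 | CIf _ c1 c2 => mod_arrays c1 ++ mod_arrays c2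
  | CFor _ _ b => mod_arrays b
  end.

Definition frame (vs ars : seq nat) (s s' : store) : Prop :=
  (forall x, x \notin vs -> sv s' x = sv s x) /\
  (forall a, a \notin ars -> sa s' a =1 sa s a).

Lemma frame_trans vs ars s1 s2 s3 :
  frame vs ars s1 s2 -> frame vs ars s2 s3 -> frame vs ars s1 s3.
Proof.
move=> [V1 A1] [V2 A2]; split=> [x Hx|a Ha i]; first by rewrite V2 ?V1.
by rewrite A2 ?A1.
Qed.

Lemma frame_sub vs ars vs' ars' s s' :
  {subset vs <= vs'} -> {subset ars <= ars'} ->
  frame vs ars s s' -> frame vs' ars' s s'.
Proof.
move=> sV sA [V A]; split=> [x Hx|a Ha]; [apply: V | apply: A].
  by apply: contra Hx; apply: sV.
by apply: contra Ha; apply: sA.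
Qed.

Lemma frame_setv vs ars s s' x k :
  x \in vs -> frame vs ars s s' -> frame vs ars s (setv (tick s') x k).
Proof.
move=> xv [V A]; split=> [y Hy|a Ha i] /=; last exact: A.
by rewrite V //; case: eqP Hy => // ->; rewrite xv.
Qed.

Lemma frame_all vs ars vs' ars' s s' :
  all [in vs'] vs -> all [in ars'] ars -> frame vs ars s s' -> frame vs' ars' s s'.
Proof. by move=> /allP sV /allP sA; apply: frame_sub. Qed.

Lemma run_frame c s : frame (mod_vars c) (mod_arrays c) s (run c s).
Proof.
have catl (T : eqType) (p q : seq T) : {subset p <= p ++ q}.
  by move=> x; rewrite mem_cat => ->.
have catr (T : eqType) (p q : seq T) : {subset q <= p ++ q}.
  by move=> x; rewrite mem_cat orbC => ->.
elim: c s => [x e|a e1 e2|c1 IH1 c2 IH2|e c1 IH1 c2 IH2|x e b IH] s /=.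
- by split=> //= y; rewrite inE => /negbTE->.
- by split=> //= b; rewrite inE => /negbTE->.
- apply: frame_trans (frame_sub _ _ (IH1 s)) (frame_sub _ _ (IH2 _));
  by [apply: catl | apply: catr].
- case: ifP => _; first exact: frame_sub (catl _ _ _) (catl _ _ _) (IH1 (tick s)).
  exact: frame_sub (catr _ _ _) (catr _ _ _) (IH2 (tick s)).
- elim: (eval s e) => [|k IHk] /=.
    by split=> //= y; rewrite inE negb_or => /andP[/negbTE->].
  apply: frame_trans IHk _; set s' := iter _ _ _.
  have [V A] := IH s'; split=> [y|a Ha j] /=; last exact: A.
  by rewrite inE negb_or => /andP[/negbTE-> Hy]; apply: V.
Qed.

(** Needed to charge the machine steps of a command to its clock. *)
Lemma run_clock c s : ck s < ck (run c s).
Proof.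
elim: c s => [x e|a e1 e2|c1 IH1 c2 IH2|e c1 IH1 c2 IH2|x e b IH] s //=.
- exact: ltn_trans (IH1 s) (IH2 _).
- by case: ifP => _; apply: ltn_trans (ltnSn _) _; [apply: IH1|apply: IH2].
- elim: (eval s e) => [|k IHk] //=.
  by apply: ltn_trans IHk _; apply: ltn_trans (IH _) _.
Qed.

Definition wp (c : com) (s : store) (t : nat) (Q : store -> Prop) : Prop :=
  Q (run c s) /\ ck (run c s) <= ck s + t.

Lemma wp_conseq c s t t' (Q Q' : store -> Prop) :
  t <= t' -> (forall s', Q s' -> Q' s') -> wp c s t Q -> wp c s t' Q'.
Proof.
by move=> le_tt' QQ' [Qs Ht]; split; [apply: QQ' | apply: leq_trans Ht _; rewrite leq_add2l].
Qed.

Lemma wp_seq c1 c2 s t1 t2 (Q : store -> Prop) :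
  wp c1 s t1 (fun s1 => wp c2 s1 t2 Q) -> wp (CSeq c1 c2) s (t1 + t2) Q.
Proof.
move=> [[Qs H2] H1]; split=> //=; rewrite addnA; apply: leq_trans H2 _.
by rewrite leq_add2r.
Qed.

(** Whatever a command does not assign syntactically is unchanged, so specifications need to mention
    only what they compute. *)
Lemma wp_frame c s t (Q : store -> Prop) :
  wp c s t (fun s' => frame (mod_vars c) (mod_arrays c) s s' -> Q s') -> wp c s t Q.
Proof. by case=> QF H; split=> //; apply/QF/run_frame. Qed.

Lemma wp_if e c1 c2 s t (Q : store -> Prop) :
  (eval s e != 0 -> wp c1 (tick s) t Q) -> (eval s e = 0 -> wp c2 (tick s) t Q) ->
  wp (CIf e c1 c2) s t.+1 Q.
Proof.
rewrite /wp /= addnS; case: eqP => [E _ /(_ E)|_ /(_ isT)] //=.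
Qed.

Lemma wp_set x e s (Q : store -> Prop) :
  Q (setv (tick s) x (eval s e)) -> wp (CSet x e) s 1 Q.
Proof. by rewrite /wp /= addn1. Qed.

Lemma wp_put a e1 e2 s (Q : store -> Prop) :
  Q (seta (tick s) a (eval s e1) (eval s e2)) -> wp (CPut a e1 e2) s 1 Q.
Proof. by rewrite /wp /= addn1. Qed.

Lemma wp_for_sum (I : nat -> store -> Prop) (t : nat -> nat) x e b s k :
  eval s e = k ->
  I 0 (setv (tick s) x 0) ->
  (forall i s', i < k -> sv s' x = i ->
     frame (x :: mod_vars b) (mod_arrays b) s s' -> I i s' ->
     wp b s' (t i) (fun s1 => sv s1 x = i /\ I i.+1 (setv (tick s1) x i.+1))) ->
  wp (CFor x e b) s (\sum_(0 <= i < k) (t i).+1).+1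
     (fun s' => [/\ I k s', sv s' x = k &
                 frame (x :: mod_vars b) (mod_arrays b) s s']).
Proof.
move=> Hk I0 Hstep; rewrite /wp /= Hk.
suff H j : j <= k ->
    let s' := iter j (fun s' => let s1 := run b s' in setv (tick s1) x (sv s1 x).+1)
                (setv (tick s) x 0) in
    [/\ I j s', sv s' x = j, frame (x :: mod_vars b) (mod_arrays b) s s' &
        ck s' <= ck s + (\sum_(0 <= i < j) (t i).+1).+1].
  by have [] := H k (leqnn k).
elim: j => [|j IHj] Hj /=.
  split=> //=; first by rewrite eqxx.
    by split=> //= y; rewrite inE negb_or => /andP[/negbTE->].
  by rewrite big_geq // addn1.
have [Ij xj Fj cj] := IHj (ltnW Hj); move: Ij xj Fj cj.
set s' := iter _ _ _ => Ij xj Fj cj.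
have [[x1 I1] c1] := Hstep j s' Hj xj Fj Ij.
split; rewrite ?x1 //=; first by rewrite eqxx.
  apply: frame_trans Fj _; have [V A] := run_frame b s'.
  split=> [y|a Ha i] /=; last exact: A.
  by rewrite inE negb_or => /andP[/negbTE-> Hy]; apply: V.
rewrite big_nat_recr //=; lia.
Qed.

Lemma wp_for (I : nat -> store -> Prop) (t : nat) x e b s k :
  eval s e = k ->
  I 0 (setv (tick s) x 0) ->
  (forall i s', i < k -> sv s' x = i ->
     frame (x :: mod_vars b) (mod_arrays b) s s' -> I i s' ->
     wp b s' t (fun s1 => sv s1 x = i /\ I i.+1 (setv (tick s1) x i.+1))) ->
  wp (CFor x e b) s (k * t.+1).+1
     (fun s' => [/\ I k s', sv s' x = k &
                 frame (x :: mod_vars b) (mod_arrays b) s s']).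
Proof.
move=> Hk I0 Hs; have := wp_for_sum (t := fun=> t) Hk I0 Hs.
by rewrite sum_nat_const_nat subn0.
Qed.

End Semantics.

(* Scalar [x] lives in register [2 x], temporaries in the odd registers.  All
   arrays are infinite and share the memory above the input: temporary 0 holds
   the first free address [base], and entry [i] of array [a] has the address
   [base + 2 ^ a * (2 i + 1)]. *)
Definition rv (x : nat) : nat := x.*2.
Definition rt (d : nat) : nat := d.*2.+1.

Fixpoint doublings (r a : nat) : prog :=
  if a is a'.+1 then Seq (Add r r r) (doublings r a') else Skip.

Definition comp_addr (d a : nat) : prog :=
  Seq (Const (rt d.+1) 1) (Seq (Add (rt d) (rt d) (rt d))
    (Seq (Add (rt d) (rt d) (rt d.+1))
      (Seq (doublings (rt d) a) (Add (rt d) (rt d) (rt 0))))).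

(** The value is left in temporary [d], and lower temporaries are preserved, so [d] is the height of
    an evaluation stack. Reading the input is guarded by the comparison with [base]: from there on
    the memory holds arrays, whereas [nth 0] yields 0. *)
Fixpoint comp_expr (d : nat) (e : expr) : prog :=
  match e with
  | EC k => Const (rt d) k
  | EV x => Seq (Const (rt d) 0) (Add (rt d) (rt d) (rv x))
  | EI e => Seq (comp_expr d e)
             (Seq (Defs.Sub (rt d.+1) (rt 0) (rt d))
                  (If (rt d.+1) (Read (rt d) (rt d)) (Const (rt d) 0)))
  | EA a e => Seq (comp_expr d e) (Seq (comp_addr d a) (Read (rt d) (rt d)))
  | EAdd e1 e2 => Seq (comp_expr d e1)
                    (Seq (comp_expr d.+1 e2) (Add (rt d) (rt d) (rt d.+1)))
  | ESub e1 e2 => Seq (comp_expr d e1)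
                    (Seq (comp_expr d.+1 e2) (Defs.Sub (rt d) (rt d) (rt d.+1)))
  end.

(** A loop counts the remaining rounds down in temporary [d], so its body is compiled one level
    higher, while the loop variable counts up. *)
Fixpoint compile (d : nat) (c : com) : prog :=
  match c with
  | CSet x e => Seq (comp_expr d e) (Seq (Const (rv x) 0) (Add (rv x) (rv x) (rt d)))
  | CPut a e1 e2 => Seq (comp_expr d e1) (Seq (comp_addr d a)
                      (Seq (comp_expr d.+1 e2) (Write (rt d) (rt d.+1))))
  | CSeq c1 c2 => Seq (compile d c1) (compile d c2)
  | CIf e c1 c2 => Seq (comp_expr d e) (If (rt d) (compile d c1) (compile d c2))
  | CFor x e b =>
      Seq (comp_expr d e) (Seq (Const (rv x) 0)
        (While (rt d) (Seq (compile d.+1 b)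
          (Seq (Const (rt d.+1) 1)
            (Seq (Add (rv x) (rv x) (rt d.+1)) (Defs.Sub (rt d) (rt d) (rt d.+1)))))))
  end.

Definition addr (base a i : nat) : nat := base + 2 ^ a * i.*2.+1.

(** The 2-adic valuation of the offset determines the array, its odd part the index. *)
Lemma addr_inj base a i b j : (addr base a i == addr base b j) = (a == b) && (i == j).
Proof.
rewrite /addr eqn_add2l; apply/eqP/andP => [E|[/eqP-> /eqP->]] //.
have lg c k : logn 2 (2 ^ c * k.*2.+1) = c.
  by rewrite lognM ?expn_gt0 // pfactorK // logn_coprime ?addn0 // coprime2n /= odd_double.
have Eab : a = b by rewrite -(lg a i) E lg.
split; apply/eqP=> //; move/eqP: E.
by rewrite Eab eqn_pmul2l ?expn_gt0 // eqSS => /eqP/double_inj.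
Qed.

(** The exact running time of the compiled expression; both branches of the guard for [EI] take
    equally long. *)
Fixpoint esize (e : expr) : nat :=
  match e with
  | EC _ => 1
  | EV _ => 2
  | EI e => esize e + 3
  | EA a e => esize e + (a + 6)
  | EAdd e1 e2 | ESub e1 e2 => esize e1 + esize e2 + 1
  end.

Fixpoint csize (c : com) : nat :=
  match c with
  | CSet x e => esize e + 2
  | CPut a e1 e2 => esize e1 + esize e2 + (a + 7)
  | CSeq c1 c2 => csize c1 + csize c2
  | CIf e c1 c2 => esize e + 1 + csize c1 + csize c2
  | CFor x e b => esize e + 6 + csize b
  end.

(** * Correctness and overhead of the compiler *)

Section Compiler.
Variables (inp : seq nat) (base : nat).
Hypothesis size_inp : size inp <= base.

(** The registers that expression code at level [d] leaves alone: the scalars, which are even, and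
    the temporaries below [d]. *)
Definition low (d r : nat) : bool := ~~ odd r || (r < rt d).

Definition rel_state (hs : store) (s : state) : Prop :=
  [/\ regs s (rt 0) = base, forall x, regs s (rv x) = sv hs x,
      forall i, i < base -> Defs.mem s i = nth 0 inp i &
      forall a i, Defs.mem s (addr base a i) = sa hs a i].

Lemma rel_state_low d hs s s' :
  0 < d -> (forall r, low d r -> regs s' r = regs s r) -> Defs.mem s' =1 Defs.mem s ->
  rel_state hs s -> rel_state hs s'.
Proof.
move=> d0 R M [B V I A]; split.
- by rewrite R // /low /rt; lia.
- by move=> x; rewrite R ?V // /low /rv odd_double.
- by move=> i Hi; rewrite M I.
- by move=> a i; rewrite M A.
Qed.

Lemma doublings_ok r a s :
  exists s', [/\ exec (doublings r a) s a.+1 s', regs s' r = 2 ^ a * regs s r,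
    forall r', r' != r -> regs s' r' = regs s r' & Defs.mem s' = Defs.mem s].
Proof.
elim: a s => [|a IH] s.
  by exists s; split=> //; rewrite ?mul1n //; constructor.
have [s' [E1 E2 E3 E4]] := IH (set_reg s r (regs s r + regs s r)).
exists s'; split=> //.
- by apply: (exec_seq (t1 := 1)) E1; constructor.
- by rewrite E2 /= eqxx addnn -mul2n mulnA expnSr.
- by move=> r' Hr; rewrite E3 //= (negbTE Hr).
Qed.

Lemma comp_addr_ok d a s :
  0 < d -> regs s (rt 0) = base ->
  exists s', [/\ exec (comp_addr d a) s (a + 5) s',
    regs s' (rt d) = addr base a (regs s (rt d)),
    forall r, low d r -> regs s' r = regs s r & Defs.mem s' = Defs.mem s].
Proof.
move=> d0 B.
pose s1 := set_reg s (rt d.+1) 1.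
pose s2 := set_reg s1 (rt d) (regs s1 (rt d) + regs s1 (rt d)).
pose s3 := set_reg s2 (rt d) (regs s2 (rt d) + regs s2 (rt d.+1)).
have [s4 [E1 E2 E3 E4]] := doublings_ok (rt d) a s3.
exists (set_reg s4 (rt d) (regs s4 (rt d) + regs s4 (rt 0))).
have nd : (rt d == rt d.+1) = false by rewrite /rt; lia.
have nd' : (rt d.+1 == rt d) = false by rewrite /rt; lia.
have n0 : (rt 0 == rt d) = false by rewrite /rt; lia.
have n0' : (rt 0 == rt d.+1) = false by rewrite /rt; lia.
split.
- rewrite (_ : a + 5 = 1 + (1 + (1 + (a.+1 + 1)))); last lia.
  apply: exec_seq (exec_const _ _ _) _.
  apply: exec_seq (exec_add _ _ _ _) _.
  apply: exec_seq (exec_add _ _ _ _) _.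
  by apply: exec_seq E1 _; constructor.
- rewrite /= eqxx E2 E3 ?n0 // /s3 /s2 /s1 /= !eqxx nd nd' n0.
  by rewrite B /addr addnn addn1 addnC.
- move=> r Hr.
  have r1 : (r == rt d) = false by move: Hr; rewrite /low /rt; lia.
  have r2 : (r == rt d.+1) = false by move: Hr; rewrite /low /rt; lia.
  by rewrite /= r1 E3 ?r1 //= r1 r2.
- by rewrite /= E4.
Qed.

Lemma comp_expr_ok d e hs s :
  0 < d -> rel_state hs s ->
  exists s', [/\ exec (comp_expr d e) s (esize e) s',
    regs s' (rt d) = eval inp hs e,
    forall r, low d r -> regs s' r = regs s r & Defs.mem s' = Defs.mem s].
Proof.
have rtS d' : (rt d' == rt d'.+1) = false by rewrite /rt; lia.
have rtS' d' : (rt d'.+1 == rt d') = false by rewrite /rt; lia.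
have lowd d' d'' r : d' <= d'' -> low d' r -> (r == rt d'') = false.
  by rewrite /low /rt; lia.
have lowS d' r : low d' r -> low d'.+1 r by rewrite /low /rt; lia.
elim: e d s => [k|x|e IH|a e IH|e1 IH1 e2 IH2|e1 IH1 e2 IH2] d s d0 Rs /=.
- exists (set_reg s (rt d) k); split=> //=; first exact: exec_const.
    by rewrite eqxx.
  by move=> r Hr; rewrite (lowd d d).
- pose s1 := set_reg s (rt d) 0.
  exists (set_reg s1 (rt d) (regs s1 (rt d) + regs s1 (rv x))); split=> //=.
  + by apply: (exec_seq (t1 := 1) (t2 := 1)); [apply: exec_const|apply: exec_add].
  + have -> : (rv x == rt d) = false by rewrite /rv /rt; lia.
    by rewrite !eqxx; case: Rs => _ -> _ _.
  + by move=> r Hr; rewrite (lowd d d).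
- have [s1 [X1 V1 L1 M1]] := IH d s d0 Rs.
  have [B1 _ I1 _] : rel_state hs s1 by apply: rel_state_low d0 L1 _ Rs; rewrite M1.
  pose s2 := set_reg s1 (rt d.+1) (regs s1 (rt 0) - regs s1 (rt d)).
  have X2 : exec (Defs.Sub (rt d.+1) (rt 0) (rt d)) s1 1 s2 by apply: exec_sub.
  have V2 : regs s2 (rt d) = eval inp hs e by rewrite /= rtS V1.
  have T2 : regs s2 (rt d.+1) = base - eval inp hs e by rewrite /= eqxx B1 V1.
  case: (posnP (base - eval inp hs e)) => Hb.
    exists (set_reg s2 (rt d) 0); split=> //=.
    + apply: exec_seq X1 _; apply: (exec_seq (t2 := 2)) X2 _.
      by apply: exec_if_false; [rewrite T2|apply: exec_const].
    + by rewrite eqxx nth_default //; lia.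
    + by move=> r Hr; rewrite (lowd d d) // (lowd d d.+1) // L1.
  exists (set_reg s2 (rt d) (Defs.mem s2 (regs s2 (rt d)))); split=> //=.
  + apply: exec_seq X1 _; apply: (exec_seq (t2 := 2)) X2 _.
    by apply: exec_if_true; [rewrite T2 -lt0n|apply: exec_read].
  + by rewrite eqxx rtS V1 I1 //; lia.
  + by move=> r Hr; rewrite (lowd d d) // (lowd d d.+1) // L1.
- have [s1 [X1 V1 L1 M1]] := IH d s d0 Rs.
  have [B1 _ _ A1] : rel_state hs s1 by apply: rel_state_low d0 L1 _ Rs; rewrite M1.
  have [s2 [X2 V2 L2 M2]] := comp_addr_ok a d0 B1.
  exists (set_reg s2 (rt d) (Defs.mem s2 (regs s2 (rt d)))); split=> //=.
  + apply: exec_seq X1 _; rewrite (_ : a + 6 = a + 5 + 1); last lia.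
    by apply: exec_seq X2 _; apply: exec_read.
  + by rewrite eqxx V2 V1 M2 A1.
  + by move=> r Hr; rewrite (lowd d d) // L2 // L1.
  + by rewrite M2.
- have [s1 [X1 V1 L1 M1]] := IH1 d s d0 Rs.
  have R1 : rel_state hs s1 by apply: rel_state_low d0 L1 _ Rs; rewrite M1.
  have [s2 [X2 V2 L2 M2]] := IH2 d.+1 s1 isT R1.
  exists (set_reg s2 (rt d) (regs s2 (rt d) + regs s2 (rt d.+1))); split=> //=.
  + by rewrite -addnA; apply: exec_seq X1 _; apply: exec_seq X2 _; apply: exec_add.
  + by rewrite eqxx V2 L2 ?V1 // /low /rt; lia.
  + by move=> r Hr; rewrite (lowd d d) // L2 ?L1 // lowS.
  + by rewrite M2.
- have [s1 [X1 V1 L1 M1]] := IH1 d s d0 Rs.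
  have R1 : rel_state hs s1 by apply: rel_state_low d0 L1 _ Rs; rewrite M1.
  have [s2 [X2 V2 L2 M2]] := IH2 d.+1 s1 isT R1.
  exists (set_reg s2 (rt d) (regs s2 (rt d) - regs s2 (rt d.+1))); split=> //=.
  + by rewrite -addnA; apply: exec_seq X1 _; apply: exec_seq X2 _; apply: exec_sub.
  + by rewrite eqxx V2 L2 ?V1 // /low /rt; lia.
  + by move=> r Hr; rewrite (lowd d d) // L2 ?L1 // lowS.
  + by rewrite M2.
Qed.

Definition temps_kept (d : nat) (s s' : state) : Prop :=
  forall d', d' < d -> regs s' (rt d') = regs s (rt d').

Lemma temps_kept_low d s s' :
  (forall r, low d r -> regs s' r = regs s r) -> temps_kept d s s'.
Proof. by move=> L d' Hd; apply: L; rewrite /low /rt; lia. Qed.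

(** [csize c] serves as the price of a tick. The price for a subcommand may be raised to that of the
    whole because the clock only advances, and the overhead of a test, a loop or a round is paid by
    the tick that it adds. Adding [csize c * ck hs] on the left avoids a truncated difference. *)
Lemma compile_ok d c hs s :
  0 < d -> rel_state hs s ->
  exists t s', [/\ exec (compile d c) s t s', rel_state (run inp c hs) s',
    temps_kept d s s' &
    t + csize c * ck hs <= csize c * ck (run inp c hs)].
Proof.
have rtI d1 d2 : (rt d1 == rt d2) = (d1 == d2) by rewrite /rt; lia.
have rvI x y : (rv x == rv y) = (x == y) by rewrite /rv; lia.
have rvt x d' : (rv x == rt d') = false by rewrite /rv /rt; lia.
have rtv x d' : (rt d' == rv x) = false by rewrite /rv /rt; lia.
elim: c d hs s => [x e|a e1 e2|c1 IH1 c2 IH2|e c1 IH1 c2 IH2|x e b IH] d hs s d0 Rs /=.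
- have [s1 [X1 V1 L1 M1]] := comp_expr_ok e d0 Rs.
  have [B1 W1 I1 A1] : rel_state hs s1 by apply: rel_state_low d0 L1 _ Rs; rewrite M1.
  pose s2 := set_reg s1 (rv x) 0.
  exists (esize e + (1 + 1)), (set_reg s2 (rv x) (regs s2 (rv x) + regs s2 (rt d))).
  split=> //=.
  + by apply: exec_seq X1 _; apply: exec_seq (exec_const _ _ _) (exec_add _ _ _ _).
  + split=> //=; first by rewrite rtv.
    by move=> y; rewrite rvI eqxx rtv V1 W1; case: eqP.
  + by move=> d' Hd; rewrite /= !rtv (temps_kept_low L1).
  + lia.
- have [s1 [X1 V1 L1 M1]] := comp_expr_ok e1 d0 Rs.
  have R1 : rel_state hs s1 by apply: rel_state_low d0 L1 _ Rs; rewrite M1.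
  have [B1 _ _ _] := R1.
  have [s2 [X2 V2 L2 M2]] := comp_addr_ok a d0 B1.
  have R2 : rel_state hs s2 by apply: rel_state_low d0 L2 _ R1; rewrite M2.
  have [s3 [X3 V3 L3 M3]] := comp_expr_ok (d := d.+1) e2 isT R2.
  have [B3 W3 I3 A3] : rel_state hs s3 by apply: (rel_state_low (d := d.+1)) L3 _ R2 => //; rewrite M3.
  have D3 : regs s3 (rt d) = addr base a (eval inp hs e1).
    by rewrite L3 ?V2 ?V1 // /low /rt; lia.
  exists (esize e1 + (a + 5 + (esize e2 + 1))),
    (set_mem s3 (regs s3 (rt d)) (regs s3 (rt d.+1))).
  split=> //=.
  + by apply: exec_seq X1 _; apply: exec_seq X2 _; apply: exec_seq X3 _; apply: exec_write.
  + split=> //= [i Hi|b i].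
      rewrite D3 I3 //; case: eqP => // Ei; move: Hi; rewrite Ei /addr; lia.
    by rewrite D3 addr_inj V3 A3.
  + move=> d' Hd; rewrite /= (temps_kept_low L3) ?(temps_kept_low L2) //; last lia.
    exact: (temps_kept_low L1).
  + lia.
- have [t1 [s1 [X1 R1 K1 T1]]] := IH1 d hs s d0 Rs.
  have [t2 [s2 [X2 R2 K2 T2]]] := IH2 d _ s1 d0 R1.
  exists (t1 + t2), s2; split=> //; first exact: exec_seq X1 X2.
    by move=> d' Hd; rewrite K2 ?K1.
  have := run_clock inp c1 hs; have := run_clock inp c2 (run inp c1 hs); nia.
- have [s1 [X1 V1 L1 M1]] := comp_expr_ok e d0 Rs.
  have R1 : rel_state hs s1 by apply: rel_state_low d0 L1 _ Rs; rewrite M1.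
  have R1' : rel_state (tick hs) s1 by case: R1.
  case: eqP => /= He.
    have [t [s2 [X2 R2 K2 T2]]] := IH2 d _ s1 d0 R1'.
    exists (esize e + t.+1), s2; split=> //.
    + by apply: exec_seq X1 _; apply: exec_if_false; rewrite ?V1.
    + by move=> d' Hd; rewrite K2 ?(temps_kept_low L1).
    + have := run_clock inp c2 (tick hs); move: T2 => /=; nia.
  have [t [s2 [X2 R2 K2 T2]]] := IH1 d _ s1 d0 R1'.
  exists (esize e + t.+1), s2; split=> //.
  + by apply: exec_seq X1 _; apply: exec_if_true; rewrite ?V1 //; apply/eqP.
  + by move=> d' Hd; rewrite K2 ?(temps_kept_low L1).
  + have := run_clock inp c1 (tick hs); move: T2 => /=; nia.
- have [s1 [X1 V1 L1 M1]] := comp_expr_ok e d0 Rs.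
  have [B1 W1 I1 A1] : rel_state hs s1 by apply: rel_state_low d0 L1 _ Rs; rewrite M1.
  pose s2 := set_reg s1 (rv x) 0.
  set C := esize e + 6 + csize b.
  set f := (X in iter _ X _).
  set p := (X in While _ X).
  have R2 : rel_state (setv (tick hs) x 0) s2.
    split=> //=; first by rewrite rtv.
    by move=> y; rewrite rvI W1.
  have V2 : regs s2 (rt d) = eval inp hs e by rewrite /= rtv.
  (* Generalized to an arbitrary number [k] of remaining rounds; the final [+ 1] pays for the last
     test, which fails. *)
  suff H k hs0 s0 : rel_state hs0 s0 -> regs s0 (rt d) = k ->
      exists t s', [/\ exec (While (rt d) p) s0 t s', rel_state (iter k f hs0) s',
        temps_kept d s0 s' & t + C * ck hs0 <= C * ck (iter k f hs0) + 1].
    have [t [s3 [X3 R3 K3 T3]]] := H _ _ _ R2 V2.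
    exists (esize e + (1 + t)), s3; split=> //.
    + by apply: exec_seq X1 _; apply: exec_seq X3; apply: exec_const.
    + by move=> d' Hd; rewrite K3 //= rtv (temps_kept_low L1).
    + by move: T3; rewrite /= /C; nia.
  elim: k hs0 s0 => [|k IHk] hs0 s0 R0 K0.
    exists 1, s0; split=> //; last by rewrite addnC.
    exact: exec_while_false.
  have [t1 [s3 [X3 R3 K3 T3]]] := IH d.+1 hs0 s0 isT R0.
  pose s4 := set_reg s3 (rt d.+1) 1.
  pose s5 := set_reg s4 (rv x) (regs s4 (rv x) + regs s4 (rt d.+1)).
  pose s6 := set_reg s5 (rt d) (regs s5 (rt d) - regs s5 (rt d.+1)).
  have Xp : exec p s0 (t1 + (1 + (1 + 1))) s6.
    apply: exec_seq X3 _; apply: exec_seq (exec_const _ _ _) _.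
    exact: exec_seq (exec_add _ _ _ _) (exec_sub _ _ _ _).
  have R6 : rel_state (f hs0) s6.
    have [B3 W3 I3 A3] := R3; split=> //.
    + have -> : regs s6 (rt 0) = regs s3 (rt 0).
        rewrite /s6 /s5 /s4 /set_reg /= !(rtv, rtI) !ltn_eqF //.
      by [].
    + move=> y; rewrite /= !rvt rvI !rtI eqxx !W3.
      by case: eqP => // _; rewrite addn1.
  have K6 : regs s6 (rt d) = k.
    rewrite /s6 /s5 /s4 /set_reg /= !(eqxx, rtv, rvt, rtI, ltn_eqF) /= ?eqxx ?K3 ?K0 //; lia.
  have [t2 [s7 [X7 R7 K7 T7]]] := IHk (f hs0) s6 R6 K6.
  exists (t1 + (1 + (1 + 1)) + t2).+1, s7; split=> //.
  + by apply: exec_while_true Xp X7; rewrite K0.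
  + by rewrite iterSr.
  + move=> d' Hd; rewrite K7 //= !rtv !rtI.
    by rewrite (ltn_eqF Hd) (ltn_eqF (ltnW _)) ?ltnS // K3 // ltnW.
  + rewrite iterSr; have := run_clock inp b hs0.
    have ckf : ck (f hs0) = (ck (run inp b hs0)).+1 by [].
    by move: T3 T7; rewrite ckf /C; nia.
Qed.

End Compiler.

(** * The dynamic program *)

Section Digits.
Variable R : nat.
Hypothesis R_gt0 : 0 < R.

Definition digit (j s : nat) : nat := s %/ R ^ j %% R.
Definition number (y : nat -> nat) (L : nat) : nat := \sum_(0 <= j < L) y j * R ^ j.

Lemma eq_number y z L : (forall j, j < L -> y j = z j) -> number y L = number z L.
Proof. by move=> E; apply: eq_big_nat => j /andP[_ /E->]. Qed.

Lemma numberS y L : number y L.+1 = number y L + y L * R ^ L.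
Proof. by rewrite /number big_nat_recr. Qed.

Lemma number_lt y L : (forall j, j < L -> y j < R) -> number y L < R ^ L.
Proof.
clear R_gt0; elim: L => [|L IH] Hy; first by rewrite /number big_geq.
rewrite numberS expnS; have := IH (fun j Hj => Hy j (ltnW Hj)).
have := Hy L (ltnSn L); nia.
Qed.

Lemma digit_number y L j : (forall i, i < L -> y i < R) -> j < L -> digit j (number y L) = y j.
Proof.
elim: L => // L IH Hy; rewrite ltnS leq_eqVlt => /predU1P[->|Hj]; rewrite numberS /digit.
  have lt : number y L < R ^ L by apply: number_lt => i Hi; apply/Hy/ltnW.
  by rewrite divnDMl ?expn_gt0 ?R_gt0 // divn_small // add0n modn_small // Hy.
rewrite -IH // => [|i Hi]; last exact/Hy/ltnW.
have -> : R ^ L = R ^ (L - j.+1) * R * R ^ j.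
  by rewrite -mulnA -expnS -expnD subnK.
by rewrite !mulnA divnDMl ?expn_gt0 ?R_gt0 // addnC modnMDl.
Qed.

Lemma digit_lt j s : digit j s < R.
Proof. by rewrite ltn_mod. Qed.

Lemma number_digit s L : number (digit^~ s) L = s %% R ^ L.
Proof.
elim: L => [|L IH]; first by rewrite /number big_geq // modn1.
rewrite numberS IH /digit modn_divl -expnS.
rewrite [RHS](divn_eq _ (R ^ L)) addnC; congr (_ + _).
by rewrite modn_dvdm // expnS dvdn_mull.
Qed.

Lemma number_cat y L M : number y (L + M) = number y L + number (fun j => y (L + j)) M * R ^ L.
Proof.
elim: M => [|M IH]; first by rewrite addn0 /number [X in _ + X * _]big_geq // addn0.
rewrite addnS !numberS IH expnD mulnDl; lia.
Qed.

Lemma number_single L j : j < L -> number (fun i => i == j) L = R ^ j.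
Proof.
move=> Hj; rewrite /number big_mkord (bigD1 (Ordinal Hj)) //= eqxx mul1n big1 ?addn0 // => i.
by rewrite -val_eqE /= => /negbTE->.
Qed.

Lemma numberD y z L : number (fun j => y j + z j) L = number y L + number z L.
Proof. by rewrite -big_split; apply: eq_bigr => j _; rewrite mulnDl. Qed.

End Digits.

Lemma bigmax_nat_le (F : nat -> nat) n i : i < n -> F i <= \max_(0 <= j < n) F j.
Proof. by move=> Hi; apply: leq_bigmax_seq; rewrite ?mem_index_iota. Qed.

Lemma bigmax_nat_attained (F : nat -> nat) n :
  \max_(0 <= j < n) F j != 0 -> exists2 i, i < n & \max_(0 <= j < n) F j = F i.
Proof.
elim: n => [|n IH]; first by rewrite big_geq.
rewrite big_nat_recr //= => nz.
case: (leqP (\max_(0 <= j < n) F j) (F n)) => [le|lt].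
  by exists n.
case: IH => [|i Hi Ei]; first by rewrite -lt0n (leq_ltn_trans _ lt).
by exists i; [apply: ltnW|].
Qed.

(** Recovers the number of labels 0, which states do not record, from the length and the other
    counts. *)
Lemma sum_count_mem l (t : seq nat) : all (fun x => x <= l) t ->
  size t = count_mem 0 t + \sum_(0 <= j < l) count_mem j.+1 t.
Proof.
elim: t => [|x t IH] /=; first by rewrite big1.
case/andP => xl /IH->; rewrite big_split /=.
suff : (x == 0) + \sum_(0 <= j < l) (x == j.+1) = 1 by lia.
case: x xl => [|x] xl; first by rewrite big1.
rewrite big_mkord (bigD1 (Ordinal xl)) //= eqxx big1 // => j.
by rewrite -val_eqE eq_sym eqSS /= => /negbTE->.
Qed.

(** * Tables of best gains and their transitions *)

Section DynamicProgram.
Variables (l h count0 : nat) (size0 : nat -> nat) (g : nat -> nat -> nat) (rk : nat -> nat).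
Let R := h.+1.

Implicit Types (ch : seq nat) (T : nat -> nat).

(* [ch] lists the labels chosen for the first vertices outside the deletion set;
   [g i x] is the number of neighbours in the deletion set with label [x] of the
   [i]th of them, and [rk i] its rank in its cluster. *)
Definition step_gain ch x : nat :=
  let c := count_mem x (drop (size ch - rk (size ch)) ch) in
  if x == 0 then c %% h else g (size ch) x + c.

Definition total_gain ch : nat :=
  \sum_(0 <= i < size ch) step_gain (take i ch) (nth 0 ch i).

Lemma total_gain_rcons ch x : total_gain (rcons ch x) = total_gain ch + step_gain ch x.
Proof.
rewrite /total_gain size_rcons big_nat_recr //= nth_rcons ltnn eqxx.
rewrite -cats1 take_size_cat //; congr (_ + _); apply: eq_big_nat => i /andP[_ Hi].
by rewrite takel_cat ?(ltnW Hi) // nth_cat Hi.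
Qed.

Definition admissible ch : Prop :=
  all (fun x => x <= l) ch /\ forall j, j < l -> size0 j + count_mem j.+1 ch <= h.

Lemma admissible_rcons ch x :
  admissible (rcons ch x) <->
  [/\ admissible ch, x <= l & forall j, j < l -> x = j.+1 -> size0 j + count_mem x ch < h].
Proof.
rewrite /admissible all_rcons; split.
  case=> /andP[xl al] H; split=> // [|j Hj Ex].
    split=> // j Hj; have := H j Hj; rewrite -cats1 count_cat; lia.
  have := H j Hj; rewrite -cats1 count_cat /= Ex eqxx; lia.
case=> -[al H] xl Hx; rewrite xl; split=> // j Hj; have := H j Hj; have := Hx j Hj.
by rewrite -cats1 count_cat /=; case: eqP => [->|_]; lia.
Qed.

(* A state records, for each part [j], its size (digit [j]) and its number of
   vertices in the current cluster (digit [l + j]). *)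
Definition state_digit q ch j : nat :=
  if j < l then size0 j + count_mem j.+1 ch else count_mem (j - l).+1 (drop q ch).

Definition encoding q ch : nat := number R (state_digit q ch) (l + l).

Lemma state_digit_le q ch j : admissible ch -> j < l + l -> state_digit q ch j < R.
Proof.
case=> _ H Hj; rewrite /state_digit /R ltnS; case: ltnP => [/H//|le].
have Hj' : j - l < l by lia.
have := H _ Hj'; have := count_cat (pred1 (j - l).+1) (take q ch) (drop q ch).
by rewrite cat_take_drop; lia.
Qed.

Lemma encoding_lt q ch : admissible ch -> encoding q ch < R ^ (l + l).
Proof. by move=> A; apply: number_lt => // j; apply: state_digit_le. Qed.

Lemma digit_encoding q ch j : admissible ch -> j < l + l ->
  digit R j (encoding q ch) = state_digit q ch j.
Proof. by move=> A; apply: digit_number => // i; apply: state_digit_le. Qed.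

Lemma encoding_rcons0 q ch : q <= size ch -> encoding q (rcons ch 0) = encoding q ch.
Proof.
move=> qs; apply: eq_number => j _.
by rewrite /state_digit drop_rcons // -!cats1 !count_cat /= !addn0.
Qed.

Lemma encoding_rconsS q ch j : q <= size ch -> j < l ->
  encoding q (rcons ch j.+1) = encoding q ch + R ^ j + R ^ (l + j).
Proof.
move=> qs Hj; rewrite -(@number_single R (l + l) j) -?(@number_single R (l + l) (l + j)); try lia.
rewrite -!numberD; apply: eq_number => i Hi.
rewrite /state_digit drop_rcons // -!cats1 !count_cat /=; case: ltnP => H; lia.
Qed.

Lemma encoding_split q ch :
  encoding q ch = number R (state_digit q ch) l
    + number R (fun j => count_mem j.+1 (drop q ch)) l * R ^ l.
Proof.
rewrite /encoding number_cat //; congr (_ + _ * _); apply: eq_number => j Hj.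
by rewrite /state_digit ltnNge leq_addr /= addKn.
Qed.

Lemma sizes_lt q ch : admissible ch -> number R (state_digit q ch) l < R ^ l.
Proof. by move=> A; apply: number_lt => // j Hj; apply: state_digit_le; rewrite // ltn_addr. Qed.

Lemma encoding_restart q ch : admissible ch -> encoding (size ch) ch = encoding q ch %% R ^ l.
Proof.
move=> A; rewrite !encoding_split [in RHS]addnC modnMDl modn_small ?sizes_lt //.
rewrite drop_size /= [X in _ + X * _]/number big1 ?addn0 //.
by apply: eq_number => j Hj; rewrite /state_digit Hj.
Qed.

(* The entry 0 marks an unreachable state; a reachable one is stored with one
   more than its best number of kept edges. *)
Definition tabulates (i q : nat) T : Prop :=
  (forall s, s < R ^ (l + l) -> T s != 0 ->
    exists ch, [/\ size ch = i, admissible ch, s = encoding q ch &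
                   T s = (count0 + total_gain ch).+1]) /\
  (forall ch, size ch = i -> admissible ch -> count0 + total_gain ch < T (encoding q ch)).

Lemma tabulates_ext i q T T' :
  (forall s, s < R ^ (l + l) -> T' s = T s) -> tabulates i q T -> tabulates i q T'.
Proof.
move=> E [S C]; split=> [s Hs|ch si A]; first by rewrite E //; apply: S.
by rewrite E ?encoding_lt //; apply: C.
Qed.

(** If the labels on [X] already overfill a part, no sequence is admissible and the correct table is
    empty. *)
Lemma tabulates_init T :
  (forall s, s < R ^ (l + l) -> T s =
     if [forall j : 'I_l, size0 j <= h] && (s == number R size0 l) then count0.+1 else 0) ->
  tabulates 0 0 T.
Proof.
have adm0 : reflect (admissible [::]) [forall j : 'I_l, size0 j <= h].
  apply: (iffP forallP) => [H|[_ H] j]; last by have := H j (ltn_ord j); rewrite addn0.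
  by split=> // j Hj; have := H (Ordinal Hj); rewrite addn0.
have E : encoding 0 [::] = number R size0 l.
  rewrite encoding_split [X in _ + X * _]/number big1 ?addn0 //.
  by apply: eq_number => j Hj; rewrite /state_digit Hj addn0.
have G : total_gain [::] = 0 by rewrite /total_gain big_geq.
move=> HT; split=> [s Hs|ch /size0nil-> A].
  rewrite HT //; case: ifP => // /andP[/adm0 A /eqP->] _.
  by exists [::]; split; rewrite // G addn0.
by rewrite HT ?encoding_lt // E eqxx G; move/adm0: A => ->; rewrite addn0 /=.
Qed.

(** States that differ only in the counts for the finished cluster merge and the best one survives;
    the mark 0 of unreachable states is neutral for the maximum. *)
Lemma tabulates_restart i q T T' :
  (forall s, s < R ^ l -> T' s = \max_(0 <= c < R ^ l) T (c * R ^ l + s)) ->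
  (forall s, R ^ l <= s < R ^ (l + l) -> T' s = 0) ->
  tabulates i q T -> tabulates i i T'.
Proof.
move=> Hlo Hhi [S C]; split=> [s Hs T's|ch si A].
  have Hsl : s < R ^ l.
    by rewrite ltnNge; apply/negP => le; move: T's; rewrite Hhi ?le.
  have [c Hc Ec] : exists2 c, c < R ^ l & T' s = T (c * R ^ l + s).
    by move: T's; rewrite Hlo // => /bigmax_nat_attained.
  have Hcs : c * R ^ l + s < R ^ (l + l) by rewrite expnD; nia.
  have [|ch [si A Es Ts]] := S _ Hcs; first by rewrite -Ec.
  exists ch; split; rewrite ?Ec //.
  by rewrite -si (encoding_restart q) // -Es modnMDl modn_small.
have Eq := encoding_restart q A; have := sizes_lt q A; have := encoding_split q ch.
set lo := number _ _ _; set hi := number _ _ _ => Es Hlo'.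
have hiR : hi < R ^ l.
  apply: number_lt => // j Hj; have := state_digit_le q (j := l + j) A.
  rewrite ltn_add2l Hj /state_digit [l + j < l]ltnNge leq_addr addKn; exact.
have -> : encoding i ch = lo by rewrite -si Eq Es addnC modnMDl modn_small.
rewrite Hlo //; apply: leq_trans (bigmax_nat_le (fun c => T (c * R ^ l + lo)) hiR).
by rewrite [hi * _ + _]addnC -Es; apply: C.
Qed.

(** The transition seen from its target: [s] arises by label 0 from itself, or by label [j.+1] from
    the state whose digits [j] and [l + j] are one less. Of the [i - q] earlier vertices of the
    cluster, those not counted by the upper digits are labelled 0. The predecessor in the last term
    discounts the new vertex. *)
Definition step_table i q T (s : nat) : nat :=
  maxn (if T s == 0 then 0
        else T s + (i - q - \sum_(0 <= j < l) digit R (l + j) s) %% h)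
    (\max_(0 <= j < l)
       (if [&& 0 < digit R j s, 0 < digit R (l + j) s & T (s - R ^ j - R ^ (l + j)) != 0]
        then T (s - R ^ j - R ^ (l + j)) + g i j.+1 + (digit R (l + j) s).-1 else 0)).

Lemma tabulates_step i T :
  tabulates i (i - rk i) T -> tabulates i.+1 (i - rk i) (step_table i (i - rk i) T).
Proof.
set q := i - rk i => -[S C].
have qi : q <= i by apply: leq_subr.
have jl j : j < l -> j < l + l /\ l + j < l + l by lia.
have sd_lo ch j : j < l -> state_digit q ch j = size0 j + count_mem j.+1 ch.
  by rewrite /state_digit => ->.
have sd_hi ch j : j < l -> state_digit q ch (l + j) = count_mem j.+1 (drop q ch).
  by move=> Hj; rewrite /state_digit ltnNge leq_addr addKn.
have zeros ch : size ch = i -> admissible ch ->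
    i - q - \sum_(0 <= j < l) digit R (l + j) (encoding q ch) = count_mem 0 (drop q ch).
  move=> si A; have [al _] := A.
  have -> : i - q = size (drop q ch) by rewrite size_drop si.
  rewrite (@sum_count_mem l (drop q ch)); last by apply/allP => x /mem_drop; apply: (allP al).
  rewrite [X in _ - X](eq_big_nat _ _ (F2 := fun j => count_mem j.+1 (drop q ch))) ?addnK //.
  move=> j /andP[_ Hj].
  by rewrite digit_encoding ?sd_hi //; case: (jl j Hj).
have gain0 ch : size ch = i -> step_gain ch 0 = count_mem 0 (drop q ch) %% h.
  by rewrite /step_gain => ->.
have gainS ch j : size ch = i -> step_gain ch j.+1 = g i j.+1 + count_mem j.+1 (drop q ch).
  by rewrite /step_gain => ->.
split=> [s Hs|ch].
  rewrite /step_table; set a := (X in maxn X _); set b := (X in maxn _ X).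
  case: (leqP a b) => [_ b0|lt_ba _].
    have [j Hj Eb] := bigmax_nat_attained b0.
    move: Eb b0; rewrite -/b => ->; case: ifP => // /and3P[dj dlj Ts' _].
    have [Hj1 Hj2] := jl j Hj.
    (* The digits of the predecessor state. Both lowered digits are positive, so subtracting the two
       powers involves no borrowing. *)
    pose y i := digit R i s - (i == j) - (i == l + j).
    have Ey : number R y (l + l) + R ^ j + R ^ (l + j) = s.
      rewrite -(@number_single R _ _ Hj1) -(@number_single R _ _ Hj2) -!numberD.
      rewrite -[RHS](modn_small Hs) -(@number_digit R); apply: eq_number => i' _; rewrite /y.
      by case: eqP => [->|_]; [|case: eqP => [->|_]]; lia.
    have yR i' : y i' < R.
      by rewrite /y; have := @digit_lt R isT i' s; lia.
    have Es' : s - R ^ j - R ^ (l + j) = number R y (l + l) by rewrite -Ey; lia.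
    have Hs' : s - R ^ j - R ^ (l + j) < R ^ (l + l) by lia.
    have [ch [si A Ech ETs]] := S _ Hs' Ts'.
    have sdy i' : i' < l + l -> state_digit q ch i' = y i'.
      by move=> Hi'; rewrite -(digit_encoding q A) // -Ech Es' digit_number.
    have := sdy _ Hj1; have := sdy _ Hj2; rewrite (sd_lo _ j) // (sd_hi _ j) // /y !eqxx => Ec Esz.
    have dR : digit R j s <= h by exact: (@digit_lt R isT j s).
    exists (rcons ch j.+1); split.
    - by rewrite size_rcons si.
    - apply/admissible_rcons; split=> // j' Hj' [<-]; lia.
    - by rewrite encoding_rconsS ?si // -Ech; lia.
    - rewrite ETs total_gain_rcons gainS // Ec; lia.
  have a0 : a != 0 by rewrite -lt0n (leq_ltn_trans _ lt_ba).
  move: a0; rewrite /a; case: ifP => // /negbT Ts _.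
  have [ch [si A Es ETs]] := S s Hs Ts.
  exists (rcons ch 0); split.
  - by rewrite size_rcons si.
  - by apply/admissible_rcons; split.
  - by rewrite encoding_rcons0 ?si.
  - by rewrite ETs total_gain_rcons gain0 // Es zeros // addSn addnA.
case/lastP: ch => // ch x; rewrite size_rcons => -[si] /admissible_rcons[A xl Hx].
have TC := C ch si A; rewrite total_gain_rcons.
case: x xl Hx => [|j] Hj Hx.
  rewrite encoding_rcons0 ?si // gain0 // /step_table leq_max; apply/orP; left.
  case: eqP => [E|_]; first by rewrite E in TC.
  by rewrite zeros // addnA ltn_add2r.
have A' : admissible (rcons ch j.+1) by apply/admissible_rcons; split.
have [Hj1 Hj2] := jl j Hj.
rewrite /step_table leq_max; apply/orP; right.
apply: leq_trans (bigmax_nat_le _ Hj); rewrite !digit_encoding //.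
rewrite (sd_lo _ j) // (sd_hi _ j) // drop_rcons ?si // encoding_rconsS ?si //.
have -> : encoding q ch + R ^ j + R ^ (l + j) - R ^ j - R ^ (l + j) = encoding q ch by lia.
rewrite -!cats1 !count_cat /= eqxx gainS //.
rewrite (_ : true + 0 = 1) // !addn1 addnS /= -lt0n (leq_ltn_trans _ TC) //=; lia.
Qed.

End DynamicProgram.

(** * The program *)

Local Notation "c1 ;; c2" := (CSeq c1 c2) (at level 100, right associativity).
Local Notation "x <~ e" := (CSet x e) (at level 90).

Lemma wp_le inp c s t t' (Q : store -> Prop) : wp inp c s t Q -> t <= t' -> wp inp c s t' Q.
Proof. by move=> H le; apply: wp_conseq le _ H. Qed.

Definition e_le (e1 e2 : expr) : expr := ESub (EC 1) (ESub e1 e2).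

Lemma eval_le inp s e1 e2 : (eval inp s (e_le e1 e2) != 0) = (eval inp s e1 <= eval inp s e2).
Proof. rewrite /=; lia. Qed.

Lemma wp_if_le inp e1 e2 c1 c2 s t (Q : store -> Prop) :
  (eval inp s e1 <= eval inp s e2 -> wp inp c1 (tick s) t Q) ->
  (eval inp s e2 < eval inp s e1 -> wp inp c2 (tick s) t Q) ->
  wp inp (CIf (e_le e1 e2) c1 c2) s t.+1 Q.
Proof.
move=> H1 H2; apply: wp_if; rewrite ?eval_le //= => H; apply: H2; lia.
Qed.

Local Notation v_res := 0 (only parsing).
Local Notation v_n := 1 (only parsing).
Local Notation v_m := 2 (only parsing).
Local Notation v_k := 3 (only parsing).
Local Notation v_h := 4 (only parsing).
Local Notation v_l := 5 (only parsing).
Local Notation v_cnt := 6 (only parsing).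
Local Notation v_lam := 7 (only parsing).
Local Notation v_ns := 8 (only parsing).
Local Notation v_nl := 9 (only parsing).
Local Notation v_pl := 10 (only parsing).
Local Notation v_radix := 11 (only parsing).
Local Notation v_len := 12 (only parsing).
Local Notation v_rem := 13 (only parsing).
Local Notation v_jj := 14 (only parsing).
Local Notation v_j := 15 (only parsing).
Local Notation v_q := 16 (only parsing).
Local Notation v_r := 17 (only parsing).
Local Notation v_acc := 18 (only parsing).
Local Notation v_junk := 19 (only parsing).

Local Notation a_pl := 0 (only parsing).
Local Notation a_ps := 1 (only parsing).
Local Notation a_off := 2 (only parsing).
Local Notation a_done := 3 (only parsing).
Local Notation a_ord := 4 (only parsing).
Local Notation a_st := 5 (only parsing).
Local Notation a_mod := 6 (only parsing).
Local Notation a_ld := 7 (only parsing).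
Local Notation a_lb := 8 (only parsing).
Local Notation a_sz := 9 (only parsing).
Local Notation a_g := 10 (only parsing).
Local Notation a_dg := 11 (only parsing).
Local Notation a_t := 12 (only parsing).

Definition skip : com := v_junk <~ EC 0.

(** * Powers and digits by repeated addition and subtraction *)

Definition p_powers (P : nat) (radix len : expr) : com :=
  v_radix <~ radix;; v_len <~ len;;
  CPut P (EC 0) (EC 1);;
  CFor v_j (EV v_len)
    (v_acc <~ EC 0;;
     CFor v_r (EV v_radix) (v_acc <~ EAdd (EV v_acc) (EA P (EV v_j)));;
     CPut P (EAdd (EV v_j) (EC 1)) (EV v_acc)).

(** Digits are extracted from the leading one down, subtracting each power as often as it fits.
    Loops only count upwards, hence the reversal from [v_jj] to [v_j]. *)
Definition p_digits (P out : nat) (radix len idx : expr) : com :=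
  v_rem <~ idx;; v_radix <~ radix;; v_len <~ len;;
  CFor v_jj (EV v_len)
    (v_j <~ ESub (ESub (EV v_len) (EC 1)) (EV v_jj);; v_q <~ EC 0;;
     CFor v_r (EV v_radix)
       (CIf (e_le (EA P (EV v_j)) (EV v_rem))
          (v_rem <~ ESub (EV v_rem) (EA P (EV v_j));; v_q <~ EAdd (EV v_q) (EC 1))
          skip);;
     CPut out (EV v_j) (EV v_q)).

(** After [r] attempts to subtract [p], exactly [minn r (w %/ p)] have succeeded; this decides
    whether the next one does. *)
Lemma sub_quotient w p r : 0 < p -> (p <= w - minn r (w %/ p) * p) = (r < w %/ p).
Proof.
move=> p0; have eq_w := divn_eq w p; have lt := ltn_pmod w p0.
case: (leqP (w %/ p) r) => [le|lt_r].
  by apply/negbTE; rewrite -ltnNge {1}eq_w addKn.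
by apply/idP; have := leq_mul lt_r (leqnn p); lia.
Qed.

Section Macros.
Variable inp : seq nat.
Notation wp := (wp inp).

Lemma powers_ok P radix len s R L :
  eval inp s radix = R -> eval inp (setv (tick s) v_radix R) len = L ->
  wp (p_powers P radix len) s (4 + L * (4 + 2 * R))
     (fun s' => forall j, j <= L -> sa s' P j = R ^ j).
Proof.
move=> ER EL; eapply wp_le.
  apply/wp_seq/wp_set; rewrite ER; apply/wp_seq/wp_set; rewrite EL.
  apply/wp_seq/wp_put.
  set s1 := seta _ _ _ _.
  have E1 : eval inp s1 (EV v_len) = L by [].
  eapply wp_conseq; [exact: leqnn| |apply: (wp_for (I := fun j s' =>
    forall i, i <= j -> sa s' P i = R ^ i) (t := 3 + 2 * R) E1)].
  - by move=> s' [H _ _].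
  - by case=> //=; rewrite !eqxx.
  move=> j s' Hj sj [Fv Fa] IH; eapply wp_le.
    apply/wp_seq/wp_set; apply: wp_seq.
    set s2 := setv _ _ _.
    have E2 : eval inp s2 (EV v_radix) = R by rewrite /= Fv.
    eapply wp_conseq; [exact: leqnn| |apply: (wp_for (I := fun r s' =>
      sv s' v_acc = r * R ^ j) (t := 1) E2)] => //.
    + move=> s3 [Hacc _ [Gv Ga]]; apply: wp_put; rewrite /= Gv //= sj; split=> // i.
      rewrite Hacc eqxx addn1 -expnS /= => Hi; case: eqP => [->//|Ni].
      by rewrite Ga //= IH //; lia.
    + move=> r s3 Hr sr [Gv Ga] Hacc; apply: wp_set; split=> //=.
      by rewrite Hacc Gv //= sj Ga //= IH // mulSn addnC.
  lia.
lia.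
Qed.

(** The radix is [l] when a labelling of [X] is decoded, and 0 if [X] is empty; hence positivity of
    [R] is required only for [0 < L]. *)
Lemma digits_ok P out radix len idx s R L z :
  P != out -> eval inp s idx = z ->
  eval inp (setv (tick s) v_rem z) radix = R ->
  eval inp (setv (tick (setv (tick s) v_rem z)) v_radix R) len = L ->
  (0 < L -> 0 < R) -> z < R ^ L -> (forall j, j < L -> sa s P j = R ^ j) ->
  wp (p_digits P out radix len idx) s (4 + L * (5 + 4 * R))
     (fun s' => forall j, j < L -> sa s' out j = digit R j z).
Proof.
move=> nPo Ez ER EL R0 zR HP; eapply wp_le.
  apply/wp_seq/wp_set; rewrite Ez; apply/wp_seq/wp_set; rewrite ER.
  apply/wp_seq/wp_set; rewrite EL.
  set s1 := setv _ _ _.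
  have E1 : eval inp s1 (EV v_len) = L by [].
  eapply wp_conseq; [exact: leqnn| |apply: (wp_for (I := fun jj s' =>
    sv s' v_rem = z %% R ^ (L - jj) /\ forall j, L - jj <= j < L -> sa s' out j = digit R j z)
    (t := 4 + 4 * R) E1)].
  - by move=> s' [[_ H] _ _] j Hj; apply: H; rewrite subnn.
  - by split=> //= [|j]; [rewrite subn0 modn_small|lia].
  move=> jj s' Hjj sjj [Fv Fa] [Hrem Hout]; have {}R0 : 0 < R by apply: R0; lia.
  eapply wp_le.
    apply/wp_seq/wp_set; rewrite /= Fv //= sjj; apply/wp_seq/wp_set.
    set j := L - 1 - jj; apply: wp_seq.
    set s2 := setv _ _ _.
    have E2 : eval inp s2 (EV v_radix) = R by rewrite /= Fv.
    have J2 : sv s2 v_jj = jj by [].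
    have j2 : sv s2 v_j = j by [].
    have Hj : j < L by rewrite /j -subnDA ltn_subrL addn_gt0 (leq_ltn_trans _ Hjj).
    have jS : j.+1 = L - jj by rewrite /j; move: Hjj; clear; lia.
    have EP : sa s' P j = R ^ j by rewrite Fa ?inE //= HP.
    set w := z %% R ^ (L - jj) in Hrem.
    have Rj0 : 0 < R ^ j by rewrite expn_gt0 R0.
    have wlt : w < R * R ^ j.
      by rewrite -expnS jS ltn_mod expn_gt0 R0.
    have lew : w %/ R ^ j * R ^ j <= w by apply: leq_divM.
    eapply wp_conseq; [exact: leqnn| |apply: (wp_for (I := fun r s' =>
       [/\ sv s' v_q = minn r (w %/ R ^ j) & sv s' v_rem = w - minn r (w %/ R ^ j) * R ^ j])
       (t := 3) E2)].
    + move=> s3 [[Hq Hr] _ [Gv Ga]]; apply: wp_put; split; first by rewrite -J2 -Gv.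
      have Em : minn R (w %/ R ^ j) = w %/ R ^ j.
        by apply/minn_idPr/ltnW; rewrite ltn_divLR.
      have Ed : w %/ R ^ j = digit R j z.
        by rewrite /w /digit modn_divl -expnS jS.
      split.
        rewrite /= Hr Em {1}(divn_eq w (R ^ j)) addKn /w modn_dvdm; last first.
          by apply: dvdn_exp2l; rewrite -jS.
        by rewrite subnS -jS.
      move=> i Hi; rewrite /= eqxx Gv // j2.
      case: eqP => [->|ni]; first by rewrite Hq Em.
      by rewrite Ga ?inE //= Hout //; move: Hi ni; rewrite subnS -jS; clear; lia.
    + by split=> //=; rewrite ?min0n // mul0n subn0.
    + move=> r s3 Hr sr [Gv Ga] [Hq Hm].
      have EP3 : sa s3 P j = R ^ j by rewrite Ga.
      have j3 : sv s3 v_j = j by rewrite Gv.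
      apply: wp_if_le; rewrite /= j3 EP3 Hm => le; last first.
        eapply wp_le; first apply: wp_set; last by [].
        have ge : w %/ R ^ j <= r by rewrite leqNgt -sub_quotient // -ltnNge.
        by split=> //=; rewrite Hq Hm !(minn_idPr _) // (leq_trans ge).
      have lt : r < w %/ R ^ j by rewrite -sub_quotient.
      eapply wp_le.
        apply/wp_seq/wp_set/wp_set; split=> //=.
        by rewrite j3 EP3 Hm Hq !(minn_idPl _) ?(ltnW lt) // addn1 mulSn [R ^ j + _]addnC subnDA.
      by [].
  by move: (R); clear; lia.
by move: (L) (R); clear; lia.
Qed.

End Macros.

Local Notation v_u := 20 (only parsing).
Local Notation v_b := 21 (only parsing).
Local Notation v_w := 22 (only parsing).
Local Notation v_o := 23 (only parsing).
Local Notation v_d := 24 (only parsing).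

(** * Reading the input and ordering the vertices by clusters *)

Definition e_vertex (a : expr) : expr := EI (EAdd (EC 5) a).
Definition e_degree (u : expr) : expr := EI (EAdd (EAdd (EC 5) (EV v_l)) u).

Definition p_load : com :=
  v_n <~ EI (EC 0);; v_m <~ EI (EC 1);; v_k <~ EI (EC 2);; v_h <~ EI (EC 3);; v_l <~ EI (EC 4).

(* The machine has no division: remainders modulo [h] are tabulated once. *)
Definition p_mod : com :=
  v_acc <~ EC 0;;
  CFor v_r (EAdd (EV v_n) (EC 1))
    (CPut a_mod (EV v_r) (EV v_acc);; v_acc <~ EAdd (EV v_acc) (EC 1);;
     CIf (e_le (EV v_h) (EV v_acc)) (v_acc <~ EC 0) skip).

Definition p_off : com :=
  CPut a_off (EC 0) (EAdd (EAdd (EC 5) (EV v_l)) (EV v_n));;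
  CFor v_j (EV v_n)
    (CPut a_off (EAdd (EV v_j) (EC 1)) (EAdd (EA a_off (EV v_j)) (e_degree (EV v_j)))).

Definition p_done : com :=
  CFor v_j (EV v_l) (CPut a_done (e_vertex (EV v_j)) (EC 1)).

(** No graph search is necessary: the first vertex met in a cluster is adjacent to all others, so
    one pass over its list collects the cluster. Vertices of [X] are marked in [a_done] beforehand;
    [a_st] marks where clusters start. *)
Definition p_order : com :=
  v_cnt <~ EC 0;;
  CFor v_u (EV v_n)
    (CIf (EA a_done (EV v_u)) skip
      (CPut a_done (EV v_u) (EC 1);; CPut a_ord (EV v_cnt) (EV v_u);;
       CPut a_st (EV v_cnt) (EC 1);; v_cnt <~ EAdd (EV v_cnt) (EC 1);;
       v_d <~ e_degree (EV v_u);; v_o <~ EA a_off (EV v_u);;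
       CFor v_b (EV v_d)
         (v_w <~ EI (EAdd (EV v_o) (EV v_b));;
          CIf (EA a_done (EV v_w)) skip
            (CPut a_done (EV v_w) (EC 1);; CPut a_ord (EV v_cnt) (EV v_w);;
             v_cnt <~ EAdd (EV v_cnt) (EC 1))))).

Section Input.
Variables (n m k h l : nat) (xs : seq nat) (ad : nat -> seq nat) (inp : seq nat).

Definition offset (u : nat) : nat := 5 + l + n + \sum_(0 <= i < u) size (ad i).

(** The interface between the graph and the program, on natural numbers so that no ordinals enter
    the verification. The last field is the cluster structure, as transitivity of adjacency outside
    [xs]. *)
Record input_ok : Prop := InputOk {
  in_n : nth 0 inp 0 = n; in_m : nth 0 inp 1 = m; in_k : nth 0 inp 2 = k;
  in_h : nth 0 inp 3 = h; in_l : nth 0 inp 4 = l;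
  in_xs : forall a, a < l -> nth 0 inp (5 + a) = nth 0 xs a;
  in_deg : forall u, u < n -> nth 0 inp (5 + l + u) = size (ad u);
  in_ad : forall u b, u < n -> b < size (ad u) -> nth 0 inp (offset u + b) = nth 0 (ad u) b;
  size_xs : size xs = l; uniq_xs : uniq xs; xs_lt : {in xs, forall x, x < n};
  ad_lt : forall u, {in ad u, forall w, w < n}; uniq_ad : forall u, uniq (ad u);
  ad_sym : forall u w, u < n -> w \in ad u -> u \in ad w;
  ad_irr : forall u, u \notin ad u;
  ad_cluster : forall u v w, u \notin xs -> v \notin xs -> w \notin xs ->
    v \in ad u -> w \in ad v -> u != w -> w \in ad u }.

Hypothesis OK : input_ok.
Notation wp := (wp inp).

Definition loaded (s : store) : Prop :=
  [/\ sv s v_n = n, sv s v_m = m, sv s v_k = k, sv s v_h = h & sv s v_l = l].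

Lemma load_ok s : wp p_load s 5 loaded.
Proof.
eapply wp_le; first do !(apply: wp_seq; apply: wp_set); first apply: wp_set; last by [].
by case: OK => *; split.
Qed.

Lemma mod_ok s : 0 < h -> loaded s ->
  wp p_mod s (2 + n.+1 * 5) (fun s' => forall r, r <= n -> sa s' a_mod r = r %% h).
Proof.
move=> h0 [En _ _ Eh _]; eapply wp_le.
  apply/wp_seq/wp_set; set s1 := setv _ _ _.
  have E1 : eval inp s1 (EAdd (EV v_n) (EC 1)) = n.+1 by rewrite /= En addn1.
  eapply wp_conseq; [exact: leqnn| |apply: (wp_for (I := fun r s' =>
    sv s' v_acc = r %% h /\ forall i, i < r -> sa s' a_mod i = i %% h) (t := 4) E1)].
  - by move=> s' [[_ H] _ _] r Hr; apply: H.
  - by split=> //=; rewrite mod0n.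
  move=> r s' Hr sr [Fv Fa] [Hacc Hmod]; eapply wp_le.
    have Em : r.+1 %% h = if h <= (r %% h).+1 then 0 else (r %% h).+1.
      rewrite -[r.+1]addn1 -modnDml addn1; have := ltn_pmod r h0 => lt.
      case: leqP => le; last by rewrite modn_small.
      by have -> : (r %% h).+1 = h; [lia|rewrite modnn].
    have Hput i : i < r.+1 -> (if i == r then r %% h else sa s' a_mod i) = i %% h.
      by move=> Hi; case: eqP => [->//|ni]; rewrite Hmod //; lia.
    apply/wp_seq/wp_put/wp_seq/wp_set; apply: wp_if_le; rewrite /= (Fv v_h) //= Eh Hacc addn1 => le.
      apply: wp_set; split=> //=; rewrite sr; split=> //.
      by rewrite Em le.
    apply: wp_set; split=> //=; rewrite sr; split=> //.
    by rewrite Em leqNgt le.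
  by [].
lia.
Qed.

Lemma offset_ok s : loaded s ->
  wp p_off s (2 + n * 2) (fun s' => forall u, u < n -> sa s' a_off u = offset u).
Proof.
move=> [En _ _ Eh El]; eapply wp_le.
  apply/wp_seq/wp_put; set s1 := seta _ _ _ _.
  have E1 : eval inp s1 (EV v_n) = n by [].
  eapply wp_conseq; [exact: leqnn| |apply: (wp_for (I := fun u s' =>
    forall i, i <= u -> sa s' a_off i = offset i) (t := 1) E1)].
  - by move=> s' [H _ _] u Hu; apply: H; apply: ltnW.
  - by case=> //= _; rewrite /offset big_geq // En El addn0.
  move=> u s' Hu su [Fv Fa] Hoff; apply: wp_put; split=> // i Hi /=.
  rewrite su addn1; case: eqP => [->|ni]; last by rewrite Hoff //; lia.
  by rewrite Hoff // Fv //= El (in_deg OK) // /offset big_nat_recr //= addnA.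
lia.
Qed.

Lemma done_ok s : loaded s -> (forall w, sa s a_done w = 0) ->
  wp p_done s (1 + l * 2) (fun s' => forall w, sa s' a_done w = (w \in xs)).
Proof.
move=> [_ _ _ _ El] H0; have E1 : eval inp s (EV v_l) = l by [].
eapply wp_conseq; [| |apply: (wp_for (I := fun a s' =>
    forall w, sa s' a_done w = (w \in take a xs)) (t := 1) E1)]; first lia.
- by move=> s' [H _ _] w; rewrite H take_oversize ?(size_xs OK).
- by move=> w /=; rewrite H0 take0.
move=> a s' Ha sa' _ IH; apply: wp_put; split=> // w /=.
rewrite sa' (in_xs OK) // (take_nth 0) ?(size_xs OK) // mem_rcons inE IH.
by case: eqP.
Qed.

Definition visit (acc : seq nat) (u : nat) : seq nat :=
  if u \in xs ++ acc then acc else acc ++ u :: [seq w <- ad u | w \notin xs].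

Definition order (u : nat) : seq nat := foldl visit [::] (iota 0 u).

Lemma orderS u : order u.+1 = visit (order u) u.
Proof. by rewrite /order -addn1 iotaD foldl_cat. Qed.

(* Each cluster is contiguous: the earlier neighbours of a vertex form a suffix. *)
Record order_inv (acc : seq nat) : Prop := OrderInv {
  ord_uniq : uniq (xs ++ acc);
  ord_lt : {in acc, forall v, v < n};
  ord_closed : forall v w, v \in acc -> w \in ad v -> w \in xs ++ acc;
  ord_contiguous : forall i j p, i < j -> j < p -> p < size acc ->
    nth 0 acc i \in ad (nth 0 acc p) -> nth 0 acc j \in ad (nth 0 acc p) }.

(** By symmetry, a neighbour in [acc] would have brought [u] along. So [visit] has to filter out
    [xs] only. *)
Lemma visit_new acc u : order_inv acc -> u < n -> u \notin xs ++ acc ->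
  {in ad u, forall w, w \notin acc}.
Proof.
move=> I Hu nu w wu; apply/negP => wa; case/negP: nu.
by apply: (ord_closed I wa); apply: ad_sym OK _ _ Hu wu.
Qed.

(** The appended block [u :: t] is a clique without edges to [acc], which gives contiguity: the
    earlier neighbours of one of its vertices are all the earlier vertices of the block. *)
Lemma visit_inv acc u : u < n -> order_inv acc -> order_inv (visit acc u).
Proof.
move=> Hu I; rewrite /visit; case: ifP => // /negbT nu.
have new := visit_new I Hu nu; move: (nu); rewrite mem_cat negb_or => /andP[ux ua].
set t := filter _ _.
have tE w : (w \in t) = (w \notin xs) && (w \in ad u) by rewrite mem_filter.
have ut_adj : {in u :: t &, forall v w, v != w -> w \in ad v}.
  move=> v w; rewrite !inE !tE => /predU1P[->|/andP[vx vu]] /predU1P[->|/andP[wx wu]] //.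
  - by rewrite eqxx.
  - by move=> _; apply: (ad_sym OK).
  - by move=> nvw; apply: (ad_cluster OK vx ux wx) wu nvw; apply: (ad_sym OK).
have acc_adj v w : v \in acc -> w \in u :: t -> v \notin ad w.
  move=> va wt; apply/negP => vw.
  have wn : w < n.
    by move: wt; rewrite inE tE => /predU1P[->//|/andP[_ /(ad_lt OK)]].
  have := ord_closed I va (ad_sym OK wn vw); rewrite mem_cat.
  move: wt; rewrite inE tE => /predU1P[->|/andP[/negbTE-> /new/negbTE->]] //.
  by rewrite (negbTE ux) (negbTE ua).
have Uacc : uniq (xs ++ acc ++ u :: t).
  have := ord_uniq I; rewrite !cat_uniq => /and3P[-> Hd ->] /=.
  apply/and3P; split.
  - rewrite has_cat negb_or Hd /= negb_or ux /=.
    by apply/hasPn => w; rewrite tE => /andP[].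
  - rewrite negb_or ua /=; apply/hasPn => w; rewrite tE => /andP[_]; exact: new.
  - by rewrite mem_filter (negbTE (ad_irr OK u)) andbF filter_uniq // (uniq_ad OK).
split=> //.
- move=> v; rewrite mem_cat inE tE => /or3P[/(ord_lt I)//|/eqP->//|/andP[_]].
  exact: (ad_lt OK).
- move=> v w; rewrite mem_cat => /orP[va wv|vt wv].
    by have := ord_closed I va wv; rewrite !mem_cat orbA => ->.
  rewrite !mem_cat; case wx: (w \in xs) => //=; apply/orP; right.
  move: vt; rewrite inE tE => /predU1P[Ev|/andP[vx vu]].
    by rewrite inE tE wx -Ev wv orbT.
  have [->|nuw] := eqVneq u w; first by rewrite inE eqxx.
  rewrite inE tE wx /=; apply/orP; right.
  by apply: (ad_cluster OK ux vx) wv nuw => //; rewrite wx.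
- move=> i j p ij jp; rewrite size_cat => Hp.
  have nthr q : size acc <= q -> q < size acc + size (u :: t) ->
      nth 0 (acc ++ u :: t) q \in u :: t.
    by move=> le lt; rewrite nth_cat ltnNge le /= mem_nth // ltn_subLR.
  case: (ltnP p (size acc)) => lp.
    rewrite !nth_cat lp (ltn_trans jp lp) (ltn_trans ij (ltn_trans jp lp)).
    exact: (ord_contiguous I).
  case: (ltnP i (size acc)) => li.
    have /negbTE-> // : nth 0 (acc ++ u :: t) i \notin ad (nth 0 (acc ++ u :: t) p).
    by apply: acc_adj; [rewrite nth_cat li mem_nth|apply: nthr].
  move=> _; apply: ut_adj; [apply: nthr => //|apply: nthr; lia|].
  move: Uacc; rewrite cat_uniq => /and3P[_ _ Ua].
  by rewrite nth_uniq ?size_cat ?(ltn_trans jp Hp) // neq_ltn jp orbT.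
Qed.

Lemma order_inv_ok u : u <= n -> order_inv (order u).
Proof.
elim: u => [_|u IH Hu]; last by rewrite orderS; apply/visit_inv/IH/ltnW.
by split=> //; rewrite cats0 (uniq_xs OK).
Qed.

Lemma order_covers u w : w < u -> w \in xs ++ order u.
Proof.
elim: u => // u IH; rewrite ltnS leq_eqVlt orderS /visit => /predU1P[->|/IH H].
  by case: ifP => // _; rewrite !mem_cat inE eqxx !orbT.
by case: ifP => // _; rewrite catA mem_cat H.
Qed.

Definition vertices : seq nat := order n.
Definition cluster_rank (i : nat) : nat :=
  count (fun w => w \in ad (nth 0 vertices i)) (take i vertices).

Lemma cluster_rank_le i : cluster_rank i <= i.
Proof. by apply: leq_trans (count_size _ _) _; rewrite size_take; case: ltnP. Qed.

Lemma vertices_inv : order_inv vertices.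
Proof. exact: order_inv_ok. Qed.

Lemma mem_vertices w : w < n -> (w \in vertices) = (w \notin xs).
Proof.
move=> Hw; have := order_covers Hw; rewrite -/vertices mem_cat.
have := ord_uniq vertices_inv; rewrite cat_uniq => /and3P[_ /hasPn H _].
case: (boolP (w \in vertices)) => [wv _|_]; last by rewrite orbF => ->.
by have := H _ wv => /= ->.
Qed.

Lemma size_vertices : size vertices <= n.
Proof.
rewrite -[X in _ <= X](size_iota 0); apply: uniq_leq_size.
  by have := ord_uniq vertices_inv; rewrite cat_uniq => /and3P[].
by move=> v /(ord_lt vertices_inv); rewrite mem_iota.
Qed.

Lemma count_suffix (t : seq nat) (P : pred nat) :
  (forall i j, i < j -> j < size t -> P (nth 0 t i) -> P (nth 0 t j)) ->
  forall i, i < size t -> P (nth 0 t i) = (size t - count P t <= i).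
Proof.
elim: t => // x t IH Hs i Hi.
have IH' := IH (fun i j ij jt => Hs i.+1 j.+1 ij jt).
have := count_size P t; case Px: (P x) => /= le.
  have all_t : all P t by apply/(all_nthP 0) => j Hj; apply: (Hs 0 j.+1).
  move: (all_t); rewrite all_count => /eqP E; rewrite Px E addnC subnDA subSnn.
  case: i Hi => [|i] Hi //=; by apply: (allP all_t); apply: mem_nth.
case: i Hi => [|i] Hi /=; first by rewrite Px; lia.
rewrite IH' // Px; lia.
Qed.

Lemma earlier_adjacent i j : i < j -> j < size vertices ->
  (nth 0 vertices i \in ad (nth 0 vertices j)) = (j - cluster_rank j <= i).
Proof.
move=> ij jv; have szt : size (take j vertices) = j by rewrite size_take jv.
have := @count_suffix (take j vertices) (fun w => w \in ad (nth 0 vertices j)) _ i.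
rewrite szt -/(cluster_rank j) nth_take // => -> // a b ab bj.
rewrite !nth_take //; last exact: ltn_trans ab bj.
exact: (ord_contiguous vertices_inv).
Qed.

(** A nonzero rank makes the preceding vertex a neighbour, and by transitivity both have the same
    other earlier neighbours. The program can thus keep the rank in a counter that is reset when a
    cluster starts. *)
Lemma cluster_rankS i : i.+1 < size vertices -> cluster_rank i.+1 != 0 ->
  cluster_rank i.+1 = (cluster_rank i).+1.
Proof.
move=> Hi nz.
have adj : nth 0 vertices i \in ad (nth 0 vertices i.+1).
  by rewrite earlier_adjacent //; lia.
have Hx j : j < size vertices -> nth 0 vertices j \notin xs.
  by move=> Hj; rewrite -mem_vertices ?mem_nth // (ord_lt vertices_inv) ?mem_nth.
have Hn j : j < size vertices -> nth 0 vertices j < n.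
  by move=> Hj; rewrite (ord_lt vertices_inv) ?mem_nth.
have U : uniq vertices by have := ord_uniq vertices_inv; rewrite cat_uniq => /and3P[].
rewrite {1}/cluster_rank (take_nth 0) ?(ltnW Hi) // -cats1 count_cat /= adj addn0 addn1.
congr _.+1; apply: eq_in_count => w /(nthP 0)[j]; rewrite size_take (ltnW Hi) => Hj.
rewrite nth_take // => <-.
have jv : j < size vertices by apply: ltn_trans (ltnW Hi).
apply/idP/idP => H.
  apply: (ad_cluster OK) (ad_sym OK _ adj) H _; rewrite ?Hx ?Hn ?(ltnW Hi) //.
  by rewrite nth_uniq ?(ltnW Hi) // gtn_eqF.
apply: (ad_cluster OK) adj H _; rewrite ?Hx ?(ltnW Hi) //.
by rewrite nth_uniq ?gtn_eqF // ltnW.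
Qed.

Lemma order_ok s : loaded s -> (forall u, u < n -> sa s a_off u = offset u) ->
  (forall w, sa s a_done w = (w \in xs)) -> (forall i, sa s a_st i = 0) ->
  wp p_order s (2 + \sum_(0 <= u < n) (9 + 6 * size (ad u)))
    (fun s' => [/\ sv s' v_cnt = size vertices,
       forall i, i < size vertices -> sa s' a_ord i = nth 0 vertices i &
       forall i, i < size vertices -> (sa s' a_st i != 0) = (cluster_rank i == 0)]).
Proof.
move=> [En _ _ _ El] Hoff Hdone Hst; eapply wp_le.
  apply/wp_seq/wp_set; set s1 := setv _ _ _.
  have E1 : eval inp s1 (EV v_n) = n by [].
  pose rank0 (acc : seq nat) i := ~~ has (fun w => w \in ad (nth 0 acc i)) (take i acc).
  pose J acc (s' : store) := [/\ sv s' v_cnt = size acc,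
     forall i, i < size acc -> sa s' a_ord i = nth 0 acc i,
     forall w, sa s' a_done w = (w \in xs ++ acc) &
     forall i, sa s' a_st i = (i < size acc) && rank0 acc i].
  eapply wp_conseq; [exact: leqnn| |apply: (wp_for_sum (I := fun u => J (order u))
    (t := fun u => 8 + 6 * size (ad u)) E1)].
  - move=> s' [[Hc Ho _ Hs] _ _]; split=> // i Hi; rewrite Hs Hi /= /cluster_rank.
    by rewrite [RHS]eqn0Ngt -has_count /rank0; case: has.
  - by split=> //= w; rewrite Hdone cats0.
  move=> u s' Hu su [Fv Fa] [Hc Ho Hd Hs]; have I := order_inv_ok (ltnW Hu).
  have l' : sv s' v_l = l by rewrite Fv //; exact: El.
  have off' w : w < n -> sa s' a_off w = offset w by move=> Hw; rewrite Fa //; exact: Hoff.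
  rewrite orderS /visit; set acc := order u in Hc Ho Hd Hs I *.
  apply: wp_if => /=; rewrite su Hd; case: ifP => // nu _.
    by apply: (wp_le (t := 1)) => //; apply: wp_set.
  have {}nu := negbT nu; have new := visit_new I Hu nu.
  eapply wp_le.
    apply/wp_seq/wp_put/wp_seq/wp_put/wp_seq/wp_put/wp_seq/wp_set/wp_seq/wp_set/wp_seq/wp_set.
    set s2 := setv _ _ _.
    have E2 : eval inp s2 (EV v_d) = size (ad u) by rewrite /= su l' (in_deg OK).
    have o2 : sv s2 v_o = offset u by rewrite /= su off'.
    have u2 : sv s2 v_u = u by [].
    pose part b := acc ++ u :: [seq w <- take b (ad u) | w \notin xs].
    eapply wp_conseq; [exact: leqnn| |apply: (wp_for (I := fun b => J (part b)) (t := 5) E2)].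
    + move=> s3 [HJ _ [Gv Ga]]; split; first by rewrite Gv.
      by move: HJ; rewrite /part take_size.
    + rewrite /part take0 cats1; split=> /=.
      * by rewrite Hc size_rcons addn1.
      * move=> i; rewrite size_rcons ltnS nth_rcons Hc su leq_eqVlt.
        by case: eqP => [->|_] /= Hi; rewrite ?ltnn ?eqxx // Hi Ho.
      * by move=> w; rewrite su -cats1 catA mem_cat inE Hd; case: eqP => _; rewrite ?orbT ?orbF.
      * move=> i; rewrite Hc size_rcons ltnS leq_eqVlt; case: eqP => [->|ni] /=.
          rewrite /rank0 nth_rcons ltnn eqxx -cats1 take_size_cat //.
          by case: hasP => // -[w wa /new]; rewrite wa.
        rewrite Hs; case: ltnP => //= Hi; rewrite /rank0 nth_rcons Hi -cats1.
        by rewrite takel_cat // ltnW.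
    move=> b s3 Hb sb [Gv Ga] [Kc Ko Kd Ks].
    have u3 : sv s3 v_u = u by rewrite Gv.
    have Ew : nth 0 inp (sv s3 v_o + sv s3 v_b) = nth 0 (ad u) b.
      by rewrite sb Gv // o2 (in_ad OK).
    set w := nth 0 (ad u) b in Ew.
    have wu : w \in ad u by apply: mem_nth.
    have Ep : part b.+1 = part b ++ (if w \in xs then [::] else [:: w]).
      rewrite /part (take_nth 0) // -cats1 filter_cat /= -/w -catA /=.
      by case: (w \in xs).
    (* The marks in [a_done] can stop a neighbour of [u] only if it is in [xs]: it is not in [acc]
       by [new], differs from [u], and occurs once in the list. *)
    have seenE : (w \in xs ++ part b) = (w \in xs).
      rewrite /part !mem_cat inE (negbTE (new w wu)) mem_filter /=.
      case wx: (w \in xs) => //=; have -> : (w == u) = false.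
        by apply: contraTF wu => /eqP->; apply: ad_irr OK _.
      apply/negP => /(nthP 0)[j]; rewrite size_take Hb => Hj; rewrite nth_take //.
      by apply/eqP; rewrite nth_uniq ?(uniq_ad OK) ?ltn_eqF // (ltn_trans Hj).
    eapply wp_le.
      apply/wp_seq/wp_set; rewrite /= Ew.
      apply: wp_if => /=; rewrite Kd seenE; case wx: (w \in xs) => // _; last first.
        apply/wp_seq/wp_put/wp_seq/wp_put/wp_set; split=> //.
        rewrite Ep wx cats1; split=> /=.
      * by rewrite Kc size_rcons addn1.
      * move=> i; rewrite size_rcons ltnS nth_rcons Kc leq_eqVlt.
        by case: eqP => [->|_] /= Hi; rewrite ?ltnn ?eqxx // Hi Ko.
      * by move=> w'; rewrite -cats1 catA mem_cat inE Kd; case: eqP => _; rewrite ?orbT ?orbF.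
      * move=> i; rewrite Ks size_rcons ltnS [i <= _]leq_eqVlt; case: eqP => [->|ni] /=.
          rewrite ltnn /rank0 nth_rcons ltnn eqxx -cats1 take_size_cat //.
          suff -> : has (in_mem^~ (mem (ad w))) (part b) by [].
          apply/hasP; exists u.
            by rewrite /part mem_cat inE eqxx orbT.
          exact: ad_sym OK _ _ Hu wu.
        case: ltnP => //= Hi; rewrite /rank0 nth_rcons Hi -cats1.
        by rewrite takel_cat // ltnW.
      apply: (wp_le (t := 1)) => //; apply: wp_set.
      by split; rewrite //= Ep wx cats0; split.
    by [].
  lia.
rewrite big_split /=; lia.
Qed.

End Input.

Local Notation v_kx := 25 (only parsing).
Local Notation v_s0 := 26 (only parsing).
Local Notation v_bad := 27 (only parsing).
Local Notation v_a := 28 (only parsing).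
Local Notation v_x := 29 (only parsing).
Local Notation v_z := 30 (only parsing).
Local Notation v_rk := 31 (only parsing).
Local Notation v_i := 32 (only parsing).
Local Notation v_v := 33 (only parsing).
Local Notation v_c := 34 (only parsing).
Local Notation v_idx := 35 (only parsing).
Local Notation v_best := 36 (only parsing).
Local Notation v_tot := 37 (only parsing).
Local Notation v_sig := 38 (only parsing).
Local Notation v_cand := 39 (only parsing).
Local Notation v_p := 40 (only parsing).
Local Notation v_y := 41 (only parsing).

(** * Updating the table *)

Definition e_h1 : expr := EAdd (EV v_h) (EC 1).
Definition e_2l : expr := EAdd (EV v_l) (EV v_l).

(* The counts of the current cluster are the leading digits of a state, so
   resetting them sends the state [z] to [z %% (h + 1) ^ l]. *)
Definition p_restart : com :=
  v_idx <~ EV v_pl;;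
  CFor v_c (ESub (EV v_pl) (EC 1))
    (CFor v_z (EV v_pl)
      (CIf (e_le (EA a_t (EV v_z)) (EA a_t (EV v_idx)))
         (CPut a_t (EV v_z) (EA a_t (EV v_idx))) skip;;
       CPut a_t (EV v_idx) (EC 0);; v_idx <~ EAdd (EV v_idx) (EC 1))).

Definition p_candidate : com :=
  CIf (e_le (EV v_best) (EV v_cand)) (v_best <~ EV v_cand) skip.

(* A transition increases the state, so running downwards the table can be
   updated in place. *)
Definition p_step : com :=
  CFor v_z (EV v_ns)
    (v_sig <~ ESub (ESub (EV v_ns) (EC 1)) (EV v_z);;
     p_digits a_ps a_dg e_h1 e_2l (EV v_sig);;
     v_best <~ EC 0;; v_tot <~ EC 0;;
     CFor v_y (EV v_l)
       (v_tot <~ EAdd (EV v_tot) (EA a_dg (EAdd (EV v_l) (EV v_y)));;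
        CIf (EA a_dg (EV v_y))
          (CIf (EA a_dg (EAdd (EV v_l) (EV v_y)))
            (v_p <~ EA a_t (ESub (ESub (EV v_sig) (EA a_ps (EV v_y)))
                               (EA a_ps (EAdd (EV v_l) (EV v_y))));;
             CIf (EV v_p)
               (v_cand <~ EAdd (EAdd (EV v_p) (EA a_g (EAdd (EV v_y) (EC 1))))
                          (ESub (EA a_dg (EAdd (EV v_l) (EV v_y))) (EC 1));;
                p_candidate)
               skip)
            skip)
          skip);;
     CIf (EA a_t (EV v_sig))
       (v_cand <~ EAdd (EA a_t (EV v_sig)) (EA a_mod (ESub (EV v_rk) (EV v_tot)));;
        p_candidate)
       skip;;
     CPut a_t (EV v_sig) (EV v_best)).

Section Table.
Variables (inp : seq nat) (l h : nat).
Notation wp := (wp inp).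
Let R := h.+1.
Let N := R ^ (l + l).

Lemma restart_ok s :
  sv s v_pl = R ^ l ->
  wp p_restart s (2 + N * 7)
    (fun s' => (forall z, z < R ^ l -> sa s' a_t z = \max_(0 <= c < R ^ l) sa s a_t (c * R ^ l + z))
       /\ (forall z, R ^ l <= z < N -> sa s' a_t z = 0)).
Proof.
set P := R ^ l => EP; have P0 : 0 < P by rewrite expn_gt0.
have NE : N = P * P by rewrite /N expnD.
pose best c z := \max_(0 <= c' < c) sa s a_t (c' * P + z).
have bestS c z : best c.+1 z = maxn (best c z) (sa s a_t (c * P + z)).
  by rewrite /best big_nat_recr.
eapply wp_le.
  apply/wp_seq/wp_set; set s1 := setv _ _ _.
  have E1 : eval inp s1 (ESub (EV v_pl) (EC 1)) = P.-1 by rewrite /= EP subn1.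
  (* The table consists of [P] blocks of length [P]. In round [c], block 0 holds the maxima over
     blocks [0, ..., c]; for the residues below [y] it also takes in block [c.+1], whose entries
     there are cleared. *)
  pose J c y (s' : store) := [/\ sv s' v_idx = P * c.+1 + y,
    forall z, z < P -> sa s' a_t z = best (c.+1 + (z < y)) z &
    forall z, P <= z -> sa s' a_t z = if z < P * c.+1 + y then 0 else sa s a_t z].
  eapply wp_conseq; [exact: leqnn| |apply: (wp_for (I := fun c => J c 0) (t := 1 + P * 6) E1)].
  - move=> s' [[_ Hlo Hhi] _ _]; split=> z Hz.
      by rewrite Hlo // ltn0 addn0 prednK.
    case/andP: Hz => Hz1 Hz2; rewrite Hhi // addn0 prednK // -NE Hz2 //.
  - split=> /= [|z Hz|z Hz]; first by rewrite EP muln1 addn0.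
      by rewrite ?ltn0 ?addn0 /best big_nat1 mul0n.
    by rewrite muln1 addn0 ltnNge Hz.
  move=> c s' Hc sc [Fv Fa] HJ; have EP' : eval inp s' (EV v_pl) = P by rewrite /= Fv.
  eapply wp_conseq; [| |apply: (wp_for (I := fun y => J c y) (t := 5) EP')]; first lia.
  + move=> s2 [[Hi Hlo Hhi] _ [Gv Ga]]; split; first by rewrite Gv.
    split=> /= [|z Hz|z Hz]; first by rewrite Hi addn0 -mulnSr.
      by rewrite Hlo // Hz ?ltn0 ?addn0 ?addn1.
    by rewrite Hhi // addn0 -mulnSr.
  + by case: HJ => Hi Hlo Hhi; split.
  move=> y s2 Hy sy _ [Hi Hlo Hhi].
  have Ec : c.+1 * P + y = P * c.+1 + y by rewrite mulnC.
  have Ny : (P * c.+1 + y == y) = false by rewrite mulnC; apply/eqP; have := leq_pmull P (ltn0Sn c); lia.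
  have ge : P <= P * c.+1 + y by rewrite mulnC; have := leq_pmull P (ltn0Sn c); lia.
  have upd s3 : sv s3 v_idx = P * c.+1 + y -> sv s3 v_z = y ->
     (forall z, z < P -> sa s3 a_t z = best (c.+1 + (z < y.+1)) z) ->
     (forall z, P <= z -> sa s3 a_t z = sa s2 a_t z) ->
     wp (CPut a_t (EV v_idx) (EC 0);; v_idx <~ EAdd (EV v_idx) (EC 1)) s3 2
       (fun s4 => sv s4 v_z = y /\ J c y.+1 (setv (tick s4) v_z y.+1)).
    move=> Ki Kz Klo Khi; eapply wp_le.
      apply/wp_seq/wp_put/wp_set; split=> //=; rewrite Ki.
      split=> /= [|z Hz|z Hz]; first by rewrite addn1 addnS.
        rewrite ltn_eqF; last by apply: leq_trans Hz ge.
        exact: Klo.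
      by rewrite addnS ltnS leq_eqVlt; case: eqP => //= _; rewrite Khi // Hhi.
    by [].
  have Told : sa s2 a_t (P * c.+1 + y) = sa s a_t (P * c.+1 + y) by rewrite Hhi // ltnn.
  eapply wp_le.
    apply: wp_seq; apply: wp_if_le; rewrite /= sy Hi Told (Hlo _ Hy) ltnn addn0 => le.
      apply: wp_put; apply: upd => //= [z Hz|z Hz]; rewrite sy Hi Told.
        case: eqP => [->|nz]; first by rewrite ltnSn addn1 bestS Ec (maxn_idPr le).
        by rewrite Hlo // ltnS [in RHS]leq_eqVlt; case: eqP nz.
      by rewrite gtn_eqF // (leq_trans Hy Hz).
    apply: wp_set; apply: upd => //= z Hz; rewrite Hlo // ltnS [in RHS]leq_eqVlt.
    case: eqP => //= ->; rewrite ltnn addn0 addn1 (bestS c.+1) Ec.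
    by apply/esym/maxn_idPl/ltnW.
  by [].
rewrite NE; nia.
Qed.

Lemma candidate_ok s (Q : store -> Prop) :
  (forall s', sv s' v_best = maxn (sv s v_best) (sv s v_cand) ->
     frame [:: v_best; v_junk] [::] s s' -> Q s') ->
  wp p_candidate s 2 Q.
Proof.
move=> H; apply: wp_if_le => /= le; apply: wp_set; apply: H => //=.
- by rewrite (maxn_idPr le).
- by split=> // y; rewrite /= inE negb_or => /andP[/negbTE->].
- by rewrite (maxn_idPl (ltnW le)).
- by split=> // y; rewrite /= !inE negb_or => /andP[_ /negbTE->].
Qed.

Definition step_cost : nat := 13 + 9 * l + (l + l) * (5 + 4 * R).

Lemma step_ok (T : nat -> nat) (g : nat -> nat -> nat) (n i rk : nat) s :
  sv s v_h = h -> sv s v_l = l -> sv s v_ns = N ->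
  sv s v_rk = rk -> rk <= n -> rk <= i ->
  (forall j, j < l + l -> sa s a_ps j = R ^ j) ->
  (forall r, r <= n -> sa s a_mod r = r %% h) ->
  (forall j, j < l -> sa s a_g j.+1 = g i j.+1) ->
  (forall z, sa s a_t z = T z) ->
  wp p_step s (1 + N * step_cost.+1)
    (fun s' => forall z, z < N -> sa s' a_t z = step_table l h g i (i - rk) T z).
Proof.
move=> Eh El En Erk rkn rki HP Hmod Hg HT.
set new := step_table _ _ _ _ _ _.
have E1 : eval inp s (EV v_ns) = N by [].
eapply wp_conseq; [| |apply: (wp_for (I := fun z s' =>
  forall z', sa s' a_t z' = if N - z <= z' < N then new z' else T z') (t := step_cost) E1)].
- by [].
- by move=> s' [H _ _] z Hz; rewrite H subnn Hz.
- by move=> z' /=; rewrite HT; case: ifP => //; lia.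
move=> z s' Hz sz [Fv Fa] HT'; eapply wp_le.
  have h' : sv s' v_h = h by rewrite Fv.
  have l' : sv s' v_l = l by rewrite Fv.
  apply/wp_seq/wp_set; rewrite /= (Fv v_ns) // En sz; set sig := N - 1 - z.
  have sigN : sig < N by rewrite /sig; lia.
  apply/wp_seq/wp_frame; eapply wp_conseq; [exact: leqnn| |
    apply: (digits_ok (R := R) (L := l + l) (z := sig)) => //].
  - move=> s2 Hdg [Gv Ga].
    have T2 z' : sa s2 a_t z' = if N - z <= z' < N then new z' else T z'.
      by rewrite Ga //=.
    have sig2 : sv s2 v_sig = sig by rewrite Gv.
    have z2 : sv s2 v_z = z by rewrite Gv.
    have l2 : sv s2 v_l = l by rewrite Gv.
    have rk2 : sv s2 v_rk = rk by rewrite Gv //= Fv.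
    have told z' : z' <= sig -> sa s2 a_t z' = T z'.
      by move=> Hz'; rewrite T2 ifF //; move: Hz'; rewrite /sig; lia.
    have P2 j : j < l + l -> sa s2 a_ps j = R ^ j by move=> Hj; rewrite Ga //= Fa // HP.
    have g2 j : j < l -> sa s2 a_g j.+1 = g i j.+1 by move=> Hj; rewrite Ga //= Fa // Hg.
    have m2 r : r <= n -> sa s2 a_mod r = r %% h by move=> Hr; rewrite Ga //= Fa // Hmod.
    apply/wp_seq/wp_set/wp_seq/wp_set; apply: wp_seq.
    set s3 := setv _ _ _.
    have E3 : eval inp s3 (EV v_l) = l by rewrite /= l2.
    pose cand j := if [&& 0 < digit R j sig, 0 < digit R (l + j) sig
        & T (sig - R ^ j - R ^ (l + j)) != 0]
      then T (sig - R ^ j - R ^ (l + j)) + g i j.+1 + (digit R (l + j) sig).-1 else 0.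
    eapply wp_conseq; [exact: leqnn| |apply: (wp_for (I := fun y s' =>
      sv s' v_tot = \sum_(0 <= j < y) digit R (l + j) sig /\
      sv s' v_best = \max_(0 <= j < y) cand j) (t := 8) E3)].
    + move=> s4 [[Htot Hbest] _ [Kv Ka]].
      have t4 z' : sa s4 a_t z' = sa s2 a_t z' by rewrite Ka.
      have sig4 : sv s4 v_sig = sig by rewrite Kv.
      have z4 : sv s4 v_z = z by rewrite Kv.
      have rk4 : sv s4 v_rk = rk by rewrite Kv.
      have new_sig : new sig = maxn (if T sig == 0 then 0
          else T sig + (rk - \sum_(0 <= j < l) digit R (l + j) sig) %% h)
          (\max_(0 <= j < l) cand j).
        by rewrite /new /step_table subKn.
      have fin s5 : sv s5 v_sig = sig -> sv s5 v_z = z -> sv s5 v_best = new sig ->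
          (forall z', sa s5 a_t z' = sa s2 a_t z') ->
          wp (CPut a_t (EV v_sig) (EV v_best)) s5 1 (fun s6 => sv s6 v_z = z /\
            forall z', sa (setv (tick s6) v_z z.+1) a_t z' =
              if N - z.+1 <= z' < N then new z' else T z').
        move=> Ks Kz Kb Kt; apply: wp_put; split=> //= z'; rewrite Ks.
        case: eqP => [->|nz]; first by rewrite Kb ifT //; move: sigN; rewrite /sig; lia.
        rewrite Kt T2; congr (if _ then _ else _); move: nz; rewrite /sig; lia.
      apply: wp_seq; apply: wp_if => /=; rewrite sig4 t4 told // => Tsig.
        apply/wp_seq/wp_set/candidate_ok => s5 /= Hb5 [Mv Ma].
        apply: fin; [by rewrite Mv|by rewrite Mv| |by move=> z'; rewrite Ma //=].
        rewrite Hb5 Hbest sig4 t4 told // rk4 Htot Ka // m2; last lia.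
        by rewrite new_sig (negbTE Tsig) maxnC.
      eapply wp_le; first apply: wp_set; last by [].
      apply: fin => //=; rewrite Hbest new_sig Tsig eqxx max0n //.
    + by split=> /=; rewrite big_geq.
    move=> y s4 Hy sy [Kv Ka] [Htot Hbest].
    have l4 : sv s4 v_l = l by rewrite Kv.
    have sig4 : sv s4 v_sig = sig by rewrite Kv.
    have dg4 j : j < l + l -> sa s4 a_dg j = digit R j sig by move=> Hj; rewrite Ka //= Hdg.
    have P4 j : j < l + l -> sa s4 a_ps j = R ^ j by move=> Hj; rewrite Ka //= P2.
    have g4 : sa s4 a_g y.+1 = g i y.+1 by rewrite Ka //= g2.
    have [Hy1 Hy2] : y < l + l /\ l + y < l + l by lia.
    have Snext s5 : sv s5 v_y = y -> sv s5 v_tot = sv s4 v_tot + digit R (l + y) sig ->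
        sv s5 v_best = maxn (sv s4 v_best) (cand y) -> sv s5 v_y = y /\
        (sv (setv (tick s5) v_y y.+1) v_tot = \sum_(0 <= j < y.+1) digit R (l + j) sig /\
         sv (setv (tick s5) v_y y.+1) v_best = \max_(0 <= j < y.+1) cand j).
      by move=> K1 K2 K3; rewrite /= K2 K3 Htot Hbest !big_nat_recr.
    (* Each of the three tests, if it fails, makes the candidate 0 and leaves the maximum as it
       is. *)
    have Cskip s5 t : cand y = 0 -> sv s5 v_y = y -> 0 < t ->
        sv s5 v_tot = sv s4 v_tot + digit R (l + y) sig -> sv s5 v_best = sv s4 v_best ->
        wp skip s5 t (fun s1 => sv s1 v_y = y /\
        (sv (setv (tick s1) v_y y.+1) v_tot = \sum_(0 <= j < y.+1) digit R (l + j) sig /\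
         sv (setv (tick s1) v_y y.+1) v_best = \max_(0 <= j < y.+1) cand j)).
      move=> K1 K2 K3 K4 K5; eapply wp_le; first apply: wp_set; last by [].
      by apply: Snext; rewrite //= K1 maxn0.
    apply: (wp_le (t := 1 + 7)) => //.
    apply/wp_seq/wp_set; rewrite /= l4 sy dg4 //.
      apply: wp_if => /=; rewrite sy dg4 // => d1; last first.
        by apply: Cskip; rewrite // /cand d1.
      apply: wp_if => /=; rewrite l4 sy dg4 // => d2; last first.
        by apply: Cskip; rewrite // /cand d2 andbF.
      apply: (wp_le (t := 1 + 4)) => //; apply/wp_seq/wp_set; rewrite /= sig4 l4 sy !P4 //.
      have -> : sa s4 a_t (sig - R ^ y - R ^ (l + y)) = T (sig - R ^ y - R ^ (l + y)).
        by rewrite Ka //= told //; lia.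
      apply: wp_if => /= Tp; last by apply: Cskip; rewrite // /cand Tp !andbF.
      apply: (wp_le (t := 1 + 2)) => //; apply/wp_seq/wp_set/candidate_ok => s5 /= Hb5 [Mv Ma].
      apply: Snext; [by rewrite Mv|by rewrite Mv //= l4 sy dg4|rewrite Hb5 l4 sy addn1 g4 dg4 // /cand !lt0n d1 d2 Tp subn1 //].
  - by rewrite /= h' addn1.
  - by rewrite /= l'.
  - by move=> j Hj; rewrite /= Fa // HP.
rewrite /step_cost; lia.
Qed.

End Table.

(** * Processing one labelling of [X] *)

Definition p_gains : com :=
  CFor v_j (EAdd (EV v_l) (EC 1)) (CPut a_g (EV v_j) (EC 0));;
  v_o <~ EA a_off (EV v_v);; v_d <~ e_degree (EV v_v);;
  CFor v_b (EV v_d)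
    (v_x <~ EA a_lb (EI (EAdd (EV v_o) (EV v_b)));;
     CPut a_g (EV v_x) (EAdd (EA a_g (EV v_x)) (EC 1))).

Definition p_vertex : com :=
  v_v <~ EA a_ord (EV v_i);;
  CIf (EA a_st (EV v_i)) (p_restart;; v_rk <~ EC 0) skip;;
  p_gains;; p_step;; v_rk <~ EAdd (EV v_rk) (EC 1).

Definition p_dp : com := v_rk <~ EC 0;; CFor v_i (EV v_cnt) p_vertex.

(** Vertices of [X] still to come have been reset to 0 in [a_lb], so only earlier ones match the
    label [v_a + 1]; two comparisons test equality. [v_s0] accumulates the initial state of the
    table, and [v_bad] records that some part exceeds [h]. *)
Definition p_label : com :=
  v_w <~ e_vertex (EV v_u);; v_a <~ EA a_ld (EV v_u);;
  v_o <~ EA a_off (EV v_w);; v_d <~ e_degree (EV v_w);;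
  CFor v_b (EV v_d)
    (v_x <~ EA a_lb (EI (EAdd (EV v_o) (EV v_b)));;
     CIf (e_le (EV v_x) (EAdd (EV v_a) (EC 1)))
       (CIf (e_le (EAdd (EV v_a) (EC 1)) (EV v_x)) (v_kx <~ EAdd (EV v_kx) (EC 1)) skip)
       skip);;
  CPut a_lb (EV v_w) (EAdd (EV v_a) (EC 1));;
  CPut a_sz (EV v_a) (EAdd (EA a_sz (EV v_a)) (EC 1));;
  v_s0 <~ EAdd (EV v_s0) (EA a_ps (EV v_a));;
  CIf (e_le e_h1 (EA a_sz (EV v_a))) (v_bad <~ EC 1) skip.

Definition p_labels : com :=
  p_digits a_pl a_ld (EV v_l) (EV v_l) (EV v_lam);;
  CFor v_j (EV v_l) (CPut a_lb (e_vertex (EV v_j)) (EC 0));;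
  CFor v_j (EV v_l) (CPut a_sz (EV v_j) (EC 0));;
  v_kx <~ EC 0;; v_s0 <~ EC 0;; v_bad <~ EC 0;;
  CFor v_u (EV v_l) p_label.

Definition p_init_table : com :=
  CFor v_z (EV v_ns) (CPut a_t (EV v_z) (EC 0));;
  CIf (EV v_bad) skip (CPut a_t (EV v_s0) (EAdd (EV v_kx) (EC 1))).

Definition p_check : com :=
  CFor v_z (EV v_ns)
    (CIf (EA a_t (EV v_z))
       (CIf (e_le (EAdd (EV v_m) (EC 1)) (EAdd (EA a_t (EV v_z)) (EV v_k)))
          (v_res <~ EC 1) skip)
       skip).

Definition p_labelling : com := p_labels;; p_init_table;; p_dp;; p_check.

Section Search.
Variables (n m k h l : nat) (xs : seq nat) (ad : nat -> seq nat) (inp : seq nat).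
Hypothesis OK : input_ok n m k h l xs ad inp.
Notation wp := (wp inp).
Notation loaded := (loaded n m k h l).
Notation offset := (offset n l ad).
Notation vertices := (vertices n xs ad).
Notation rank_of := (cluster_rank n xs ad).
Let R := h.+1.
Let N := R ^ (l + l).

(** During the search [a_lb] is 0 outside [X], so the positive entries of [a_g] count neighbours in
    [X] only. *)
Lemma gains_ok s v : loaded s -> v < n -> sv s v_v = v -> sa s a_off v = offset v ->
  wp p_gains s (6 + 2 * l.+1 + 3 * size (ad v))
    (fun s' => forall x, x <= l -> sa s' a_g x = count (fun w => sa s a_lb w == x) (ad v)).
Proof.
move=> [_ _ _ _ El] Hv Ev Eo; eapply wp_le.
  have E1 : eval inp s (EAdd (EV v_l) (EC 1)) = l.+1 by rewrite /= El addn1.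
  apply: wp_seq; eapply wp_conseq; [exact: leqnn| |apply: (wp_for (I := fun j s' =>
    forall x, x < j -> sa s' a_g x = 0) (t := 1) E1)] => //.
  - move=> s1 [G0 _ [Fv Fa]]; apply/wp_seq/wp_set/wp_seq/wp_set.
    set s2 := setv _ _ _.
    have E2 : eval inp s2 (EV v_d) = size (ad v).
      by rewrite /= !(Fv v_v) // !(Fv v_l) // El Ev (in_deg OK).
    eapply wp_conseq; [exact: leqnn| |apply: (wp_for (I := fun b s' =>
      forall x, x <= l -> sa s' a_g x = count (fun w => sa s a_lb w == x) (take b (ad v)))
      (t := 2) E2)].
    + by move=> s3 [H _ _] x Hx; rewrite H // take_size.
    + by move=> x Hx; rewrite take0 /= G0.
    move=> b s3 Hb sb [Gv Ga] H; eapply wp_le.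
      have o3 : sv s3 v_o = offset v by rewrite Gv //= (Fv v_v) // Ev Fa.
      apply/wp_seq/wp_set/wp_put; split=> //= x Hx.
      rewrite o3 sb (in_ad OK) // Ga //= Fa // (take_nth 0) // -cats1 count_cat /= addn0.
      by rewrite -H // eq_sym; case: eqP => [->|_]; rewrite ?addn0.
    by [].
  - move=> j s' Hj sj _ H; apply: wp_put; split=> //= x Hx; rewrite sj.
    by case: eqP => // nj; apply: H; lia.
lia.
Qed.

Section Labelling.
Variables (lab : nat -> nat).
Hypothesis lab_lt : forall a, a < l -> lab a < l.

Definition label_of (w : nat) : nat := if w \in xs then (lab (index w xs)).+1 else 0.
Definition part_size (a j : nat) : nat := count (fun i => lab i == j) (iota 0 a).
Definition earlier_same (a : nat) : nat :=
  count (fun w => (w \in take a xs) && (lab (index w xs) == lab a)) (ad (nth 0 xs a)).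
Definition kept_inside : nat := \sum_(0 <= a < l) earlier_same a.
Definition label_gain (i x : nat) : nat :=
  count (fun w => label_of w == x) (ad (nth 0 vertices i)).

Notation tab := (tabulates l h kept_inside (part_size l) label_gain rank_of).

Definition vertex_cost (v : nat) : nat :=
  14 + 2 * l.+1 + 3 * size (ad v) + N * 7 + N * (step_cost l h).+1.

(** The counter [v_rk] on entering round [i]: one more than the rank of the previous vertex, whose
    cluster starts at [i - prev_rank i]. It equals the rank of vertex [i] unless a new cluster
    starts there. *)
Definition prev_rank (i : nat) : nat := if i is j.+1 then (rank_of j).+1 else 0.

Lemma dp_ok s : loaded s -> 0 < h -> sv s v_cnt = size vertices ->
  sv s v_ns = N -> sv s v_pl = R ^ l ->
  (forall j, j < l + l -> sa s a_ps j = R ^ j) ->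
  (forall r, r <= n -> sa s a_mod r = r %% h) ->
  (forall u, u < n -> sa s a_off u = offset u) ->
  (forall i, i < size vertices -> sa s a_ord i = nth 0 vertices i) ->
  (forall i, i < size vertices -> (sa s a_st i != 0) = (rank_of i == 0)) ->
  (forall w, w < n -> sa s a_lb w = label_of w) ->
  tab 0 0 (sa s a_t) ->
  wp p_dp s (2 + \sum_(0 <= i < size vertices) (vertex_cost (nth 0 vertices i)).+1)
    (fun s' => exists q, tab (size vertices) q (sa s' a_t)).
Proof.
move=> [En Em Ek Eh El] h0 Ec Ens Epl HP Hmod Hoff Hord Hst Hlb T0; eapply wp_le.
  apply/wp_seq/wp_set; set s1 := setv _ _ _.
  have E1 : eval inp s1 (EV v_cnt) = size vertices by [].
  eapply wp_conseq; [exact: leqnn| |apply: (wp_for_sum (I := fun i s' =>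
     sv s' v_rk = prev_rank i /\ tab i (i - prev_rank i) (sa s' a_t))
     (t := fun i => vertex_cost (nth 0 vertices i)) E1)].
  - by move=> s' [[_ H] _ _]; eexists; apply: H.
  - by split.
  move=> i s' Hi si F0 [Hrk HT].
  have {F0} [Fv Fa] : frame (v_i :: mod_vars p_vertex) (mod_arrays p_vertex) s s'.
    case: F0 => V A; split=> [y Hy|a Ha j]; last exact: A.
    by rewrite V //=; case: eqP Hy => // ->.
  set v := nth 0 vertices i.
  have Hv : v < n by apply: (ord_lt (vertices_inv OK)); apply: mem_nth.
  have Hin : i <= n by apply: leq_trans (ltnW Hi) (size_vertices OK).
  have l' : loaded s' by split; rewrite Fv.
  (* Common continuation of both branches, once the counter and the table refer to the cluster of
     vertex [i]. *)
  have next s2 : loaded s2 -> frame (v_i :: mod_vars p_vertex) (mod_arrays p_vertex) s s2 ->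
      sv s2 v_i = i -> sv s2 v_v = v -> sv s2 v_rk = rank_of i ->
      tab i (i - rank_of i) (sa s2 a_t) ->
      wp (p_gains;; p_step;; v_rk <~ EAdd (EV v_rk) (EC 1)) s2
        (6 + 2 * l.+1 + 3 * size (ad v) + (1 + N * (step_cost l h).+1 + 1))
        (fun s1 => sv s1 v_i = i /\ sv (setv (tick s1) v_i i.+1) v_rk = prev_rank i.+1 /\
           tab i.+1 (i.+1 - prev_rank i.+1) (sa (setv (tick s1) v_i i.+1) a_t)).
    move=> L2 [Gv Ga] i2 v2 rk2 T2; apply/wp_seq/wp_frame.
    eapply wp_conseq; [exact: leqnn| |apply: (gains_ok (v := v)) => //]; last by rewrite Ga // Hoff.
    move=> s3 Hg [Kv Ka]; apply/wp_seq/wp_frame.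
    eapply wp_conseq; [exact: leqnn| |apply: (@step_ok inp l h (sa s3 a_t) label_gain n i (rank_of i) s3) => //].
    - move=> s4 Hn [Mv Ma]; apply: wp_set; split; first by rewrite /= Mv // Kv.
      rewrite /= Mv // Kv // rk2 addn1; split=> //; rewrite subSS.
      apply: tabulates_ext Hn _; apply: tabulates_step.
      by apply: tabulates_ext T2 => z _; rewrite Ka.
    - by rewrite Kv // Gv.
    - by rewrite Kv // Gv.
    - by rewrite Kv // Gv.
    - by rewrite Kv.
    - by apply: leq_trans (cluster_rank_le _ _ _ _) Hin.
    - exact: cluster_rank_le.
    - by move=> j Hj; rewrite Ka // Ga // HP.
    - by move=> r Hr; rewrite Ka // Ga // Hmod.
    - move=> j Hj; rewrite Hg // /label_gain -/v; apply: eq_in_count => w wv.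
      by rewrite Ga // Hlb // (ad_lt OK wv).
  eapply wp_le.
    apply/wp_seq/wp_set; rewrite /= si Fa // Hord // -/v; apply: wp_seq.
    set s2 := setv _ _ _.
    apply: (wp_if (t := 3 + N * 7)) => /=; rewrite si Fa // => Est.
      have rk0 : rank_of i = 0 by apply/eqP; rewrite -Hst.
      apply: (wp_le (t := 2 + N * 7 + 1)); last lia.
      apply/wp_seq/wp_frame; eapply wp_conseq; [exact: leqnn| |apply: (@restart_ok inp l h)];
        last by rewrite /= Fv.
      move=> s3 [Hlo Hhi] [Kv Ka]; apply: wp_set; apply: next.
      + by case: l' => ? ? ? ? ?; split; rewrite /= Kv.
      + apply: frame_setv => //; apply: frame_trans (frame_all _ _ (conj Kv Ka)) => //.
        exact: frame_setv.
      + by rewrite /= Kv.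
      + by rewrite /= Kv.
      + by [].
      + rewrite rk0 subn0; apply: tabulates_restart HT => //.
    have rkn : rank_of i != 0 by rewrite -Hst // Est.
    have rkE : rank_of i = prev_rank i.
      case: (i) Hi rkn => [|j] Hj; last by apply: (cluster_rankS OK).
      by rewrite /cluster_rank take0.
    eapply wp_le; first apply: wp_set; last by [].
    apply: next => //=; rewrite ?rkE //.
    by do 2 apply: frame_setv => //.
  rewrite /vertex_cost; lia.
by [].
Qed.

Lemma part_sizeS a j : part_size a.+1 j = part_size a j + (j == lab a).
Proof. by rewrite /part_size -addn1 iotaD count_cat /= addn0 add0n eq_sym. Qed.

Lemma labels_ok s z : loaded s -> sv s v_lam = z -> z < l ^ l ->
  (forall a, a < l -> digit l a z = lab a) ->
  (forall j, j < l -> sa s a_pl j = l ^ j) ->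
  (forall j, j < l + l -> sa s a_ps j = R ^ j) ->
  (forall u, u < n -> sa s a_off u = offset u) ->
  (forall w, w \notin xs -> sa s a_lb w = 0) ->
  wp p_labels s (10 + l * (5 + 4 * l) + l * 4 + \sum_(0 <= a < l) (12 + 5 * size (ad (nth 0 xs a))))
    (fun s' => [/\ forall w, sa s' a_lb w = label_of w, sv s' v_kx = kept_inside,
       sv s' v_s0 = number R (part_size l) l &
       (sv s' v_bad == 0) = [forall j : 'I_l, part_size l j <= h]]).
Proof.
move=> L0 Ez Hz Hlab HP HPS Hoff Hlb; have [_ _ _ Eh El] := L0.
eapply wp_le.
  apply/wp_seq/wp_frame; eapply wp_conseq; [exact: leqnn| |
    apply: (digits_ok (R := l) (L := l) (z := z)) => //].
  move=> s1 Hd [Fv Fa]; have E1 : eval inp s1 (EV v_l) = l by rewrite /= Fv.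
  apply: wp_seq; eapply wp_conseq; [exact: leqnn| |apply: (wp_for (I := fun j s' =>
    forall w, w \notin drop j xs -> sa s' a_lb w = 0) (t := 1) E1)].
  - move=> s2 [Hlb2 _ [Gv Ga]]; have E2 : eval inp s2 (EV v_l) = l by rewrite /= Gv.
    apply: wp_seq; eapply wp_conseq; [exact: leqnn| |apply: (wp_for (I := fun j s' =>
      forall i, i < j -> sa s' a_sz i = 0) (t := 1) E2)] => //.
    + move=> s3 [Hsz _ [Kv Ka]].
      do 3 apply/wp_seq/wp_set; set s4 := setv _ _ _.
      have E4 : eval inp s4 (EV v_l) = l by rewrite /= Kv.
      pose K a (s' : store) :=
        [/\ forall w, sa s' a_lb w = if w \in take a xs then (lab (index w xs)).+1 else 0,
        forall j, j < l -> sa s' a_sz j = part_size a j,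
        sv s' v_kx = \sum_(0 <= i < a) earlier_same i,
        sv s' v_s0 = number R (part_size a) l &
        (sv s' v_bad == 0) = [forall j : 'I_l, part_size a j <= h]].
      eapply wp_conseq; [exact: leqnn| |apply: (wp_for_sum (I := K)
        (t := fun a => 11 + 5 * size (ad (nth 0 xs a))) E4)].
      * move=> s5 [[H1 _ H3 H4 H5] _ _]; split=> // w.
        by rewrite H1 take_oversize // (size_xs OK).
      * split=> //= [w|||].
        - by rewrite take0 Ka // Hlb2 // drop_oversize // (size_xs OK).
        - by rewrite big_geq.
        - by rewrite /number big1.
        - by rewrite eqxx; apply/esym/forallP.
      move=> a s5 Ha sa5 F5 [Klb Ksz Kkx Ks0 Kbad].
      have [Mv Ma] := F5.
      set x := nth 0 xs a.
      have xn : x < n by apply: (xs_lt OK); rewrite mem_nth // (size_xs OK).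
      have h5 : sv s5 v_h = h by rewrite Mv //= Kv // Gv // Fv.
      have l5 : sv s5 v_l = l by rewrite Mv //= Kv // Gv // Fv.
      have ld5 : sa s5 a_ld a = lab a by rewrite Ma //= Ka // Ga // Hd // Hlab.
      have off5 : sa s5 a_off x = offset x by rewrite Ma //= Ka // Ga // Fa // Hoff.
      have ps5 : sa s5 a_ps (lab a) = R ^ lab a.
        by rewrite Ma //= Ka // Ga // Fa // HPS // ltn_addr // lab_lt.
      have ax : nth 0 inp (5 + a) = x by rewrite (in_xs OK).
      have ix : index x xs = a by rewrite index_uniq ?(uniq_xs OK) // (size_xs OK).
      eapply wp_le.
        do 4 apply/wp_seq/wp_set; rewrite /= !sa5 !ax ld5 off5 l5 (in_deg OK) //.
        set s6 := setv _ _ _.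
        have E6 : eval inp s6 (EV v_d) = size (ad x) by [].
        pose same b := count (fun w => (w \in take a xs) && (lab (index w xs) == lab a))
                         (take b (ad x)).
        apply: wp_seq; eapply wp_conseq; [exact: leqnn| |apply: (wp_for (I := fun b s' =>
          sv s' v_kx = sv s5 v_kx + same b) (t := 4) E6)].
        + move=> s7 [Nkx _ [Nv Na]].
          have w7 : sv s7 v_w = x by rewrite Nv.
          have a7 : sv s7 v_a = lab a by rewrite Nv.
          have h7 : sv s7 v_h = h by rewrite Nv.
          have sz7 : sa s7 a_sz (lab a) = part_size a (lab a).
            by rewrite Na //= Ksz // lab_lt.
          have ps7 : sa s7 a_ps (lab a) = R ^ lab a by rewrite Na //=.
          have last s8 : sv s8 v_u = a -> sv s8 v_kx = sv s7 v_kx ->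
              sv s8 v_s0 = sv s7 v_s0 + R ^ lab a ->
              (forall w, sa s8 a_lb w = if w == x then (lab a).+1 else sa s7 a_lb w) ->
              (forall j, sa s8 a_sz j = if j == lab a then part_size a.+1 (lab a) else sa s7 a_sz j) ->
              (sv s8 v_bad == 0) = (sv s7 v_bad == 0) && (part_size a.+1 (lab a) <= h) ->
              sv s8 v_u = a /\ K a.+1 (setv (tick s8) v_u a.+1).
            move=> U1 U2 U3 U4 U5 U6; split=> //; split=> /=.
            - move=> w; rewrite U4 Na //= Klb (take_nth 0) ?(size_xs OK) // mem_rcons inE -/x.
              by case: eqP => [->|_]; rewrite ?ix.
            - move=> j Hj; rewrite U5; case: eqP => [->//|/eqP/negbTE nj].
              by rewrite Na //= Ksz // part_sizeS nj addn0.
            - by rewrite U2 Nkx Kkx big_nat_recr //= /same take_size.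
            - rewrite U3 Nv // -[RHS](@eq_number R (fun j => part_size a j + (j == lab a))).
                by rewrite numberD number_single ?lab_lt //= Ks0.
              by move=> j _; rewrite part_sizeS.
            - rewrite U6 Nv //= Kbad; apply/andP/forallP => [[/forallP H1 H2] j|H].
                by rewrite part_sizeS; case: eqP => [->|_]; [rewrite part_sizeS eqxx in H2|rewrite addn0].
              split; last by have := H (Ordinal (lab_lt Ha)).
              by apply/forallP => j; have := H j; rewrite part_sizeS; lia.
          apply/wp_seq/wp_put/wp_seq/wp_put/wp_seq/wp_set.
          apply: wp_if_le; rewrite /= a7 eqxx h7 sz7 addn1 => le.
            apply: wp_set; apply: last => /=; rewrite ?a7 ?w7 ?ps7 ?sz7 ?addn1 //.
            + by rewrite Nv.
            + by move=> j; rewrite part_sizeS eqxx addn1.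
            + by rewrite part_sizeS eqxx (_ : (_ <= h) = false) ?andbF //; apply/negbTE; move: le => /=; lia.
          apply: wp_set; apply: last => /=; rewrite ?a7 ?w7 ?ps7 ?sz7 ?addn1 //.
          + by rewrite Nv.
          + by move=> j; rewrite part_sizeS eqxx addn1.
          + by rewrite part_sizeS eqxx (_ : (_ <= h) = true) ?andbT //; move: le => /=; lia.
        + by rewrite /= /same take0 addn0.
        move=> b s7 Hb sb [Nv Na] Hkx.
        have o7 : sv s7 v_o = offset x by rewrite Nv.
        have a7 : sv s7 v_a = lab a by rewrite Nv.
        have inE7 : nth 0 inp (sv s7 v_o + sv s7 v_b) = nth 0 (ad x) b.
          by rewrite o7 sb (in_ad OK).
        set w := nth 0 (ad x) b in inE7.
        set lbw := if w \in take a xs then (lab (index w xs)).+1 else 0.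
        have lb7 : sa s7 a_lb w = lbw by rewrite Na //= Klb.
        have sameS : same b.+1 = same b + (lbw == (lab a).+1).
          rewrite /same (take_nth 0) // -cats1 count_cat /= addn0 -/w /lbw.
          by case: ifP => //= _; rewrite eqSS.
        apply: (wp_le (t := 1 + 3)) => //.
        apply/wp_seq/wp_set; rewrite /= inE7 lb7.
        apply: wp_if_le; rewrite /= a7 addn1 => le1.
          apply: wp_if_le; rewrite /= a7 addn1 => le2.
            apply: wp_set; split=> //=; rewrite Hkx sameS.
            by rewrite (_ : lbw == _) ?addn1 ?addnS //; lia.
          apply: wp_set; split=> //=; rewrite Hkx sameS ltn_eqF ?addn0 //.
        apply: (wp_le (t := 1)) => //; apply: wp_set; split=> //=.
        by rewrite Hkx sameS gtn_eqF ?addn0.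
      by move: (size (ad x)) => dx; clear; lia.
    + move=> j s3 Hj sj _ H; apply: wp_put; split=> //= i Hi; rewrite sj.
      by case: eqP => // nj; apply: H; lia.
  - by move=> w Hw /=; rewrite Fa // Hlb //; move: Hw; rewrite drop0.
  - move=> j s2 Hj sj _ H; apply: wp_put; split=> //= w Hw; rewrite sj (in_xs OK) //.
    case: eqP => // nj; apply: H; rewrite (drop_nth 0) ?(size_xs OK) // inE negb_or Hw andbT.
    exact/eqP.
rewrite (eq_bigr (fun a => 12 + 5 * size (ad (nth 0 xs a)))) //; lia.
Qed.

End Labelling.
End Search.

(** * Preparation and the search over all labellings *)

Definition p_prepare : com :=
  p_load;; p_powers a_pl (EV v_l) (EV v_l);; p_powers a_ps e_h1 e_2l;;
  v_nl <~ EA a_pl (EV v_l);; v_ns <~ EA a_ps e_2l;; v_pl <~ EA a_ps (EV v_l);;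
  p_mod;; p_off;; p_done;; p_order.

Definition p_main : com := p_prepare;; CFor v_lam (EV v_nl) p_labelling.

Section Main.
Variables (n m k h l : nat) (xs : seq nat) (ad : nat -> seq nat) (inp : seq nat).
Hypothesis OK : input_ok n m k h l xs ad inp.
Hypothesis h_gt0 : 0 < h.
Notation wp := (wp inp).
Notation loaded := (loaded n m k h l).
Notation offset := (offset n l ad).
Notation vertices := (vertices n xs ad).
Notation rank_of := (cluster_rank n xs ad).
Let R := h.+1.
Let N := R ^ (l + l).

Definition feasible (lab : nat -> nat) : Prop :=
  exists ch, [/\ size ch = size vertices, admissible l h (part_size lab l) ch &
    m <= k + (kept_inside l xs ad lab + total_gain h (label_gain n xs ad lab) rank_of ch)].

Lemma init_table_ok (lab : nat -> nat) s :
  sv s v_ns = N -> sv s v_kx = kept_inside l xs ad lab ->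
  sv s v_s0 = number R (part_size lab l) l ->
  (sv s v_bad == 0) = [forall j : 'I_l, part_size lab l j <= h] ->
  wp p_init_table s (1 + N * 2 + 2)
    (fun s' => tabulates l h (kept_inside l xs ad lab) (part_size lab l)
                 (label_gain n xs ad lab) rank_of 0 0 (sa s' a_t)).
Proof.
move=> EN Ekx Es0 Ebad; have E1 : eval inp s (EV v_ns) = N by [].
apply: wp_seq; eapply wp_conseq; [exact: leqnn| |apply: (wp_for (I := fun z s' =>
  forall i, i < z -> sa s' a_t i = 0) (t := 1) E1)] => //.
- move=> s1 [H0 _ [Fv Fa]]; apply: wp_if => /=; rewrite Fv // => Eb.
    apply: wp_set; apply: tabulates_init => z Hz.
    by rewrite -Ebad (negbTE Eb) /= H0.
  apply: wp_put; apply: tabulates_init => z Hz /=.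
  rewrite -Ebad Eb /= !Fv // Es0 Ekx addn1; case: eqP => // _; exact: H0.
- move=> z s' Hz sz _ H; apply: wp_put; split=> //= i Hi; rewrite sz.
  by case: eqP => // ni; apply: H; lia.
Qed.

Lemma check_ok s : loaded s -> sv s v_ns = N ->
  wp p_check s (1 + N * 4) (fun s' => sv s' v_res != 0 <->
    sv s v_res != 0 \/ exists2 z, z < N & (sa s a_t z != 0) && (m < sa s a_t z + k)).
Proof.
move=> [_ Em Ek _ _] EN; have E1 : eval inp s (EV v_ns) = N by [].
eapply wp_conseq; [exact: leqnn| |apply: (wp_for (I := fun z s' => sv s' v_res != 0 <->
    sv s v_res != 0 \/ exists2 i, i < z & (sa s a_t i != 0) && (m < sa s a_t i + k)) (t := 3) E1)].
- by move=> s' [].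
- by split=> /= [|[]//]; [left|case].
move=> z s' Hz sz [Fv Fa] IH.
have step b s1 : sv s1 v_z = z -> (sv s1 v_res != 0) = (sv s' v_res != 0) || b ->
    b = (sa s a_t z != 0) && (m < sa s a_t z + k) ->
    sv s1 v_z = z /\ (sv (setv (tick s1) v_z z.+1) v_res != 0 <->
    sv s v_res != 0 \/ exists2 i, i < z.+1 & (sa s a_t i != 0) && (m < sa s a_t i + k)).
  move=> K1 K2 Eb; split=> //; rewrite [sv _ v_res]/= K2; split.
    case/orP => [/IH[H|[i Hi H]]|Hb]; [by left|right|right].
      by exists i => //; apply: ltnW.
    by exists z; rewrite // -Eb.
  case=> [H|[i]]; first by apply/orP; left; apply/IH; left.
  rewrite ltnS leq_eqVlt => /predU1P[->|Hi] H; first by rewrite Eb H orbT.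
  by apply/orP; left; apply/IH; right; exists i.
apply: wp_if => /=; rewrite sz Fa // => T0; last first.
  apply: (wp_le (t := 1)) => //; apply: wp_set; apply: (step false) => //=; last by rewrite T0.
  by rewrite orbF.
apply: wp_if_le; rewrite /= sz Fa // !Fv // Em Ek => le.
  by apply: wp_set; apply: (step true) => //=; rewrite ?orbT // T0; lia.
by apply: wp_set; apply: (step false) => //=; rewrite ?orbF // T0; lia.
Qed.

Definition labelling_cost : nat :=
  (10 + l * (5 + 4 * l) + l * 4 + \sum_(0 <= a < l) (12 + 5 * size (ad (nth 0 xs a))))
  + ((1 + N * 2 + 2) +
     ((2 + \sum_(0 <= i < size vertices) (vertex_cost h l ad (nth 0 vertices i)).+1)
      + (1 + N * 4))).

(** The results of the preparation, which no labelling modifies. *)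
Definition prepared (s : store) : Prop :=
  [/\ loaded s, [/\ sv s v_cnt = size vertices, sv s v_ns = N & sv s v_pl = R ^ l],
  [/\ forall j, j < l -> sa s a_pl j = l ^ j, forall j, j < l + l -> sa s a_ps j = R ^ j &
      forall r, r <= n -> sa s a_mod r = r %% h] &
  [/\ forall u, u < n -> sa s a_off u = offset u,
      forall i, i < size vertices -> sa s a_ord i = nth 0 vertices i &
      forall i, i < size vertices -> (sa s a_st i != 0) = (rank_of i == 0)]].

Lemma prepared_frame vs ars s s' : frame vs ars s s' ->
  all (fun x => x \notin vs) [:: v_n; v_m; v_k; v_h; v_l; v_cnt; v_ns; v_pl] ->
  all (fun a => a \notin ars) [:: a_pl; a_ps; a_mod; a_off; a_ord; a_st] ->
  prepared s -> prepared s'.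
Proof.
move=> [V A] /allP Hv /allP Ha [[? ? ? ? ?] [? ? ?] [H1 H2 H3] [H4 H5 H6]].
by do !split; rewrite ?V ?Hv // => *; rewrite A ?Ha ?H1 ?H2 ?H3 ?H4 ?H5 ?H6.
Qed.

(** The first conclusion restores the last precondition for the next labelling: [a_lb] is written on
    [X] only. *)
Lemma labelling_ok s z : prepared s -> sv s v_lam = z -> z < l ^ l ->
  (forall w, w \notin xs -> sa s a_lb w = 0) ->
  wp p_labelling s labelling_cost
    (fun s' => (forall w, w \notin xs -> sa s' a_lb w = 0) /\
       (sv s' v_res != 0 <-> sv s v_res != 0 \/ feasible (fun a => digit l a z))).
Proof.
move=> P0 Ez Hz Hlb; pose lab a := digit l a z.
have lab_lt a : a < l -> lab a < l by move=> Ha; apply: digit_lt; apply: leq_ltn_trans Ha.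
have [L0 [Ec Ens Epl] [HPL HPS Hmod] [Hoff Hord Hst]] := P0.
apply/wp_seq/wp_frame; eapply wp_conseq; [exact: leqnn| |
  apply: (labels_ok OK lab_lt L0 Ez Hz) => //].
move=> s1 [Hlb1 Hkx Hs0 Hbad] F1.
have P1 : prepared s1 by apply: prepared_frame F1 _ _ P0.
apply/wp_seq/wp_frame; eapply wp_conseq; [exact: leqnn| |apply: (init_table_ok (lab := lab)) => //];
  last by case: P1 => _ [].
move=> s2 HT2 F2; have P2 : prepared s2 by apply: prepared_frame F2 _ _ P1.
have [L2 [Ec2 Ens2 Epl2] [HPL2 HPS2 Hmod2] [Hoff2 Hord2 Hst2]] := P2.
have Hlb2 w : sa s2 a_lb w = label_of xs lab w by case: F2 => _ ->.
apply/wp_seq/wp_frame; eapply wp_conseq; [exact: leqnn| |apply: (dp_ok OK (lab := lab)) => //].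
move=> s3 [q HT3] F3; have P3 : prepared s3 by apply: prepared_frame F3 _ _ P2.
have [L3 [_ Ens3 _] _ _] := P3.
apply/wp_frame; eapply wp_conseq; [exact: leqnn| |apply: check_ok => //].
move=> s4 Hres F4; split.
  move=> w nw; case: F4 => _ ->//; case: F3 => _ ->//; rewrite Hlb2.
  by rewrite /label_of (negbTE nw).
rewrite Hres; have -> : sv s3 v_res = sv s v_res.
  by case: F3 => ->//; case: F2 => ->//; case: F1 => ->.
have [S C] := HT3; split=> -[H|H]; [by left|right|by left|right].
  case: H => y Hy /andP[y0 Hm]; have [ch [si A Ey ETy]] := S y Hy y0.
  by exists ch; split=> //; move: Hm; rewrite ETy addSn ltnS addnC.
case: H => ch [si A Hm]; exists (encoding l h (part_size lab l) q ch); first exact: encoding_lt.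
have := C ch si A => lt; rewrite -lt0n (leq_ltn_trans _ lt) //=.
by apply: leq_ltn_trans Hm _; rewrite addnC ltn_add2r.
Qed.

Definition prepare_cost : nat :=
  5 + ((4 + l * (4 + 2 * l)) + ((4 + (l + l) * (4 + 2 * R)) + (1 + (1 + (1 +
   ((2 + n.+1 * 5) + ((2 + n * 2) + ((1 + l * 2) +
    (2 + \sum_(0 <= u < n) (9 + 6 * size (ad u))))))))))).

Definition start : store := Store (fun=> 0) (fun _ _ => 0) 0.

Lemma prepare_ok : wp p_prepare start prepare_cost
  (fun s => [/\ prepared s, sv s v_nl = l ^ l, sv s v_res = 0 & forall w, sa s a_lb w = 0]).
Proof.
have lf vs ars s s' : frame vs ars s s' ->
  all (fun x => x \notin vs) [:: v_n; v_m; v_k; v_h; v_l] -> loaded s -> loaded s'.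
  by move=> [V _] /allP Hv [? ? ? ? ?]; split; rewrite V ?Hv.
apply/wp_seq/wp_frame; eapply wp_conseq; [exact: leqnn| |exact: load_ok OK _].
move=> s1 L1 F1.
have [_ _ _ h1 l1] := L1.
apply/wp_seq/wp_frame; eapply wp_conseq; [exact: leqnn| |apply: (@powers_ok _ _ _ _ _ l l) => //].
move=> s2 HPL F2; have L2 := lf _ _ _ _ F2 isT L1; have [_ _ _ h2 l2] := L2.
apply/wp_seq/wp_frame; eapply wp_conseq; [exact: leqnn| |apply: (@powers_ok _ _ _ _ _ R (l + l)) => //];
  [|by rewrite /= h2 addn1|by rewrite /= l2].
move=> s3 HPS F3; have L3 := lf _ _ _ _ F3 isT L2; have [_ _ _ h3 l3] := L3.
have pl3 j : j <= l -> sa s3 a_pl j = l ^ j by move=> Hj; case: F3 => _ ->//; rewrite HPL.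
do 3 apply/wp_seq/wp_set.
set s4 := setv _ _ _.
have F4 : frame [:: v_nl; v_ns; v_pl] [::] s3 s4 by do 3 apply: frame_setv => //.
have nl4 : sv s4 v_nl = l ^ l by rewrite /= l3 pl3.
have ns4 : sv s4 v_ns = N by rewrite /= l3 HPS.
have pl4 : sv s4 v_pl = R ^ l by rewrite /= l3 HPS ?leq_addr.
have L4 := lf _ _ _ _ F4 isT L3.
apply/wp_seq/wp_frame; eapply wp_conseq; [exact: leqnn| |
  apply: (mod_ok (n := n) (m := m) (k := k) (h := h) (l := l)) => //].
move=> s5 Hmod F5; have L5 := lf _ _ _ _ F5 isT L4.
apply/wp_seq/wp_frame; eapply wp_conseq; [exact: leqnn| |apply: (offset_ok OK L5)].
move=> s6 Hoff F6; have L6 := lf _ _ _ _ F6 isT L5.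
apply/wp_seq/wp_frame; eapply wp_conseq; [exact: leqnn| |apply: (done_ok OK L6)]; last first.
  move=> w; case: F6 => _ ->//; case: F5 => _ ->//; case: F4 => _ ->//; case: F3 => _ ->//.
  by case: F2 => _ ->//; case: F1 => _ ->.
move=> s7 Hdone F7; have L7 := lf _ _ _ _ F7 isT L6.
apply/wp_frame; eapply wp_conseq; [exact: leqnn| |apply: (order_ok OK L7)] => //; first last.
- move=> i; case: F7 => _ ->//; case: F6 => _ ->//; case: F5 => _ ->//; case: F4 => _ ->//.
  by case: F3 => _ ->//; case: F2 => _ ->//; case: F1 => _ ->.
- by move=> u Hu; case: F7 => _ ->//; rewrite Hoff.
move=> s8 [Hcnt Hord Hst] F8; have L8 := lf _ _ _ _ F8 isT L7.
have F : frame (mod_vars (p_mod;; p_off;; p_done;; p_order))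
               (mod_arrays (p_mod;; p_off;; p_done;; p_order)) s4 s8.
  apply: frame_trans (frame_all _ _ F5) _ => //; apply: frame_trans (frame_all _ _ F6) _ => //.
  by apply: frame_trans (frame_all _ _ F7) (frame_all _ _ F8).
have [Vv Va] := F.
have [V4 A4] := F4.
split; [split=> //| | |].
- by split; rewrite // Vv.
- split=> [j Hj|j Hj|r Hr].
  + by rewrite Va // A4 // pl3 // ltnW.
  + by rewrite Va // A4 // HPS // ltnW.
  + by case: F8 => _ ->//; case: F7 => _ ->//; case: F6 => _ ->//; rewrite Hmod.
- by split=> // u Hu; case: F8 => _ ->//; case: F7 => _ ->//; rewrite Hoff.
- by rewrite Vv.
- by rewrite Vv // V4 //; case: F3 => ->//; case: F2 => ->//; case: F1 => ->.
- move=> w; rewrite Va // A4 //; case: F3 => _ ->//; case: F2 => _ ->//.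
  by case: F1 => _ ->.
Qed.

(** The loop variable, in base [l], is the labelling of [X]. For [l = 0] there is [0 ^ 0 = 1]
    labelling, the empty one, so the table is still computed once. *)
Lemma main_ok : wp p_main start (prepare_cost + (1 + l ^ l * labelling_cost.+1))
  (fun s => sv s v_res != 0 <-> exists2 z, z < l ^ l & feasible (fun a => digit l a z)).
Proof.
apply: wp_seq; eapply wp_conseq; [exact: leqnn| |exact: prepare_ok].
move=> s [P0 Enl Eres Hlb]; have E1 : eval inp s (EV v_nl) = l ^ l by [].
eapply wp_conseq; [exact: leqnn| |apply: (wp_for (I := fun z s' =>
  (forall w, w \notin xs -> sa s' a_lb w = 0) /\
  (sv s' v_res != 0 <-> exists2 y, y < z & feasible (fun a => digit l a y)))
  (t := labelling_cost) E1)].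
- by move=> s' [[_ H] _ _].
- by split=> [w _|]; [exact: Hlb|rewrite /= Eres; split=> // -[]].
move=> z s' Hz sz F0 [Hlb' IH]; have P' : prepared s' by apply: prepared_frame F0 _ _ P0.
apply/wp_frame; eapply wp_conseq; [exact: leqnn| |apply: (labelling_ok (z := z)) => //].
move=> s2 [Hlb2 Hres] [Fv Fa]; split; first by rewrite Fv.
split=> //; rewrite [sv _ v_res]/= Hres IH; split.
  by case=> [[y Hy Fy]|Fz]; [exists y => //; apply: ltnW|exists z].
case=> y; rewrite ltnS leq_eqVlt => /predU1P[->|Hy] Fy; [by right|by left; exists y].
Qed.

End Main.

(** * Feasible labellings and edge deletions *)

Lemma count_exchange (T : eqType) (s t : seq T) (P : pred T) : uniq s -> uniq t ->
  count (fun x => (x \in s) && P x) t = count (fun x => (x \in t) && P x) s.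
Proof.
move=> us ut; rewrite -!size_filter; apply: perm_size; apply: uniq_perm; rewrite ?filter_uniq //.
by move=> x; rewrite !mem_filter; case: (x \in s); case: (x \in t); case: (P x).
Qed.

Lemma filter_suffix (t : seq nat) (P : pred nat) :
  (forall i j, i < j -> j < size t -> P (nth 0 t i) -> P (nth 0 t j)) ->
  filter P t = drop (size t - count P t) t.
Proof.
elim: t => // x t IH Hs.
have IH' := IH (fun i j ij jt => Hs i.+1 j.+1 ij jt).
have le := count_size P t; rewrite /=; case Px: (P x) => /=; last by rewrite add0n subSn.
rewrite add1n subSS.
have all_t : all P t by apply/(all_nthP 0) => j Hj; apply: (Hs 0 j.+1).
move: (all_t); rewrite all_count => /eqP->.
by rewrite subnn (all_filterP all_t).
Qed.

Section Labellings.
Variables (n m k h l : nat) (xs : seq nat) (ad : nat -> seq nat) (inp : seq nat).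
Hypothesis OK : input_ok n m k h l xs ad inp.
Hypothesis h_gt0 : 0 < h.
Notation vertices := (vertices n xs ad).
Notation rank_of := (cluster_rank n xs ad).
Notation all_vertices := (xs ++ vertices).

Lemma uniq_all : uniq all_vertices.
Proof. exact: ord_uniq (vertices_inv OK). Qed.

Lemma perm_all_vertices : perm_eq (iota 0 n) all_vertices.
Proof.
apply: uniq_perm; rewrite ?iota_uniq ?uniq_all // => w; rewrite mem_iota add0n mem_cat.
case: (ltnP w n) => Hw /=; first by rewrite (mem_vertices OK) // orbN.
apply/esym/negbTE; rewrite negb_or; apply/andP; split; apply/negP.
  by move/(xs_lt OK); rewrite ltnNge Hw.
by move/(ord_lt (vertices_inv OK)); rewrite ltnNge Hw.
Qed.

(** As [X] comes first, an edge between [X] and a cluster is counted at its end outside [X], when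
    both labels are known. *)
Definition position (w : nat) : nat := index w all_vertices.

Lemma position_xs a u : a <= l -> (position u < a) = (u \in take a xs).
Proof.
move=> Ha; have [ux|ux] := boolP (u \in xs); last first.
  have -> : (u \in take a xs) = false by apply: contraNF ux; apply: mem_take.
  apply/negbTE; rewrite -leqNgt /position index_cat (negbTE ux) (size_xs OK); lia.
by rewrite /position index_cat ux in_take.
Qed.

Lemma position_vertices i u : i <= size vertices ->
  (position u < l + i) = (u \in xs) || (u \in take i vertices).
Proof.
move=> Hi; have [ux|ux] := boolP (u \in xs).
  by rewrite /position index_cat ux ltn_addr // -(size_xs OK) index_mem.
rewrite /position index_cat (negbTE ux) (size_xs OK) ltn_add2l /=.
by rewrite in_take_leq.
Qed.

Section Fixed.
Variables (lab : nat -> nat) (ch : seq nat).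
Hypotheses (lab_lt : forall a, a < l -> lab a < l) (size_ch : size ch = size vertices).

Definition labelling (w : nat) : nat :=
  if w \in xs then (lab (index w xs)).+1 else nth 0 ch (index w vertices).

Definition list_back_degree (f : nat -> nat) (w : nat) : nat :=
  count (fun u => (position u < position w) && (f u == f w)) (ad w).

Definition list_gain (f : nat -> nat) (w : nat) : nat :=
  if f w == 0 then list_back_degree f w %% h else list_back_degree f w.

Lemma labelling_xs a : a < l -> labelling (nth 0 xs a) = (lab a).+1.
Proof.
move=> Ha; rewrite /labelling mem_nth ?(size_xs OK) //.
by rewrite index_uniq ?(size_xs OK) ?(uniq_xs OK).
Qed.

Lemma uniq_vertices : uniq vertices.
Proof. by have := uniq_all; rewrite cat_uniq => /and3P[]. Qed.

Lemma vertices_notin w : w \in vertices -> w \notin xs.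
Proof. by move=> wv; rewrite -(mem_vertices OK) // (ord_lt (vertices_inv OK)). Qed.

Lemma labelling_vertices i : i < size vertices -> labelling (nth 0 vertices i) = nth 0 ch i.
Proof.
move=> Hi; rewrite /labelling (negbTE (vertices_notin _)) ?mem_nth //.
by rewrite index_uniq ?uniq_vertices.
Qed.

Lemma map_labelling : [seq labelling w | w <- vertices] = ch.
Proof.
apply: (@eq_from_nth _ 0) => [|i]; rewrite size_map // => Hi.
by rewrite (nth_map 0) // labelling_vertices.
Qed.

Lemma list_gain_xs a : a < l -> list_gain labelling (nth 0 xs a) = earlier_same xs ad lab a.
Proof.
move=> Ha; rewrite /list_gain /list_back_degree labelling_xs //=.
have -> : position (nth 0 xs a) = a.
  by rewrite /position index_cat mem_nth ?index_uniq ?(size_xs OK) ?(uniq_xs OK).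
apply: eq_in_count => u _; rewrite position_xs ?(ltnW Ha) //.
by case ut: (u \in take a xs) => //=; rewrite /labelling (mem_take ut) eqSS.
Qed.

(** The earlier neighbours with the same label are those in [X], counted by [label_gain], and those
    in the cluster, whose labels end [take i ch]. For label 0 the first kind is empty, since labels
    on [X] are positive. *)
Lemma list_gain_vertices i : i < size vertices ->
  list_gain labelling (nth 0 vertices i) =
  step_gain h (label_gain n xs ad lab) rank_of (take i ch) (nth 0 ch i).
Proof.
move=> Hi; rewrite /list_gain labelling_vertices //; set x := nth 0 ch i; set v := nth 0 vertices i.
have szt : size (take i ch) = i by rewrite size_takel // size_ch ltnW.
have szv : size (take i vertices) = i by rewrite size_takel // ltnW.
have pv : position v = l + i.
  rewrite /position index_cat (negbTE (vertices_notin _)) ?mem_nth //.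
  by rewrite index_uniq ?uniq_vertices // (size_xs OK).
have E : list_back_degree labelling v =
   count (fun u => (u \in xs) && (label_of xs lab u == x)) (ad v) +
   count_mem x (drop (i - rank_of i) (take i ch)).
  rewrite /list_back_degree pv labelling_vertices // -/x.
  (* Neighbours in the cluster are counted along the order instead of along the adjacency list; by
     contiguity they are the suffix selected by [drop]. *)
  have -> : count_mem x (drop (i - rank_of i) (take i ch)) =
     count (fun u => (u \in take i vertices) && (labelling u == x)) (ad v).
    rewrite count_exchange ?(uniq_ad OK) ?take_uniq ?uniq_vertices //.
    have fs := @filter_suffix (take i vertices) (fun u => u \in ad v).
    rewrite szv -/(rank_of i) in fs.
    rewrite -{1}map_labelling -map_take -map_drop -fs => [|a b ab bi]; last first.
      rewrite !nth_take //; last exact: ltn_trans ab bi.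
      exact: (ord_contiguous (vertices_inv OK)).
    by rewrite count_map count_filter; apply: eq_count => u /=; rewrite andbC.
  rewrite -count_predUI [X in _ = _ + X](eq_count (a2 := pred0)) ?count_pred0 ?addn0 => [|u /=].
    apply: eq_count => u /=; rewrite position_vertices ?(ltnW Hi) //.
    case ux: (u \in xs) => //=; rewrite /labelling /label_of ux //.
    by case: (_ == x); rewrite /= ?andbF.
  apply/negP => /andP[/andP[ux _] /andP[/mem_take/vertices_notin]]; by rewrite ux.
rewrite E /step_gain szt; case: eqP => [->|/eqP nx].
  rewrite (eq_count (a2 := pred0)) ?count_pred0 // => u /=.
  by rewrite /label_of; case: ifP.
congr (_ + _); apply: eq_count => u /=; rewrite /label_of.
by case: ifP => //=; rewrite eq_sym (negbTE nx).
Qed.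

Lemma list_gain_sum : \sum_(0 <= w < n) list_gain labelling w =
  kept_inside l xs ad lab + total_gain h (label_gain n xs ad lab) rank_of ch.
Proof.
rewrite /index_iota subn0 (perm_big _ perm_all_vertices) big_cat /=; congr (_ + _).
  rewrite (big_nth 0) (size_xs OK) /kept_inside.
  by apply: eq_big_nat => a /andP[_ Ha]; apply: list_gain_xs.
rewrite (big_nth 0) /total_gain size_ch.
by apply: eq_big_nat => i /andP[_ Hi]; apply: list_gain_vertices.
Qed.

Lemma count_labelling j : count (fun w => labelling w == j.+1) (iota 0 n) =
  part_size lab l j + count_mem j.+1 ch.
Proof.
rewrite (permP perm_all_vertices) count_cat; congr (_ + _); last by rewrite -{1}map_labelling count_map.
have {1}-> : xs = [seq nth 0 xs a | a <- iota 0 l].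
  by rewrite -(size_xs OK) -/(mkseq _ _) mkseq_nth.
rewrite count_map; apply: eq_in_count => a; rewrite mem_iota => /andP[_ Ha] /=.
by rewrite labelling_xs ?eqSS.
Qed.

End Fixed.
End Labellings.

Lemma iota_recr n : iota 0 n.+1 = iota 0 n ++ [:: n].
Proof. by rewrite -addn1 iotaD. Qed.

Lemma size_flatten_iota (s : nat -> seq nat) n :
  size (flatten [seq s i | i <- iota 0 n]) = \sum_(0 <= i < n) size (s i).
Proof.
elim: n => [|n IH]; first by rewrite big_geq.
by rewrite iota_recr big_nat_recr //= map_cat flatten_cat size_cat IH /= cats0.
Qed.

Lemma nth_flatten_iota (s : nat -> seq nat) n u b : u < n -> b < size (s u) ->
  nth 0 (flatten [seq s i | i <- iota 0 n]) (\sum_(0 <= i < u) size (s i) + b) = nth 0 (s u) b.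
Proof.
elim: n => // n IH; rewrite ltnS leq_eqVlt iota_recr map_cat flatten_cat nth_cat => Hu Hb.
rewrite size_flatten_iota /= cats0; case/predU1P: Hu => [Eu|Hu].
  by rewrite -Eu ltnNge leq_addr /= addKn.
rewrite ifT ?IH // (big_cat_nat (n := u.+1) _ Hu) //= big_nat_recr //=.
by rewrite -addnA ltn_add2l ltn_addr.
Qed.

(** * Transfer to graphs on ordinals *)

Section Instance.
Variables (n : nat) (e : rel 'I_n) (k h : nat) (X : {set 'I_n}).
Variables (xs : seq 'I_n) (adj : 'I_n -> seq 'I_n).
Hypotheses (e_sym : symmetric e) (e_irr : irreflexive e) (h_gt0 : 0 < h).
Hypotheses (cvd : cluster_vertex_deletion_set e X) (xs_uniq : uniq xs) (xsX : xs =i X).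
Hypothesis adjP : adjacency_lists e adj.

Let m := #|edges e|.
Let l := #|X|.
Let inp := encode e k h xs adj.

Definition xs_nat : seq nat := [seq val x | x <- xs].
Definition adj_nat (u : nat) : seq nat :=
  if insub u is Some v then [seq val w | w <- adj v] else [::].

Lemma adj_natE (v : 'I_n) : adj_nat v = [seq val w | w <- adj v].
Proof. by rewrite /adj_nat valK. Qed.

Lemma mem_adj_nat (v w : 'I_n) : (val w \in adj_nat v) = e v w.
Proof. by rewrite adj_natE mem_map ?(adjP v).2 //; apply: val_inj. Qed.

Lemma adj_nat_ord u w : w \in adj_nat u ->
  exists v v' : 'I_n, [/\ u = v, w = v' & e v v'].
Proof.
rewrite /adj_nat; case: insubP => [v _ Ev|//] /mapP[v' v'v ->].
by exists v, v'; rewrite Ev -(adjP v).2.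
Qed.

Lemma mem_xs_nat (v : 'I_n) : (val v \in xs_nat) = (v \in X).
Proof. by rewrite mem_map ?xsX //; apply: val_inj. Qed.

Lemma size_xs_nat : size xs_nat = l.
Proof. by rewrite size_map /l -(card_uniqP xs_uniq); apply: eq_card. Qed.

Lemma cluster_trans (u v w : 'I_n) : u \notin X -> v \notin X -> w \notin X ->
  e u v -> e v w -> u != w -> e u w.
Proof.
case: cvd => P _ HP uX vX wX; rewrite !HP ?inE //.
by move=> /andP[_ /eqP->] /andP[_ ->] ->.
Qed.

Lemma encodeE : inp = [:: n; m; k; h; l] ++ xs_nat
  ++ [seq size (adj_nat u) | u <- iota 0 n] ++ flatten [seq adj_nat u | u <- iota 0 n].
Proof.
rewrite /inp /encode -size_xs_nat size_map -/m; congr (_ ++ _ ++ _ ++ _).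
  by rewrite -val_enum_ord -map_comp; apply: eq_map => u; rewrite /= adj_natE size_map.
rewrite map_flatten -map_comp -val_enum_ord -map_comp; congr flatten.
by apply: eq_map => u; rewrite /= adj_natE.
Qed.

Lemma input_okP : input_ok n m k h l xs_nat adj_nat inp.
Proof.
have H i : nth 0 inp (5 + i) = nth 0 (xs_nat
  ++ [seq size (adj_nat u) | u <- iota 0 n] ++ flatten [seq adj_nat u | u <- iota 0 n]) i.
  by rewrite encodeE.
split; rewrite ?size_xs_nat //; try by rewrite encodeE.
- by move=> a Ha; rewrite H nth_cat size_xs_nat Ha.
- move=> u Hu; rewrite -addnA H nth_cat size_xs_nat ltnNge leq_addr /= addKn.
  by rewrite nth_cat size_map size_iota Hu (nth_map 0) ?size_iota // nth_iota.
- move=> u b Hu Hb; rewrite /offset -!addnA H nth_cat size_xs_nat ltnNge leq_addr /= addKn.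
  by rewrite nth_cat size_map size_iota ltnNge leq_addr /= addKn nth_flatten_iota.
- by rewrite map_inj_uniq //; apply: val_inj.
- by move=> _ /mapP[x _ ->]; apply: ltn_ord.
- by move=> u _ /adj_nat_ord[v [v' [_ -> _]]]; apply: ltn_ord.
- rewrite /adj_nat => u; case: insubP => // v _ _; rewrite map_inj_uniq ?(adjP v).1 //.
  exact: val_inj.
- by move=> _ _ _ /adj_nat_ord[v [v' [-> -> evv']]]; rewrite mem_adj_nat e_sym.
- by move=> u; apply/negP => /adj_nat_ord[v [v' [-> /val_inj-> ]]]; rewrite e_irr.
- move=> u0 v0 w0 uX vX wX /adj_nat_ord[u [v [Eu Ev euv]]] /adj_nat_ord[v' [w [Ev' Ew evw]]].
  move: uX vX wX; rewrite {}Eu {}Ew Ev !mem_xs_nat mem_adj_nat => uX vX wX nuw.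
  have Evv : v = v' by apply: val_inj; rewrite /= -Ev -Ev'.
  by apply: (cluster_trans uX vX wX) => //; rewrite Evv.
Qed.

Let OK := input_okP.

(** A degree splits into earlier and later neighbours, and either kind adds up to the number of
    edges. *)
Lemma sum_degrees : \sum_(0 <= u < n) size (adj_nat u) = m + m.
Proof.
rewrite big_mkord {1}/m (card_edges val_inj e_sym e_irr) {1}/m (card_edges val_inj e_sym e_irr).
have E : \sum_v #|[set w : 'I_n | (val w < val v) && e v w]| =
         \sum_v #|[set w : 'I_n | (val v < val w) && e v w]|.
  under eq_bigr => v _ do rewrite -sum1dep_card big_mkcond.
  rewrite exchange_big /=; apply: eq_bigr => v _; rewrite -sum1dep_card [RHS]big_mkcond.
  by apply: eq_bigr => w _; rewrite e_sym.
rewrite {2}E -big_split /=; apply: eq_bigr => v _.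
rewrite adj_natE size_map -(card_uniqP (adjP v).1) -cardsUI addnC [X in X + _]eq_card0 ?add0n; last first.
  move=> w; rewrite !inE; apply/negP => /andP[/andP[H1 _] /andP[H2 _]].
  by move: (ltn_trans H1 H2); rewrite ltnn.
apply: eq_card => w; rewrite !inE -andb_orl (adjP v).2 -neq_ltn.
by case: eqP => //= /val_inj->; rewrite e_irr.
Qed.

Lemma size_encode : size inp = n + m + m + l + 5.
Proof.
rewrite encodeE !size_cat size_xs_nat size_map size_iota size_flatten_iota sum_degrees /=; lia.
Qed.

Let pos (v : 'I_n) : nat := position n xs_nat adj_nat v.

Lemma pos_inj : injective pos.
Proof.
move=> v w E; apply: val_inj.
have I (u : 'I_n) : val u \in xs_nat ++ vertices n xs_nat adj_nat.
  by rewrite -(perm_mem (perm_all_vertices OK)) mem_iota add0n ltn_ord.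
by rewrite -(nth_index 0 (I v)) -(nth_index 0 (I w)); congr nth.
Qed.

Lemma gainE (f : nat -> nat) (v : 'I_n) :
  gain e pos h (fun v : 'I_n => f v) v = list_gain n h xs_nat adj_nat f v.
Proof.
have E : back_degree e pos (fun v : 'I_n => f v) v = list_back_degree n xs_nat adj_nat f v.
  rewrite /list_back_degree adj_natE count_map -size_filter.
  rewrite -(card_uniqP (filter_uniq _ (adjP v).1)); apply: eq_card => w.
  by rewrite inE mem_filter (adjP v).2 /= -andbA; congr (_ && _); apply: andbC.
by rewrite /gain /list_gain E.
Qed.

Lemma sum_gain (f : nat -> nat) :
  \sum_v gain e pos h (fun v : 'I_n => f v) v = \sum_(0 <= w < n) list_gain n h xs_nat adj_nat f w.
Proof. by rewrite big_mkord; apply: eq_bigr => v _; rewrite gainE. Qed.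

Lemma card_label (f : nat -> nat) (j : nat) :
  #|[set v : 'I_n | f v == j]| = count (fun w => f w == j) (iota 0 n).
Proof.
rewrite -val_enum_ord count_map cardE /enum_mem -size_filter.
rewrite -filter_predI -enumT /=; congr size; apply: eq_filter => v /=.
by rewrite inE andbT.
Qed.

Lemma feasible_sound z : z < l ^ l ->
  feasible n m k h l xs_nat adj_nat (fun a => digit l a z) -> Tfree_edge_deletion e k h.
Proof.
set lab := fun a => digit l a z => _ [ch [sch [al A] Hm]].
have lab_lt a : a < l -> lab a < l by move=> Ha; apply: digit_lt; apply: leq_ltn_trans Ha.
pose f := labelling n xs_nat adj_nat lab ch.
have fle (v : 'I_n) : f v <= l.
  rewrite /f /labelling; case: ifP => vx.
    by apply: lab_lt; rewrite -size_xs_nat index_mem.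
  case: (ltnP (index (val v) (vertices n xs_nat adj_nat)) (size ch)) => Hi.
    by apply: (allP al); apply: mem_nth.
  by rewrite nth_default.
apply: (@labelling_sound _ e X pos h e_sym e_irr pos_inj h_gt0 cluster_trans l (fun v : 'I_n => f v)).
  split=> [v|v|[//|j] _].
  - by rewrite -mem_xs_nat /f /labelling => ->.
  - exact: fle.
  (* Admissibility bounds the classes of the labels up to [l]; larger labels do not occur. *)
  rewrite card_label (count_labelling OK) //; case: (ltnP j l) => [/A//|lj].
  rewrite -(@count_labelling _ _ _ _ _ _ _ _ OK) // -card_label.
  rewrite eq_card0 // => v; rewrite !inE; apply/negP => /eqP Ev.
  by have := fle v; rewrite /f Ev ltnNge lj.
by rewrite sum_gain (list_gain_sum OK).
Qed.

Lemma feasible_complete : Tfree_edge_deletion e k h ->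
  exists2 z, z < l ^ l & feasible n m k h l xs_nat adj_nat (fun a => digit l a z).
Proof.
case/(labelling_complete e_sym e_irr pos_inj cluster_trans) => f [fX fle fh] Hm.
pose fn (w : nat) := if insub w is Some v then f v else 0.
have fnE (v : 'I_n) : fn v = f v by rewrite /fn valK.
(* Labels on [X] lie between 1 and [l], so their predecessors are digits in base [l], and [z] is the
   index of this labelling in the search. *)
pose lab a := (fn (nth 0 xs_nat a)).-1.
pose z := number l lab l.
have xa a : a < l -> exists2 v : 'I_n, nth 0 xs_nat a = v & v \in X.
  rewrite -size_xs_nat => Ha; have := mem_nth 0 Ha; case/mapP => v; rewrite xsX => vX Ev.
  by exists v.
have lab_lt a : a < l -> lab a < l.
  move=> Ha; have [v Ev vX] := xa a Ha; rewrite /lab Ev fnE.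
  by have := fX v vX; have := fle v; rewrite -/l; lia.
have digE a : a < l -> digit l a z = lab a.
  by move=> Ha; apply: digit_number => //; apply: leq_ltn_trans Ha.
exists z; first by apply: number_lt => a; apply: lab_lt.
pose ch := [seq fn w | w <- vertices n xs_nat adj_nat].
have sch : size ch = size (vertices n xs_nat adj_nat) by rewrite size_map.
set dlab := fun a => digit l a z.
have labE (v : 'I_n) : labelling n xs_nat adj_nat dlab ch v = f v.
  rewrite /labelling; case: ifP => vx.
    have Ha : index (val v) xs_nat < l by rewrite -size_xs_nat index_mem.
    rewrite /dlab digE // /lab nth_index // fnE prednK // fX // -mem_xs_nat //.
  have vv : val v \in vertices n xs_nat adj_nat.
    by rewrite (mem_vertices OK) ?ltn_ord //; apply: (negbT vx).
  by rewrite /ch (nth_map 0) ?index_mem // nth_index.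
exists ch; split=> //.
  split.
    apply/allP => _ /mapP[w wv ->].
    by rewrite -[w]/(val (Ordinal (ord_lt (vertices_inv OK) wv))) fnE.
  move=> j Hj; rewrite -(count_labelling OK) // -card_label.
  apply: leq_trans (fh j.+1 isT); apply: subset_leq_card; apply/subsetP => v.
  by rewrite !inE labE.
have dlab_lt a : a < l -> dlab a < l by move=> Ha; rewrite /dlab digE ?lab_lt.
rewrite -(list_gain_sum OK) // -sum_gain.
apply: leq_trans Hm _; rewrite leq_add2l; apply: leq_sum => v _.
have eqB : back_degree e pos (fun v : 'I_n => labelling n xs_nat adj_nat dlab ch v) v =
    back_degree e pos f v by apply: eq_card => w; rewrite !inE !labE.
by rewrite /gain eqB labE.
Qed.

End Instance.

(** * Running time *)

(** Let [b] be the base on the right. If [l > 0], then [(l + 1) * (h + 1) <= 4 * l * h <= b ^ 2],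
    and the exponent becomes [2 * 4 * l], whence the 8. If [l = 0], both exponents vanish and
    [0 ^ 0 = 1]. *)
Lemma cost_bound_le h l : 0 < h ->
  ((l.+1 * h.+1) ^ l) ^ 4 <= (2 ^ l * l * h ^ 2) ^ (8 * (2 ^ l * l * h)).
Proof.
move=> h_gt0; case: (posnP l) => [l0|l0]; first by rewrite l0 !muln0 !expn0.
set b := 2 ^ l * l * h ^ 2.
have p2 : 2 <= 2 ^ l by rewrite -{1}[2]expn1 leq_exp2l.
have b2 : 2 <= b.
    rewrite /b -[2]muln1 leq_mul ?expn_gt0 ?h_gt0 //.
    by rewrite -[2]muln1 leq_mul.
have Zb : l.+1 * h.+1 <= b ^ 2.
  have lh : l.+1 * h.+1 <= 2 * l * (2 * h) by apply: leq_mul; lia.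
  have b_ge : 2 * l * h <= b by rewrite /b leq_mul ?leq_mul // -mulnn leq_pmulr.
  by rewrite -mulnn; have := leq_mul b2 b_ge; lia.
rewrite -expnM; apply: leq_trans (_ : (b ^ 2) ^ (l * 4) <= _).
  by rewrite leq_exp2r // muln_gt0 l0.
rewrite -expnM leq_exp2l //; nia.
Qed.

Section CostBound.
Variables (n m k h l : nat) (xs : seq nat) (ad : nat -> seq nat) (inp : seq nat).
Hypothesis OK : input_ok n m k h l xs ad inp.
Hypotheses (h_gt0 : 0 < h) (sum_deg : \sum_(0 <= u < n) size (ad u) = m + m).

Let M := maxn 1 (n + m).
Let U := (l.+1 * h.+1) ^ l.

Lemma sum_size_lists :
  \sum_(0 <= a < l) size (ad (nth 0 xs a)) +
  \sum_(0 <= i < size (vertices n xs ad)) size (ad (nth 0 (vertices n xs ad) i)) = m + m.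
Proof.
have := sum_deg; rewrite /index_iota subn0 (perm_big _ (perm_all_vertices OK)) big_cat /=.
by rewrite (big_nth 0) [X in _ + X = _ -> _](big_nth 0) (size_xs OK) /index_iota subn0.
Qed.

Lemma l_le_n : l <= n.
Proof.
rewrite -(size_xs OK) -[X in _ <= X](size_iota 0); apply: uniq_leq_size (uniq_xs OK) _.
by move=> x /(xs_lt OK); rewrite mem_iota.
Qed.

(** The fourth power collects one factor [U] for the [l ^ l] labellings, two for the
    [h.+1 ^ (l + l)] states and one for the work per state, at most [41 * U]. Degrees enter only
    through their sum, so [M] is a linear factor; 400 is a generous constant. *)
Lemma main_cost_le :
  prepare_cost n h l ad + (1 + l ^ l * (labelling_cost n h l xs ad).+1) <= 400 * U ^ 4 * M.
Proof.
have U1 : 0 < U by rewrite expn_gt0.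
have ZU : 0 < l -> l.+1 * h.+1 <= U.
  by move=> l0; rewrite -{1}[_ * _]expn1 leq_exp2l //; nia.
have lU : l * h.+1 <= U by case: (posnP l) => [->|/ZU]; [rewrite mul0n|nia].
have llU : l ^ l <= U by case: (posnP l) => [->|l0]; [|rewrite leq_exp2r //; nia].
have RU : h.+1 ^ l <= U by case: (posnP l) => [->|l0]; [|rewrite leq_exp2r //; nia].
have NU : h.+1 ^ (l + l) <= U * U by rewrite expnD leq_mul.
have lU1 : l <= U by nia.
have ln := l_le_n; have Sn := size_vertices OK; have sums := sum_size_lists.
rewrite /prepare_cost /labelling_cost /vertex_cost /step_cost.
have st : (13 + 9 * l + (l + l) * (5 + 4 * h.+1)).+1 <= 41 * U by lia.
move: (h.+1 ^ (l + l)) (l ^ l) (13 + 9 * l + (l + l) * (5 + 4 * h.+1)).+1 NU llU st.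
move=> N LL St NU llU st.
rewrite [\sum_(0 <= i < size _) _](eq_bigr (fun i => 15 + 2 * l.+1 + N * 7 + N * St
  + 3 * size (ad (nth 0 (vertices n xs ad) i)))); last by move=> i _; lia.
rewrite !big_split /= -!big_distrr /= !sum_nat_const_nat !subn0 sum_deg.
move: (size (vertices n xs ad)) Sn sums => S Sn.
set dX := \sum_(0 <= a < l) _; set dV := \sum_(0 <= i < S) _ => sums.
set R := h.+1 in lU *.
have M1 : 1 <= M /\ n + m <= M by rewrite /M; lia.
case: M1 => M1 nmM.
have UU : U <= U * U by rewrite leq_pmull.
have U3 : U * U <= U * U * U by rewrite leq_pmulr.
have NSt : N * St <= 41 * (U * U * U) by rewrite mulnC; have := leq_mul NU st; lia.
have ll : l * l <= U * U by apply: leq_mul.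
set W := U * U * U in U3 NSt *.
have W1 : 0 < W by rewrite !muln_gt0 U1.
have WM : W <= W * M by rewrite leq_pmulr.
have MW : M <= W * M by rewrite leq_pmull.
have Sc : S * (15 + 2 * l.+1 + N * 7 + N * St) <= 67 * (W * M).
  have : 15 + 2 * l.+1 + N * 7 + N * St <= 67 * W by lia.
  have SM : S <= M by lia.
  by move/(leq_mul SM); lia.
have U4 : 400 * U ^ 4 * M = 400 * (U * (W * M)) by rewrite /W !expnS expn0; lia.
have UWM : W * M <= U * (W * M) by rewrite leq_pmull.
rewrite {}U4; set lc := (X in LL * X).
have Llc : lc <= 131 * (W * M) by rewrite /lc; lia.
have := leq_mul llU Llc; rewrite mulnCA => H.
lia.
Qed.

End CostBound.

(** Computes the length of the input, [n + 2 * m + l + 5], from its header. The arrays lie above it,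
    where memory is initially 0. *)
Definition p_base : prog :=
  Seq (Const (rt 1) 0) (Seq (Read (rt 0) (rt 1))
  (Seq (Const (rt 1) 1) (Seq (Read (rt 2) (rt 1))
  (Seq (Add (rt 0) (rt 0) (rt 2)) (Seq (Add (rt 0) (rt 0) (rt 2))
  (Seq (Const (rt 1) 4) (Seq (Read (rt 2) (rt 1))
  (Seq (Add (rt 0) (rt 0) (rt 2))
  (Seq (Const (rt 2) 5) (Add (rt 0) (rt 0) (rt 2))))))))))).

Lemma base_ok inp base :
  size inp <= base -> base = nth 0 inp 0 + nth 0 inp 1 + nth 0 inp 1 + nth 0 inp 4 + 5 ->
  exists s, exec p_base (init_state inp) 11 s /\ rel_state inp base start s.
Proof.
move=> le_base Ebase.
have exS p q s s1 t s2 : exec p s 1 s1 -> exec q s1 t s2 -> exec (Seq p q) s t.+1 s2.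
  exact: exec_seq.
eexists; split.
  by do 10 (eapply exS; first by constructor); constructor.
split=> [|x|i _|a i] /=.
- by rewrite Ebase.
- have even r : odd r -> (rv x == r) = false.
    by move=> odd_r; apply: contraTF odd_r => /eqP <-; rewrite odd_double.
  by rewrite !even.
- by [].
- by rewrite nth_default // (leq_trans le_base) // leq_addr.
Qed.

Theorem theorem2 :
  exists (p : prog) (c d : nat),
  forall (n : nat) (e : rel 'I_n) (k h : nat) (X : {set 'I_n})
         (xs : seq 'I_n) (adj : 'I_n -> seq 'I_n),
    symmetric e -> irreflexive e ->
    0 < k -> 0 < h ->
    cluster_vertex_deletion_set e X ->
    uniq xs -> xs =i X -> adjacency_lists e adj ->
    let m := #|edges e| in
    let l := #|X| in
    exists (t : nat) (s : state),
      [/\ exec p (init_state (encode e k h xs adj)) t s,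
          accepting s <-> Tfree_edge_deletion e k h &
          t <= c * (2 ^ l * l * h ^ 2) ^ (d * (2 ^ l * l * h)) * maxn 1 (n + m)].
Proof.
(* 11 steps compute [base], each tick costs at most [csize p_main] steps, 400 comes from
   [main_cost_le] and 8 from [cost_bound_le]. *)
exists (Seq p_base (compile 1 p_main)), (11 + csize p_main * 400), 8.
move=> n e k h X xs adj e_sym e_irr _ h0 cvd xs_uniq xsX adjP m l.
set inp := encode e k h xs adj.
have OK := input_okP k h e_sym e_irr cvd xs_uniq xsX adjP.
have size_inp := size_encode k e_sym e_irr h0 xs_uniq xsX adjP.
have [|s0 [X0 R0]] := base_ok (eq_leq size_inp).
  by rewrite (in_n OK) (in_m OK) (in_l OK).
have [t [s1 [X1 R1 _ T1]]] := compile_ok (eq_leq size_inp) p_main (isT : 0 < 1) R0.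
have [Hres Hck] := main_ok OK h0.
move: R1 T1 Hres Hck; move: (run _ p_main start) => s2 R1.
rewrite (_ : ck start = 0) // muln0 addn0 add0n => T1 Hres Hck.
exists (11 + t), s1; split.
- exact: exec_seq X0 X1.
- case: R1 => _ V1 _ _; rewrite /accepting (V1 0) Hres; split.
    by case=> z Hz; apply: (feasible_sound e_sym e_irr h0 cvd xs_uniq xsX adjP Hz).
  exact: (feasible_complete e_sym e_irr h0 cvd xs_uniq xsX adjP).
rewrite -/l -/m.
have cost := main_cost_le OK h0 (sum_degrees e_sym e_irr adjP).
have pow := @cost_bound_le h l h0.
move: T1 cost pow Hck; rewrite -/m -/l; move: (csize _) (ck s2) => c cks.
set T := prepare_cost _ _ _ _ + _; set U := (l.+1 * h.+1) ^ l.
set B := _ ^ (8 * _); set M := maxn 1 _ => T1 cost pow Hck.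
have B1 : 0 < B by apply: leq_trans pow; rewrite !expn_gt0.
have M1 : 0 < M by rewrite /M; lia.
have TB : T <= 400 * (B * M).
  by apply: leq_trans cost _; rewrite -mulnA leq_mul2l leq_mul2r pow orbT.
have BM : 0 < B * M by rewrite muln_gt0 B1.
have : t <= c * (400 * (B * M)).
  by apply: leq_trans T1 _; rewrite leq_mul2l (leq_trans Hck) ?orbT.
rewrite -mulnA mulnDl -mulnA => Ht; lia.
Qed.
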